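(* Assume in addition $\kappa\in C^3_{\mathrm{per}}([0,T];L^\infty(D))$. There exists a constant $C_0$ independent of $h$ and $K$ such that whenever $$K>C_0\,C_{\mathrm{inv}}(h)^2,$$ the following holds. (i) (Absorbing boundary condition, $\kappa_0>0$.) Every eigenvalue $\omega_{h,K}$ of the fully discrete coupled harmonics eigenvalue problem in the first Brillouin zone satisfies $\operatorname{Im}\omega_{h,K}\le C_\kappa'$. (ii) (Homogeneous Neumann boundary condition, $\kappa_0=0$.) Every eigenvalue $\omega_{h,K}$ of the fully discrete coupled harmonics eigenvalue problem in the first Brillouin zone satisfies $|\operatorname{Im}\omega_{h,K}|\le C_\kappa'$. Here $$C_\kappa'=\frac2T\int_0^T\left\|\frac{\kappa'(s)_+}{\kappa(s)}\right\|_{L^\infty(D)}\mathrm ds .$$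
   Context: $D\subset\mathbb R^d$ is a bounded Lipschitz domain with boundary $\Gamma$, $T>0$, $\Omega=2\pi/T$; $\kappa_0>0$ is a fixed constant for the absorbing boundary condition and $\kappa_0=0$ for the homogeneous Neumann boundary condition. The real-valued coefficient $\kappa\in C^1_{\mathrm{per}}(0,T;L^\infty(D))$ is $T$-periodic and $C^1$ in time with values in $L^\infty(D)$, with $0<c_\kappa=\operatorname*{ess\,inf}_{D\times[0,T]}\kappa\le\operatorname*{ess\,sup}_{D\times[0,T]}\kappa=C_\kappa<\infty$; $\kappa'=\partial_t\kappa$, $\kappa'_+=\max(\kappa',0)$. Its Fourier coefficients are defined by $\kappa(x,t)=\sum_{n\in\mathbb Z}\widehat\kappa_n(x)e^{-in\Omega t}$. $C^3_{\mathrm{per}}$ denotes $T$-periodic $C^3$ functions of time. $(X_h)_{h>0}$ is a family of finite-dimensional subspaces of (complex-valued) $H^1(D)$, with mesh width $h\to0$, and $C_{\mathrm{inv}}(h)$ is a constant with $\|\nabla u_h\|_{L^2(D)}\le C_{\mathrm{inv}}(h)\|u_h\|_{L^2(D)}$ for all $u_h\in X_h$; it tends to infinity as $h\to0$. For a positive integer $K$ put $\widehat V_{h,K}=X_h^{2K+1}$ with elements $\widehat u=(\widehat u_n)_{|n|\le K}$. Let $(\widehat\varphi,\widehat\psi)_{K,D}=\sum_{|n|\le K}(\widehat\varphi_n,\widehat\psi_n)_{L^2(D)}$ and $(\widehat\varphi,\widehat\psi)_{K,\Gamma}=\sum_{|n|\le K}(\widehat\varphi_n,\widehat\psi_n)_{L^2(\Gamma)}$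 (conjugate-linear in the test function, written first), $(\mathcal D\widehat u)_n=-in\Omega\widehat u_n$, and $(\mathcal T_\kappa\nabla\widehat u)_n=\sum_{|m|\le K}\widehat\kappa_{n-m}\nabla\widehat u_m$ with the gradient acting entrywise. Fully discrete coupled harmonics eigenvalue problem: find $\omega_{h,K}\in\mathbb C$ and a nontrivial $(\widehat u,\widehat z)\in\widehat V_{h,K}^2$ such that for all $(\widehat v,\widehat\eta)\in\widehat V_{h,K}^2$ $$(\widehat v,\mathcal D\widehat u-\widehat z)_{K,D}=i\omega_{h,K}(\widehat v,\widehat u)_{K,D},$$ $$(\widehat\eta,\mathcal D\widehat z)_{K,D}+(\nabla\widehat\eta,\mathcal T_\kappa\nabla\widehat u)_{K,D}+\kappa_0(\widehat\eta,\widehat z)_{K,\Gamma}=i\omega_{h,K}(\widehat\eta,\widehat z)_{K,D}.$$ ''In the first Brillouin zone'' means $\operatorname{Re}\omega_{h,K}\in(-\Omega/2,\Omega/2]$. *)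

(* Defs.v *)
From HB Require Import structures.
From mathcomp Require Import all_boot all_order all_algebra.
From mathcomp Require Import all_classical all_reals all_analysis.
From mathcomp Require Import complex.

Set Implicit Arguments.
Unset Strict Implicit.
Unset Printing Implicit Defensive.

Import Order.TTheory GRing.Theory Num.Theory.
Import numFieldNormedType.Exports.

Local Open Scope classical_set_scope.
Local Open Scope ring_scope.
Local Open Scope complex_scope.

(* MathComp-Analysis has Lebesgue measure on R only.  Lebesgue measure on R^d
   and surface measure are obtained by Caratheodory's construction [mu_ext]
   from a set function defined on all subsets of R^d; [all_sets] is a copy of
   R^d in which every set is measurable, so that covers are unrestricted. *)
Definition all_sets (R : realType) (n : nat) : Type := 'rV[R]_n.

HB.instance Definition _ (R : realType) n := Pointed.on (all_sets R n).
HB.instance Definition _ (R : realType) n :=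
  @isMeasurable.Build default_measure_display (all_sets R n)
    discrete_measurable (@discrete_measurable0 _) (@discrete_measurableC _)
    (@discrete_measurableU _).

Section set_functions.
Context (R : realType) (n : nat).
Implicit Types (A B : set 'rV[R]_n) (x a b : 'rV[R]_n).
Local Open Scope ereal_scope.

Definition box a b : set 'rV[R]_n :=
  [set x | forall i, (a 0 i <= x 0 i <= b 0 i)%R].

Definition box_volumes A : set (\bar R) :=
  [set y | exists ab : 'rV[R]_n * 'rV[R]_n,
     [/\ forall i, (ab.1 0 i <= ab.2 0 i)%R, A `<=` box ab.1 ab.2 &
         y = (\prod_i (ab.2 0 i - ab.1 0 i))%:E]].

Definition box_gauge A : \bar R :=
  if A == set0 then 0 else ereal_inf (box_volumes A).

Definition lebesgue_outer A : \bar R :=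
  mu_ext (box_gauge : set (all_sets R n) -> \bar R) A.

(* The norm of the library on matrices is the sup norm. *)
Definition enorm x : R := Num.sqrt (\sum_i x 0 i ^+ 2).

Definition diam A : \bar R :=
  ereal_sup [set y | exists2 x, A x & exists2 x', A x' &
                       y = (enorm (x - x'))%:E].

Lemma box_gauge0 : box_gauge set0 = 0.
Proof. by rewrite /box_gauge eqxx. Qed.

Lemma box_gauge_ge0 A : 0 <= box_gauge A.
Proof.
rewrite /box_gauge; case: ifP => // _.
apply: le_ereal_inf_tmp => _ [ab [abP _ ->]].
by rewrite lee_fin prodr_ge0// => i _; rewrite subr_ge0.
Qed.

Definition lebesgue_outer_on D A : \bar R := lebesgue_outer (A `&` D).

Lemma lebesgue_outer_on0 D : lebesgue_outer_on D set0 = 0.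
Proof.
by rewrite /lebesgue_outer_on set0I; exact: (@mu_ext0 _ (all_sets R n) R _ box_gauge0 box_gauge_ge0).
Qed.

Lemma lebesgue_outer_on_ge0 D A : 0 <= lebesgue_outer_on D A.
Proof. exact: (@mu_ext_ge0 _ (all_sets R n) R _ box_gauge_ge0). Qed.

Lemma le_lebesgue_outer_on D :
  {homo lebesgue_outer_on D : A B / A `<=` B >-> A <= B}.
Proof. by move=> A B AB; apply: (@le_mu_ext _ (all_sets R n)); exact: setSI. Qed.

Lemma lebesgue_outer_on_sigma_subadditive D :
  sigma_subadditive (lebesgue_outer_on D).
Proof.
move=> F; rewrite /lebesgue_outer_on setI_bigcupl.
exact: (@mu_ext_sigma_subadditive _ (all_sets R n) R _ box_gauge_ge0).
Qed.

HB.instance Definition _ D := isOuterMeasure.Build R 'rV[R]_n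
  (lebesgue_outer_on D) (lebesgue_outer_on0 D) (lebesgue_outer_on_ge0 D)
  (@le_lebesgue_outer_on D) (@lebesgue_outer_on_sigma_subadditive D).

End set_functions.

Section surface.
Context (R : realType) (n : nat).
Implicit Types (A G : set 'rV[R]_n.+1) (e : R).
Local Open Scope ereal_scope.

(* |unit ball of R^n| / 2^n, which makes the n-dimensional Hausdorff measure
   agree with the usual n-dimensional area. *)
Definition hausdorff_cst : R :=
  (fine (lebesgue_outer [set x : 'rV[R]_n | (enorm x <= 1)%R]) / 2 ^+ n)%R.

Definition hausdorff_gauge e A : \bar R :=
  if A == set0 then 0
  else if diam A <= e%:E then (hausdorff_cst * fine (diam A) ^+ n)%:E
  else +oo.

Definition hausdorff_outer A : \bar R :=
  ereal_sup [set mu_ext (hausdorff_gauge e : set (all_sets R n.+1) -> \bar R) A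
            | e in [set e : R | (0 < e)%R]].

Lemma diam_ge0 A : A !=set0 -> 0 <= diam A.
Proof.
move=> [x Ax]; apply: (@le_trans _ _ (enorm (x - x))%:E).
  by rewrite lee_fin sqrtr_ge0.
by apply: ereal_sup_ubound; exists x => //; exists x.
Qed.

Lemma hausdorff_cst_ge0 : (0 <= hausdorff_cst)%R.
Proof.
rewrite divr_ge0 ?exprn_ge0 ?fine_ge0//.
exact: (@mu_ext_ge0 _ (all_sets R n) R _ (@box_gauge_ge0 R n)).
Qed.

Lemma hausdorff_gauge0 e : hausdorff_gauge e set0 = 0.
Proof. by rewrite /hausdorff_gauge eqxx. Qed.

Lemma hausdorff_gauge_ge0 e A : 0 <= hausdorff_gauge e A.
Proof.
rewrite /hausdorff_gauge; case: ifPn => // A0; case: ifP => // _.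
rewrite lee_fin mulr_ge0 ?hausdorff_cst_ge0// exprn_ge0// fine_ge0//.
by apply: diam_ge0; exact/set0P.
Qed.

Definition surface_outer G A : \bar R := hausdorff_outer (A `&` G).

Lemma surface_outer0 G : surface_outer G set0 = 0.
Proof.
rewrite /surface_outer set0I; apply/eqP; rewrite eq_le; apply/andP; split.
  apply: ge_ereal_sup => _ [e _ <-].
  by rewrite (@mu_ext0 _ (all_sets R n.+1) R _ (hausdorff_gauge0 e) (@hausdorff_gauge_ge0 e)).
apply: ereal_sup_ubound; exists 1%R => //=.
exact: (@mu_ext0 _ (all_sets R n.+1) R _ (hausdorff_gauge0 1) (@hausdorff_gauge_ge0 1)).
Qed.

Lemma surface_outer_ge0 G A : 0 <= surface_outer G A.
Proof.
apply: le_trans (@mu_ext_ge0 _ (all_sets R n.+1) R _ (@hausdorff_gauge_ge0 1) (A `&` G)) _.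
by apply: ereal_sup_ubound; exists 1%R => //=.
Qed.

Lemma le_surface_outer G :
  {homo surface_outer G : A B / A `<=` B >-> A <= B}.
Proof.
move=> A B AB; apply: ge_ereal_sup => _ [e e0 <-].
apply: (@le_trans _ _ (mu_ext (hausdorff_gauge e : set (all_sets R n.+1) -> _)
  (B `&` G))); first by apply: (@le_mu_ext _ (all_sets R n.+1)); exact: setSI.
by apply: ereal_sup_ubound; exists e.
Qed.

Lemma surface_outer_sigma_subadditive G : sigma_subadditive (surface_outer G).
Proof.
move=> F; rewrite {1}/surface_outer setI_bigcupl.
apply: ge_ereal_sup => _ [e e0 <-].
apply: (le_trans (@mu_ext_sigma_subadditive _ (all_sets R n.+1) R _ (@hausdorff_gauge_ge0 e) _)).
apply: lee_nneseries => [i _ _|i _].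
  exact: (@mu_ext_ge0 _ (all_sets R n.+1) R _ (@hausdorff_gauge_ge0 e)).
by apply: ereal_sup_ubound; exists e.
Qed.

HB.instance Definition _ G := isOuterMeasure.Build R 'rV[R]_n.+1
  (surface_outer G) (surface_outer0 G) (surface_outer_ge0 G)
  (@le_surface_outer G) (@surface_outer_sigma_subadditive G).

End surface.

(* The outer measures are restricted to D (resp. G) beforehand, hence integrals
   and a.e. statements over D (resp. G) are over the whole space for these. *)
Definition volume_outer (R : realType) n (D : set 'rV[R]_n) :
  {outer_measure set 'rV[R]_n -> \bar R} := lebesgue_outer_on D.

Definition volume (R : realType) n (D : set 'rV[R]_n) :
    {measure set (caratheodory_type (volume_outer D)) -> \bar R} :=
  (volume_outer D : set (caratheodory_type (volume_outer D)) -> \bar R).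

Definition area_outer (R : realType) n (G : set 'rV[R]_n.+1) :
  {outer_measure set 'rV[R]_n.+1 -> \bar R} := surface_outer G.

Definition surface (R : realType) n (G : set 'rV[R]_n.+1) :
    {measure set (caratheodory_type (area_outer G)) -> \bar R} :=
  (area_outer G : set (caratheodory_type (area_outer G)) -> \bar R).

Definition boundary (T : topologicalType) (D : set T) : set T :=
  closure D `\` interior D.

(* Near each boundary point, after a rotation, D is the strict epigraph of a
   Lipschitz function of the first n coordinates. *)
Definition bounded_lipschitz_domain (R : realType) n (D : set 'rV[R]_n.+1) :=
  [/\ D !=set0, open D, connected D, bounded_set D &
    forall p, boundary D p ->
      exists (U : set 'rV[R]_n.+1) (Q : 'M[R]_n.+1) (g : 'rV[R]_n -> R) (L : R),
      [/\ open U, U p, Q *m Q^T = 1%:M,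
          forall a b, `|g a - g b| <= L * `|a - b| &
          forall x, U x ->
            (D x <-> g (col' ord_max (x *m Q)) < (x *m Q) 0 ord_max)]].

Section complex_integration.
Context d (T : measurableType d) (R : realType) (mu : {measure set T -> \bar R}).
Implicit Types (f g : T -> R[i]).

Definition cintegral (A : set T) f : R[i] :=
  (Rintegral mu A (fun x => complex.Re (f x)))
  +i* (Rintegral mu A (fun x => complex.Im (f x))).

Definition L2 f :=
  (fun x => complex.Re (f x)) \in Lfun mu 2%:E /\
  (fun x => complex.Im (f x)) \in Lfun mu 2%:E.

(* Conjugate-linear in the first argument. *)
Definition ip f g : R[i] := cintegral setT (fun x => (f x)^* * g x).

Definition L2norm f : R := Num.sqrt (complex.Re (ip f f)).

Definition ipK N (f g : 'I_N -> T -> R[i]) : R[i] := \sum_n ip (f n) (g n).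

End complex_integration.

Section Linf_valued.
Context d (T : measurableType d) (R : realType) (mu : {measure set T -> \bar R}).
Implicit Types (k : R -> T -> R).

Definition Linf_norm (f : T -> R) : \bar R := 'N[mu]_+oo[EFin \o f].

Definition Linf_continuous k := forall t : R,
  (fun s => Linf_norm (fun x => k s x - k t x)) @ t --> 0%E.

Definition Linf_derivative k k' := forall t : R,
  (fun e => Linf_norm (fun x => e^-1 * (k (t + e) x - k t x) - k' t x))
    @ 0^' --> 0%E.

(* k is C^m from R to L^oo, with period P; periodicity is equality in L^oo. *)
Fixpoint Cper (m : nat) (P : R) k : Prop :=
  [/\ forall t, k t \in Lfun mu +oo%E,
      forall t, \forall x \ae mu, k (t + P) x = k t x,
      Linf_continuous k &
      if m is m'.+1 then exists2 k', Linf_derivative k k' & Cper m' P k'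
      else True].

Definition ess_sup_on (A : set T) (f : T -> \bar R) : \bar R :=
  ereal_inf [set y | \forall x \ae mu, A x -> (f x <= y)%E].

Definition ess_inf_on (A : set T) (f : T -> \bar R) : \bar R :=
  ereal_sup [set y | \forall x \ae mu, A x -> (y <= f x)%E].

Definition growth_constant (P : R) k k' : R :=
  2 / P * Rintegral lebesgue_measure `[0, P]
    (fun s => fine (Linf_norm (fun x => Num.max (k' s x) 0 / k s x))).

End Linf_valued.

Section time_harmonics.
Context (R : realType).

Definition frequency (P : R) : R := 2 * pi / P.

Definition expi (a : R) : R[i] := cos a +i* sin a.

(* The coefficients in k(t, x) = \sum_n khat_n(x) exp(- i n Omega t), for
   Omega = 2 pi / P. *)
Definition fourier_coef (T : Type) (P : R) (k : R -> T -> R) (n : int) (x : T) : R[i] :=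
  (P^-1)%:C * cintegral lebesgue_measure `[0, P]
    (fun t : R => (k t x)%:C * expi (n%:~R * frequency P * t)).

End time_harmonics.

Section sobolev.
Context (R : realType) (n : nat).
Local Notation E := 'rV[R]_n.+1.
Implicit Types (D : set E) (phi : E -> R).

Definition partial phi (i : 'I_n.+1) : E -> R := 'D_(delta_mx 0 i) phi.

Fixpoint Ck (m : nat) phi : Prop :=
  continuous phi /\
  if m is m'.+1 then
    forall i, (forall x, derivable phi x (delta_mx 0 i)) /\ Ck m' (partial phi i)
  else True.

Definition smooth phi := forall m, Ck m phi.

Definition test_function D phi :=
  smooth phi /\
  exists A, [/\ compact A, A `<=` D & forall x, ~ A x -> phi x = 0].

(* An element of H^1(D) is carried with its weak gradient: w.1 is the function
   and w.2 i is its i-th weak partial derivative. *)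
Definition field : Type := ((E -> R[i]) * ('I_n.+1 -> E -> R[i]))%type.

Definition weak_gradient D (u : E -> R[i]) (g : 'I_n.+1 -> E -> R[i]) :=
  forall phi i, test_function D phi ->
    cintegral (volume D) setT (fun x => u x * (partial phi i x)%:C) =
    - cintegral (volume D) setT (fun x => g i x * (phi x)%:C).

Definition H1 D : set field :=
  [set w | [/\ L2 (volume D) w.1, forall i, L2 (volume D) (w.2 i) &
               weak_gradient D w.1 w.2]].

Definition grad_norm D (w : field) : R :=
  Num.sqrt (\sum_i L2norm (volume D) (w.2 i) ^+ 2).

Definition H1_norm D (w : field) : R :=
  Num.sqrt (L2norm (volume D) w.1 ^+ 2 + grad_norm D w ^+ 2).

Definition comb (c : R[i]) (v w : field) : field :=
  (fun x => c * v.1 x + w.1 x, fun i x => c * v.2 i x + w.2 i x).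

Definition finite_dim_subspace D (X : set field) :=
  [/\ X `<=` H1 D, X !=set0,
      forall c v w, X v -> X w -> X (comb c v w) &
      exists (N : nat) (e : 'I_N -> field), (forall j, X (e j)) /\
        forall w, X w -> exists c : 'I_N -> R[i],
          \forall x \ae volume D, w.1 x = \sum_j c j * (e j).1 x].

(* tr is the trace H^1(D) -> L^2(boundary D): the bounded linear map that is
   the restriction to the boundary on smooth functions.  These conditions
   determine it since smooth functions are dense in H^1(D). *)
Definition trace_operator D (tr : (E -> R[i]) -> (E -> R[i])) :=
  [/\ forall w, H1 D w -> L2 (surface (boundary D)) (tr w.1),
      forall c v w, H1 D v -> H1 D w ->
        \forall x \ae surface (boundary D),
          tr (comb c v w).1 x = c * tr v.1 x + tr w.1 x,
      exists C : R, forall w, H1 D w ->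
        L2norm (surface (boundary D)) (tr w.1) <= C * H1_norm D w &
      forall phi psi, smooth phi -> smooth psi ->
        \forall x \ae surface (boundary D),
          boundary D x -> tr (fun y => phi y +i* psi y) x = phi x +i* psi x].

End sobolev.

Section coupled_harmonics.
Context (R : realType) (n : nat) (D : set 'rV[R]_n.+1).
Variables (P : R) (kappa : R -> 'rV[R]_n.+1 -> R) (kappa0 : R).
Variable tr : ('rV[R]_n.+1 -> R[i]) -> ('rV[R]_n.+1 -> R[i]).

(* The harmonics -K, ..., K are indexed by 'I_(2K+1). *)
Definition harmonic K (j : 'I_K.*2.+1) : int := j%:Z - K%:Z.

(* Entry j of a harmonic vector multiplied by - i n Omega, n = harmonic j. *)
Definition Dt K (u : 'I_K.*2.+1 -> 'rV[R]_n.+1 -> R[i]) (j : 'I_K.*2.+1) :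
    'rV[R]_n.+1 -> R[i] :=
  fun x => - 'i * ((harmonic j)%:~R * frequency P)%:C * u j x.

Definition Tkappa_grad K (u : 'I_K.*2.+1 -> field R n) (l : 'I_n.+1)
    (j : 'I_K.*2.+1) : 'rV[R]_n.+1 -> R[i] :=
  fun x => \sum_m
    fourier_coef P kappa (harmonic j - harmonic m) x * (u m).2 l x.

Definition value K (u : 'I_K.*2.+1 -> field R n) (j : 'I_K.*2.+1) :
    'rV[R]_n.+1 -> R[i] := (u j).1.

Definition coupled_harmonics_eigenvalue K (X : set (field R n)) (omega : R[i]) :=
  exists u z : 'I_K.*2.+1 -> field R n,
  [/\ forall j, X (u j), forall j, X (z j),
      ~ (forall j, \forall x \ae volume D, (u j).1 x = 0 /\ (z j).1 x = 0) &
      forall v eta : 'I_K.*2.+1 -> field R n,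
        (forall j, X (v j)) -> (forall j, X (eta j)) ->
        ipK (volume D) (value v)
            (fun j x => Dt (value u) j x - value z j x)
          = 'i * omega * ipK (volume D) (value v) (value u)
        /\
        ipK (volume D) (value eta) (Dt (value z))
          + \sum_l ipK (volume D) (fun j => (eta j).2 l) (Tkappa_grad u l)
          + kappa0%:C * ipK (surface (boundary D))
              (fun j => tr (value eta j)) (fun j => tr (value z j))
          = 'i * omega * ipK (volume D) (value eta) (value z)].

Definition in_first_Brillouin_zone (omega : R[i]) :=
  - (frequency P / 2) < complex.Re omega <= frequency P / 2.

End coupled_harmonics.

(* Main.v *)
Require Import Defs.
From HB Require Import structures.
From mathcomp Require Import all_boot all_order all_algebra.
From mathcomp Require Import all_classical all_reals all_analysis.
From mathcomp Require Import measurable_realfun ess_sup_inf complex.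
From mathcomp Require Import ring lra zify.

(* Let b = Im omega and m(t) = || kappa'_+ / kappa ||_oo at time t, with mean value mbar.
   In coordinates of X_h the problem becomes a Fourier-Galerkin truncation of z = u' - i omega u,
   z' - i omega z + A(t) u + kappa0 B z = 0 for hermitian forms with A' <= m A.  Choose a
   positive trigonometric polynomial phi, of degree L, close to exp(mbar t - int_0^t m) together
   with its derivative, so that 2 mbar phi - phi'/2 - m phi/2 >= delta > 0 (phi = 1 if mbar = 0).
   Testing with the modes |n| <= K of phi z gives, for the energy E = |z|^2 + A(u,u),
     b int phi E - (1/2) int phi' E - (1/2) int phi A'(u,u) + kappa0 int phi B(z,z)
       = Re int A(w,u),
   where w collects the modes K < |n| <= K + L of phi z.  If b > 2 mbar, the left side is at
   least a multiple of int E.  Writing w as a time derivative gains a factor 1/K, and the inverse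
   estimate bounds the gradient of z by C_inv |z|, so the right side is smaller than that as soon
   as K > C_0 C_inv^2: a contradiction.  For kappa0 = 0 the truncated problem is self-adjoint up
   to conjugation of omega, so conj(omega) is an eigenvalue as well. *)

Set Implicit Arguments.
Unset Strict Implicit.
Unset Printing Implicit Defensive.

Import Order.TTheory GRing.Theory Num.Theory.
Import numFieldNormedType.Exports.

Local Open Scope classical_set_scope.
Local Open Scope ring_scope.
Local Open Scope complex_scope.

(** With phi = 1 the inequality A' <= m A only bounds b by a multiple of the maximum of m. The
    exponential weight spreads the rate evenly over the period: for it 2 mbar phi - phi'/2 - m phi/2
    equals (3/2) mbar phi. This slack pays for passing to a trigonometric polynomial, which keeps
    all sums finite and confines the defect of the test function to finitely many high modes. The
    slack vanishes with mbar, but then phi = 1 has degree 0 and leaves no tail. A second obstacle is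
    that b has no a priori bound, while C_0 must not depend on it. Both sides of the final
    inequality are therefore kept linear in b: the lower bound carries the factor 1 + b - 2 mbar,
    the tail a factor of size 1 + |omega|, and |Re omega| <= Omega / 2 makes their quotient bounded.
    This is the role of the first Brillouin zone. A spanning family of X_h may be linearly
    dependent, so the forms on coordinates are only semidefinite: equations hold weakly,
    nontriviality is stated through quadratic forms, and the conjugation argument compares kernels
    instead of inverting a mass matrix. *)

Notation Re := (@complex.Re _).
Notation Im := (@complex.Im _).

(** * Complex-valued integrals and functions of time *)

Section complex_parts.
Context (R : realType).
Implicit Types (x y : R[i]) (r : R).

Lemma ReD x y : Re (x + y) = Re x + Re y. Proof. by case: x y => ? ? []. Qed.
Lemma ImD x y : Im (x + y) = Im x + Im y. Proof. by case: x y => ? ? []. Qed.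
Lemma ReN x : Re (- x) = - Re x. Proof. by case: x. Qed.
Lemma ImN x : Im (- x) = - Im x. Proof. by case: x. Qed.
Lemma ReM x y : Re (x * y) = Re x * Re y - Im x * Im y.
Proof. by case: x y => ? ? []. Qed.
Lemma ImM x y : Im (x * y) = Re x * Im y + Im x * Re y.
Proof. by case: x y => ? ? []. Qed.
Lemma Re_conj x : Re x^* = Re x. Proof. by case: x. Qed.
Lemma Im_conj x : Im x^* = - Im x. Proof. by case: x. Qed.
Lemma Re_sum I (s : seq I) (Q : pred I) (F : I -> R[i]) :
  Re (\sum_(i <- s | Q i) F i) = \sum_(i <- s | Q i) Re (F i).
Proof. by apply: (big_morph _ ReD). Qed.
Lemma complex_eq x y : Re x = Re y -> Im x = Im y -> x = y.
Proof. by case: x y => a b [c e] /= -> ->. Qed.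
Lemma ReZ r x : Re (r%:C * x) = r * Re x. Proof. by rewrite ReM /= mul0r subr0. Qed.
Lemma ImZ r x : Im (r%:C * x) = r * Im x. Proof. by rewrite ImM /= mul0r addr0. Qed.
Lemma conj_real r : r%:C^* = r%:C.
Proof. by apply: complex_eq => //=; rewrite oppr0. Qed.
Lemma conjcM x y : conjc (x * y) = conjc x * conjc y. Proof. exact: rmorphM. Qed.
Lemma conjcD x y : conjc (x + y) = conjc x + conjc y. Proof. exact: rmorphD. Qed.
Lemma conjcX x n : conjc (x ^+ n) = conjc x ^+ n. Proof. exact: rmorphXn. Qed.
Lemma conjc_sum I (s : seq I) (Q : pred I) (F : I -> R[i]) :
  conjc (\sum_(i <- s | Q i) F i) = \sum_(i <- s | Q i) conjc (F i).
Proof. exact: rmorph_sum. Qed.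
Lemma mulConjE x : conjc x * x = (Re x ^+ 2 + Im x ^+ 2)%:C.
Proof.
by apply: complex_eq; rewrite ?ReM ?ImM Re_conj Im_conj /=; ring.
Qed.

End complex_parts.

Section cintegral_theory.
Context d (T : measurableType d) (R : realType) (mu : {measure set T -> \bar R}).
Context (A : set T).
Hypothesis mA : measurable A.
Implicit Types (f g : T -> R[i]).

Definition cintegrable f :=
  mu.-integrable A (fun x => (Re (f x))%:E) /\
  mu.-integrable A (fun x => (Im (f x))%:E).

Lemma integrableZr (r : R) (h : T -> R) :
  mu.-integrable A (EFin \o h) -> mu.-integrable A (fun x => (r * h x)%:E).
Proof.
move=> hi; apply: (eq_integrable mA (fun x => r%:E * (h x)%:E)%E) => //.
exact: integrableZl.
Qed.

Lemma integrableDr (h k : T -> R) :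
  mu.-integrable A (fun x => (h x)%:E) -> mu.-integrable A (fun x => (k x)%:E) ->
  mu.-integrable A (fun x => (h x + k x)%:E).
Proof.
move=> hi ki; apply: (eq_integrable mA ((fun x => (h x)%:E) \+ (fun x => (k x)%:E))%E) => //.
exact: integrableD.
Qed.

Lemma integrableBr (h k : T -> R) :
  mu.-integrable A (fun x => (h x)%:E) -> mu.-integrable A (fun x => (k x)%:E) ->
  mu.-integrable A (fun x => (h x - k x)%:E).
Proof.
move=> hi ki; apply: (eq_integrable mA ((fun x => (h x)%:E) \- (fun x => (k x)%:E))%E) => //.
exact: integrableB.
Qed.

Lemma cintegrableD f g : cintegrable f -> cintegrable g ->
  cintegrable (fun x => f x + g x).
Proof.
move=> [f1 f2] [g1 g2]; split.
  by under eq_fun do rewrite ReD; exact: integrableDr.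
by under eq_fun do rewrite ImD; exact: integrableDr.
Qed.

Lemma cintegrableZ (c : R[i]) f : cintegrable f ->
  cintegrable (fun x => c * f x).
Proof.
move=> [f1 f2]; split.
  by under eq_fun do rewrite ReM; apply: integrableBr; exact: integrableZr.
by under eq_fun do rewrite ImM; apply: integrableDr; exact: integrableZr.
Qed.

Lemma cintegrable0 : cintegrable (fun=> 0).
Proof. by split; exact: integrable0. Qed.

Lemma cintegrable_sum I (s : seq I) (Q : pred I) (F : I -> T -> R[i]) :
  (forall i, Q i -> cintegrable (F i)) ->
  cintegrable (fun x => \sum_(i <- s | Q i) F i x).
Proof.
move=> h; elim: s => [|a s IH].
  by under eq_fun do rewrite big_nil; exact: cintegrable0.
under eq_fun do rewrite big_cons; case: (boolP (Q a)) => // Qa.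
by apply: cintegrableD => //; exact: h.
Qed.

Local Notation I f := (cintegral mu A f).

Lemma cintegralD f g : cintegrable f -> cintegrable g ->
  I (fun x => f x + g x) = I f + I g.
Proof.
move=> [f1 f2] [g1 g2]; apply: complex_eq; rewrite /cintegral /=.
  by under eq_Rintegral do rewrite ReD; rewrite RintegralD.
by under eq_Rintegral do rewrite ImD; rewrite RintegralD.
Qed.

Lemma cintegralZ (c : R[i]) f : cintegrable f -> I (fun x => c * f x) = c * I f.
Proof.
move=> [f1 f2]; apply: complex_eq; rewrite ?ReM ?ImM /cintegral /=.
  under eq_Rintegral do rewrite ReM.
  by rewrite RintegralB ?RintegralZl//; exact: integrableZr.
under eq_Rintegral do rewrite ImM.
by rewrite RintegralD ?RintegralZl//; exact: integrableZr.
Qed.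

Lemma cintegral0 : I (fun=> 0) = 0.
Proof. by rewrite /cintegral /= Rintegral_cst// mul0r. Qed.

Lemma cintegral_sum J (s : seq J) (Q : pred J) (F : J -> T -> R[i]) :
  (forall i, Q i -> cintegrable (F i)) ->
  I (fun x => \sum_(i <- s | Q i) F i x) = \sum_(i <- s | Q i) I (F i).
Proof.
move=> h; elim: s => [|a s IH].
  by under eq_fun do rewrite big_nil; rewrite big_nil cintegral0.
under eq_fun do rewrite big_cons; rewrite big_cons; case: (boolP (Q a)) => // Qa.
by rewrite cintegralD ?IH//; [exact: h|exact: cintegrable_sum].
Qed.

Lemma cintegral_conj f : cintegrable f -> I (fun x => (f x)^*) = (I f)^*.
Proof.
move=> [f1 f2]; apply: complex_eq; rewrite ?Re_conj ?Im_conj /cintegral /=.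
  by under eq_Rintegral do rewrite Re_conj.
under eq_Rintegral do rewrite Im_conj -mulN1r.
by rewrite RintegralZl// mulN1r.
Qed.

Lemma eq_cintegral f g : (forall x, A x -> f x = g x) -> I f = I g.
Proof.
by move=> fg; rewrite /cintegral; congr Complex; apply: eq_Rintegral => x /[!inE] Ax; rewrite fg.
Qed.

End cintegral_theory.

Section complex_functions_of_time.
Context (R : realType).
Implicit Types (f g : R -> R[i]) (a b : R -> R).

Definition ccontinuous f := continuous (Re \o f) /\ continuous (Im \o f).

Definition cderivative f g := forall t : R,
  is_derive t 1 (Re \o f) (Re (g t)) /\
  is_derive t 1 (Im \o f) (Im (g t)).

Lemma ccontinuousD f g : ccontinuous f -> ccontinuous g ->
  ccontinuous (fun t => f t + g t).
Proof.
move=> [f1 f2] [g1 g2]; split => t.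
  have -> : Re \o (fun t => f t + g t) = (Re \o f) \+ (Re \o g).
    by apply/funext => x; rewrite /= ReD.
  by apply: cvgD; [exact: f1|exact: g1].
have -> : Im \o (fun t => f t + g t) = (Im \o f) \+ (Im \o g).
  by apply/funext => x; rewrite /= ImD.
by apply: cvgD; [exact: f2|exact: g2].
Qed.

Lemma ccontinuousM f g : ccontinuous f -> ccontinuous g ->
  ccontinuous (fun t => f t * g t).
Proof.
move=> [f1 f2] [g1 g2]; split => t.
  have -> : Re \o (fun t => f t * g t) =
      (fun t => (Re \o f) t * (Re \o g) t - (Im \o f) t * (Im \o g) t).
    by apply/funext => x; rewrite /= ReM.
  by apply: cvgB; apply: cvgM; [exact: f1|exact: g1|exact: f2|exact: g2].
have -> : Im \o (fun t => f t * g t) =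
    (fun t => (Re \o f) t * (Im \o g) t + (Im \o f) t * (Re \o g) t).
  by apply/funext => x; rewrite /= ImM.
by apply: cvgD; apply: cvgM; [exact: f1|exact: g2|exact: f2|exact: g1].
Qed.

Lemma ccontinuous_cst (c : R[i]) : ccontinuous (fun=> c).
Proof. by split => t; exact: cvg_cst. Qed.

Lemma ccontinuous_sum I (s : seq I) (Q : pred I) (F : I -> R -> R[i]) :
  (forall i, Q i -> ccontinuous (F i)) ->
  ccontinuous (fun x => \sum_(i <- s | Q i) F i x).
Proof.
move=> h; elim: s => [|i s IH].
  by under eq_fun do rewrite big_nil; exact: ccontinuous_cst.
under eq_fun do rewrite big_cons; case: (boolP (Q i)) => // Qi.
by apply: ccontinuousD => //; exact: h.
Qed.

Lemma ccontinuous_real a : continuous a -> ccontinuous (fun t => (a t)%:C).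
Proof. by move=> ca; split => //; exact: cst_continuous. Qed.

Lemma cderivativeM f f' g g' : cderivative f f' -> cderivative g g' ->
  cderivative (fun t => f t * g t) (fun t => f' t * g t + f t * g' t).
Proof.
move=> df dg t; have [f1 f2] := df t; have [g1 g2] := dg t; split.
  have -> : (Re \o (fun t => f t * g t) : R -> R) =
     ((Re \o f : R -> R) * (Re \o g : R -> R) - (Im \o f : R -> R) * (Im \o g : R -> R)).
    by apply/funext => x; rewrite /= ReM.
  apply: is_derive_eq.
  by rewrite ReD !ReM /= /GRing.scale /=; ring.
have -> : (Im \o (fun t => f t * g t) : R -> R) =
   ((Re \o f : R -> R) * (Im \o g : R -> R) + (Im \o f : R -> R) * (Re \o g : R -> R)).
  by apply/funext => x; rewrite /= ImM.
apply: is_derive_eq.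
by rewrite ImD !ImM /= /GRing.scale /=; ring.
Qed.

Lemma cderivative_cst (c : R[i]) : cderivative (fun=> c) (fun=> 0).
Proof. by move=> t; split; exact: is_derive_cst. Qed.

Lemma cderivative_expi (c : R) :
  cderivative (fun t => expi (c * t)) (fun t => 'i * c%:C * expi (c * t)).
Proof.
have dl (t : R) : is_derive t 1 (fun x : R => c * x : R) c.
  have -> : (fun x : R => c * x : R) = (c *: (id : R -> R)) by [].
  by apply: is_derive_eq; rewrite /GRing.scale /= mulr1.
move=> t; split.
  rewrite (_ : Re _ = - sin (c * t) * c); last by rewrite !ReM !ImM /expi /=; ring.
  exact: (@is_derive1_comp _ cos (fun x : R => c * x : R) t _ _ (is_derive_cos _) (dl t)).
rewrite (_ : Im _ = cos (c * t) * c); last by rewrite !ImM !ReM /expi /=; ring.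
exact: (@is_derive1_comp _ sin (fun x : R => c * x : R) t _ _ (is_derive_sin _) (dl t)).
Qed.

Lemma is_derive_continuous (F f : R -> R) :
  (forall t : R, is_derive t 1 (F : R -> R) (f t)) -> continuous F.
Proof.
move=> dF t; apply: (@differentiable_continuous R R R t F).
by apply/derivable1_diffP; have [] := dF t.
Qed.

Lemma cderivative_continuous f g : cderivative f g -> ccontinuous f.
Proof. by move=> df; split; apply: is_derive_continuous => t; have [] := df t. Qed.

Lemma ccontinuous_expi (c : R) : ccontinuous (fun t => expi (c * t)).
Proof. exact: cderivative_continuous (cderivative_expi c). Qed.

Lemma expiD (x y : R) : expi (x + y) = expi x * expi y.
Proof.
by apply: complex_eq; rewrite ?ReM ?ImM /expi /= ?cosD ?sinD //; ring.
Qed.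

Lemma expi0 : expi 0 = 1 :> R[i].
Proof. by rewrite /expi cos0 sin0. Qed.

Lemma conj_expi (x : R) : (expi x)^* = expi (- x).
Proof. by rewrite /expi /= cosN sinN. Qed.

Lemma expi2pi (k : int) : expi (k%:~R * (2 * pi)) = 1 :> R[i].
Proof.
have h (n : nat) : expi (n%:R * (2 * pi)) = 1 :> R[i].
  elim: n => [|n IH]; first by rewrite mul0r expi0.
  rewrite -natr1 mulrDl mul1r expiD IH mul1r /expi mulrDl mul1r.
  by rewrite sinD cosD !sinpi !cospi !(mulr0, mul0r, mulrN1, opprK, addr0, subr0).
case: k => n; first exact: h.
rewrite NegzE mulrNz mulNr -conj_expi h.
by apply: complex_eq => //=; rewrite oppr0.
Qed.

Lemma within_itv_continuous (a : R -> R) (x y : R) : continuous a ->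
  {within `[x, y], continuous a}.
Proof. by move=> ca; exact: (continuous_subspaceT ca). Qed.

Lemma continuous_integrable_itv a (x y : R) : continuous a ->
  lebesgue_measure.-integrable `[x, y] (fun t => (a t)%:E).
Proof.
move=> ca; apply: (@continuous_compact_integrable _ a); first exact: segment_compact.
exact: within_itv_continuous.
Qed.

Lemma ccontinuous_cintegrable f (x y : R) : ccontinuous f ->
  cintegrable lebesgue_measure (`[x, y] : set (measurableTypeR R)) f.
Proof. by move=> [f1 f2]; split; exact: continuous_integrable_itv. Qed.

Lemma FTC2_is_derive (F f : R -> R) (x y : R) : x < y -> continuous f ->
  (forall t : R, is_derive t 1 (F : R -> R) (f t)) ->
  Rintegral lebesgue_measure `[x, y] f = F y - F x.
Proof.
move=> xy cf dF; rewrite /Rintegral (@continuous_FTC2 _ f F)//.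
- exact: within_itv_continuous.
- have cF := is_derive_continuous dF.
  split; first by move=> z _; have [] := dF z.
    exact: cvg_at_right_filter (cF x).
  exact: cvg_at_left_filter (cF y).
- by move=> z _; rewrite derive1E; have [] := dF z.
Qed.

Lemma cFTC2 f g (x y : R) : x < y -> ccontinuous g -> cderivative f g ->
  cintegral lebesgue_measure (`[x, y] : set (measurableTypeR R)) g = f y - f x.
Proof.
move=> xy [g1 g2] df; apply: complex_eq; rewrite ?ReD ?ImD ?ReN ?ImN /cintegral /=.
  exact: (@FTC2_is_derive (Re \o f) _ x y xy g1 (fun t => (df t).1)).
exact: (@FTC2_is_derive (Im \o f) _ x y xy g2 (fun t => (df t).2)).
Qed.

End complex_functions_of_time.

(** * Fourier modes over one period *)

Section fourier.
Context (R : realType) (P : R).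
Hypothesis P_gt0 : 0 < P.
Local Notation Om := (frequency P).

(** In the sign convention of the problem the coefficient of index [n] multiplies [mode (- n)]. *)
Definition mode (k : int) (t : R) : R[i] := expi (k%:~R * Om * t).

Definition Iper (f : R -> R[i]) : R[i] :=
  cintegral lebesgue_measure (`[0, P] : set (measurableTypeR R)) f.

Lemma frequency_gt0 : 0 < Om.
Proof. by rewrite /frequency divr_gt0// mulr_gt0// pi_gt0. Qed.

Lemma mode0 t : mode 0 t = 1.
Proof. by rewrite /mode !mul0r expi0. Qed.

Lemma modeD k l t : mode (k + l) t = mode k t * mode l t.
Proof. by rewrite /mode intrD !mulrDl expiD. Qed.

Lemma conj_mode k t : (mode k t)^* = mode (- k) t.
Proof. by rewrite /mode conj_expi mulrNz !mulNr. Qed.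

Lemma mode_per k : mode k P = 1.
Proof.
rewrite /mode -mulrA /frequency divfK ?expi2pi//.
by rewrite gt_eqF.
Qed.

Lemma ccontinuous_mode k : ccontinuous (mode k).
Proof. exact: ccontinuous_expi. Qed.

Lemma cderivative_mode k :
  cderivative (mode k) (fun t => 'i * (k%:~R * Om)%:C * mode k t).
Proof. exact: cderivative_expi. Qed.

Lemma IperD f g : ccontinuous f -> ccontinuous g ->
  Iper (fun t => f t + g t) = Iper f + Iper g.
Proof. by move=> cf cg; apply: cintegralD => //; exact: ccontinuous_cintegrable. Qed.

Lemma IperZ c f : ccontinuous f -> Iper (fun t => c * f t) = c * Iper f.
Proof. by move=> cf; apply: cintegralZ => //; exact: ccontinuous_cintegrable. Qed.

Lemma Iper_sum J (s : seq J) (Q : pred J) (F : J -> R -> R[i]) :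
  (forall i, Q i -> ccontinuous (F i)) ->
  Iper (fun x => \sum_(i <- s | Q i) F i x) = \sum_(i <- s | Q i) Iper (F i).
Proof.
by move=> h; apply: cintegral_sum => // i Qi; apply: ccontinuous_cintegrable; exact: h.
Qed.

Lemma Iper_conj f : ccontinuous f -> Iper (fun t => (f t)^*) = (Iper f)^*.
Proof. by move=> cf; apply: cintegral_conj => //; exact: ccontinuous_cintegrable. Qed.

Lemma Re_Iper f : Re (Iper f) = Rintegral lebesgue_measure `[0, P] (Re \o f).
Proof. by []. Qed.

(** The boundary terms cancel: [mode k] is 1 at both ends of the period and [a] takes equal values
    there. *)
Lemma Iper_by_parts (a a' : R -> R[i]) (k : int) :
  cderivative a a' -> ccontinuous a' -> a P = a 0 ->
  Iper (fun t => a' t * mode k t) =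
  - ('i * (k%:~R * Om)%:C) * Iper (fun t => a t * mode k t).
Proof.
move=> da ca' aP; have ca := cderivative_continuous da.
have dm := cderivative_mode k.
have cm : ccontinuous (fun t => 'i * (k%:~R * Om)%:C * mode k t).
  by apply: ccontinuousM; [exact: ccontinuous_cst|exact: ccontinuous_mode].
have mk0 : mode k 0 = 1 by rewrite /mode mulr0 expi0.
have c1 : ccontinuous (fun t => a' t * mode k t).
  by apply: ccontinuousM => //; exact: ccontinuous_mode.
have c2 : ccontinuous (fun t => a t * ('i * (k%:~R * Om)%:C * mode k t)).
  exact: ccontinuousM.
have /eqP : Iper (fun t => a' t * mode k t) +
    Iper (fun t => a t * ('i * (k%:~R * Om)%:C * mode k t)) = 0.
  rewrite -IperD// /Iper (cFTC2 P_gt0 _ (cderivativeM da dm)); last exact: ccontinuousD.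
  by rewrite mode_per mk0 aP subrr.
rewrite addr_eq0 => /eqP ->.
rewrite mulNr; congr (- _); rewrite -IperZ; last first.
  by apply: ccontinuousM => //; exact: ccontinuous_mode.
by congr Iper; apply/funext => t; ring.
Qed.

Lemma Iper_cst c : Iper (fun=> c) = P%:C * c.
Proof.
rewrite /Iper /cintegral !Rintegral_cst//= lebesgue_measure_itv /= lte_fin P_gt0 /= subr0.
by apply: complex_eq; rewrite ?ReZ ?ImZ /= mulrC.
Qed.

Lemma Iper_mode k : Iper (mode k) = if k == 0 then P%:C else 0.
Proof.
case: eqVneq => [->|k0].
  by rewrite (_ : mode 0 = fun=> 1) ?Iper_cst ?mulr1//; apply/funext => t; rewrite mode0.
(* Integration by parts against the constant 1 says that [k Om] times the integral is 0. *)
have := @Iper_by_parts (fun=> 1) (fun=> 0) k (cderivative_cst _) (ccontinuous_cst _) erefl.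
under eq_fun do rewrite mul0r.
under [in X in _ = X -> _]eq_fun do rewrite mul1r.
rewrite Iper_cst mulr0 => /esym/eqP; rewrite mulf_eq0 => /orP[|/eqP//].
rewrite oppr_eq0 mulf_eq0 => /orP[|].
  by rewrite eq_complex /= oner_eq0 andbF.
by rewrite eq_complex /= eqxx andbT mulf_eq0 intr_eq0 (negbTE k0) /= gt_eqF// frequency_gt0.
Qed.

End fourier.

(** * Trigonometric weights *)

Section uniform_continuity.
Context (R : realType).

(** Compactness is used in its covering form, the parameter being a modulus [d] that tends to 0 from
    the right. Only [t] is confined to the interval; [s] may leave it slightly. *)
Lemma continuous_uniform_itv (f : R -> R) (a b e : R) : continuous f -> 0 < e ->
  exists2 del, 0 < del &
    forall s t, a <= t <= b -> `|s - t| < del -> `|f s - f t| <= e.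
Proof.
move=> cf e0.
have := @segment_compact R a b; rewrite compact_near_coveringP => nc.
have := nc R (0 : R)^'+ (fun d x => forall s, `|s - x| < d -> `|f s - f x| <= e) _.
move=> /(_ _)[].
  move=> x _; have e2 : 0 < e / 2 by rewrite divr_gt0.
  have /cvgrPdist_lt/(_ _ e2) := cf x.
  move=> [r /= r0 hr].
  exists (ball x (r / 2), [set d | 0 < d < r / 2]).
    split => /=; first by apply: nbhsx_ballx; rewrite divr_gt0.
    exists (r / 2) => /=; first by rewrite divr_gt0.
    by move=> d /=; rewrite sub0r normrN => + d0; rewrite gtr0_norm// d0.
  move=> [x' d] /= [xx' /andP[d0 dr]] s sx'.
  have h1 : `|f x - f x'| < e / 2.
    by apply: hr; apply: (lt_trans xx'); lra.
  have h2 : `|f x - f s| < e / 2.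
    apply: hr => /=; rewrite -[X in X < _]/(`|x - s|).
    rewrite (_ : x - s = (x - x') - (s - x')); last by ring.
    by rewrite (le_lt_trans (ler_normB _ _))//; move: xx'; rewrite /ball /=; lra.
  rewrite (_ : f s - f x' = (f x - f x') - (f x - f s)); last by ring.
  by rewrite (le_trans (ler_normB _ _))//; lra.
move=> d /= d0 hd; exists (d / 2); first by rewrite divr_gt0.
move=> s t tab st; apply: (hd (d / 2)) => //=.
- by rewrite sub0r normrN gtr0_norm; lra.
- by rewrite divr_gt0.
Qed.

Lemma continuous_bounded_itv (f : R -> R) (a b : R) : a <= b -> continuous f ->
  exists2 B, 0 < B & forall t, a <= t <= b -> `|f t| <= B.
Proof.
move=> ab cf.
have cn : continuous (fun t => `|f t|).
  by move=> t; apply: cvg_norm; exact: cf.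
have [c _ hc] := EVT_max ab (@within_itv_continuous _ _ a b cn).
exists (`|f c| + 1); first by rewrite ltr_wpDl.
by move=> t tab; rewrite (le_trans (hc _ _)) ?in_itv// lerDl.
Qed.

End uniform_continuity.

Notation harmonic := Defs.harmonic.

Section symmetric_sums.

(** Summands are indexed by all integers and usually vanish outside a window, so widening and
    shifting the range need no reindexing of ordinals. *)
Definition ssum (V : nmodType) (Q : nat) (F : int -> V) : V :=
  \sum_(j < Q.*2.+1) F (harmonic j).

Lemma ssum_only0 (V : nmodType) Q (F : int -> V) :
  (forall n, n != 0 -> F n = 0) -> ssum Q F = F 0.
Proof.
move=> h; have QQ : (Q < Q.*2.+1)%N by lia.
rewrite /ssum (bigD1 (Ordinal QQ))//= big1 ?addr0.
  by congr F; rewrite /harmonic /=; lia.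
move=> [j jQ] jn; apply: h; apply: contra jn => /eqP.
by rewrite /harmonic /= => hj; apply/eqP/val_inj => /=; lia.
Qed.

Lemma eq_ssum (V : nmodType) Q (F G : int -> V) : F =1 G -> ssum Q F = ssum Q G.
Proof. by move=> FG; apply: eq_bigr => j _; rewrite FG. Qed.

End symmetric_sums.

(** This bounds the mean of the kernel below: normalising costs only a polynomial factor, which the
    geometric decay of the kernel away from 0 outweighs. *)
Lemma bin_central_ge (n : nat) : (4 ^ n <= (n.*2.+1) * 'C(n.*2, n))%N.
Proof.
elim: n => [|n IH] //.
have h : (n.+1 * 'C(n.+1.*2, n.+1) = 2 * (n.*2.+1 * 'C(n.*2, n)))%N.
  rewrite doubleS binS mulnDr.
  have -> : 'C(n.*2.+1, n) = 'C(n.*2.+1, n.+1).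
    by rewrite -bin_sub; [congr ('C(_, _))|]; lia.
  by rewrite -mul_bin_diag /= mul2n addnn.
have n0 : (0 < n.+1)%N by [].
rewrite -(leq_pmul2l n0) expnS.
have -> : (n.+1 * ((n.+1).*2.+1 * 'C((n.+1).*2, n.+1)) =
   (n.+1).*2.+1 * (2 * (n.*2.+1 * 'C(n.*2, n))))%N by rewrite -h; lia.
move: IH; set X := (4 ^ n)%N; set Y := (_ * 'C(n.*2, n))%N => XY.
have : (n.+1 * (4 * X) <= n.+1 * (4 * Y))%N by rewrite !leq_mul2l XY orbT.
by move/leq_trans; apply; nia.
Qed.

(** * The kernel and convolution with it *)

Section kernel_coefficients.
Context (R : realType).

(** The Fourier coefficient of index [n], for |n| <= N, of the power of the cosine defined as [kern]
    below. *)
Definition kern_coef (N : nat) (n : int) : R :=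
  'C(N.*2, absz (n + N%:Z))%:R / 4 ^+ N.

Lemma kern_coef0 N : kern_coef N 0 = 'C(N.*2, N)%:R / 4 ^+ N.
Proof. by rewrite /kern_coef add0r. Qed.

Lemma kern_coef0_gt0 N : 0 < kern_coef N 0.
Proof.
by rewrite kern_coef0 divr_gt0 ?exprn_gt0// ltr0n bin_gt0; lia.
Qed.

Lemma kern_coef0_inv N : (kern_coef N 0)^-1 <= (N.*2.+1)%:R.
Proof.
have h : 0 < ('C(N.*2, N)%:R : R) by rewrite ltr0n bin_gt0; lia.
rewrite kern_coef0 invf_div ler_pdivrMr// -natrX -natrM ler_nat.
exact: bin_central_ge.
Qed.

End kernel_coefficients.

Section kernel.
Context (R : realType) (P : R).
Local Notation kern_coef := (@kern_coef R).
Local Notation Om := (frequency P).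

(* The approximate identity of de la Vallee-Poussin. *)
Definition kern (N : nat) (s : R) : R := cos (Om * s / 2) ^+ N.*2.

(** Euler's formula and the binomial theorem: term [j] of the expansion has frequency [N - j], the
    opposite of [harmonic j]. *)
Lemma kernE N s : (kern N s)%:C = ssum N (fun n => (kern_coef N n)%:C * mode P (- n) s).
Proof.
have cosE (x : R) : (cos x)%:C = (expi x + expi (- x)) / 2%:R%:C.
  apply: (canRL (mulfK _)); first by rewrite eq_complex /= pnatr_eq0.
  by rewrite -conj_expi; apply: complex_eq; rewrite ?ReM ?ImM ?ReD ?ImD ?Re_conj ?Im_conj /expi /=; ring.
rewrite /kern rmorphXn /= cosE expr_div_n exprDn mulr_suml.
apply: eq_bigr => -[j jN] _ /=.
have -> : (2%:R%:C ^+ N.*2 : R[i]) = (4 ^+ N)%:C.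
  rewrite -rmorphXn /= -muln2 mulnC exprM; congr ((_ ^+ _)%:C); ring.
have expiX (x : R) n : expi x ^+ n = expi (n%:R * x).
  elim: n => [|n IH]; first by rewrite mul0r expi0 expr0.
  by rewrite exprS IH -expiD; congr expi; rewrite -natr1; ring.
have hj : absz (harmonic (Ordinal jN) + N%:Z) = j.
  by rewrite /harmonic /=; lia.
rewrite /kern_coef hj !expiX -expiD /mode.
have -> : (N.*2 - j)%:R * (Om * s / 2) + j%:R * - (Om * s / 2) =
    (- harmonic (Ordinal jN))%:~R * Om * s.
  rewrite natrB; last by rewrite -ltnS.
  by rewrite /harmonic /= -muln2 natrM opprB intrB /= -!pmulrn; field.
rewrite -mulr_natl rmorphM fmorphV /= (rmorph_nat (real_complex R)) /=.
by rewrite -!mulrA; congr (_ * _); rewrite mulrC.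
Qed.

End kernel.

Section approximate_identity.
Context (R : realType) (P : R).
Hypothesis P_gt0 : 0 < P.
Local Notation Om := (frequency P).
Local Notation mode := (mode P).
Local Notation Iper := (Iper P).
Local Notation kern := (kern P).
Local Notation kern_coef := (@kern_coef R).

Lemma mulr_ssumr (c : R[i]) Q (F : int -> R[i]) :
  c * ssum Q F = ssum Q (fun n => c * F n).
Proof. exact: mulr_sumr. Qed.

Lemma Iper_ssum Q (F : int -> R -> R[i]) : (forall n, ccontinuous (F n)) ->
  Iper (fun t => ssum Q (F^~ t)) = ssum Q (fun n => Iper (F n)).
Proof. by move=> h; apply: Iper_sum. Qed.

Lemma Iper_real (f : R -> R) :
  Iper (fun t => (f t)%:C) = (Rintegral lebesgue_measure `[0, P] f)%:C.
Proof.
by apply: complex_eq => //=; rewrite /Iper /cintegral /= Rintegral_cst// mul0r.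
Qed.

Lemma continuous_kern N : continuous (kern N).
Proof.
move=> s; rewrite /kern.
apply: (continuous_comp (f := fun x => cos (Om * x / 2)) (g := fun y => y ^+ N.*2));
  last exact: exprn_continuous.
apply: (continuous_comp (f := fun x => Om * x / 2)); last exact: continuous_cos.
by apply: cvgM; [apply: cvgM; [exact: cvg_cst|exact: cvg_id]|exact: cvg_cst].
Qed.

Lemma continuous_kernB N t : continuous (fun s => kern N (t - s)).
Proof.
move=> s; apply: (continuous_comp (f := fun x => t - x)); last exact: continuous_kern.
by apply: cvgB; [exact: cvg_cst|exact: cvg_id].
Qed.

(** [P * kern_coef N 0] is the integral of the kernel over a period, so constants are preserved. *)
Definition kconv (f : R -> R) N t : R :=
  (P * kern_coef N 0)^-1 *
  Rintegral lebesgue_measure `[0, P] (fun s => f s * kern N (t - s)).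

(** The kernel is a trigonometric polynomial in [t - s], hence the convolution is one in [t]
    whatever [f] is; its coefficients are multiples of those of [f]. *)
Lemma kconvE f N t : continuous f -> (kconv f N t)%:C =
  ssum N (fun n => ((P * kern_coef N 0)^-1 * kern_coef N n)%:C *
                   Iper (fun s => (f s)%:C * mode n s) * mode (- n) t).
Proof.
move=> cf; rewrite /kconv rmorphM /= -Iper_real.
rewrite [X in Iper X](_ : _ = fun s => ssum N (fun n =>
    ((kern_coef N n)%:C * mode (- n) t) * ((f s)%:C * mode n s))); last first.
  apply/funext => s; rewrite rmorphM /= kernE mulr_ssumr; apply: eq_ssum => n.
  have -> : mode (- n) (t - s) = mode (- n) t * mode n s.
    by rewrite /mode mulrBr expiD; congr (_ * expi _); rewrite mulrNz !mulNr opprK.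
  ring.
have cc n : ccontinuous (fun s => (f s)%:C * mode n s).
  by apply: ccontinuousM; [exact: ccontinuous_real|exact: ccontinuous_mode].
rewrite Iper_ssum; last first.
  by move=> n; apply: ccontinuousM => //; exact: ccontinuous_cst.
rewrite mulr_ssumr; apply: eq_ssum => n; rewrite IperZ//.
by rewrite [in RHS]rmorphM /=; ring.
Qed.

Lemma kconv1 N t : kconv (fun=> 1) N t = 1.
Proof.
apply: (@complexI R); rewrite kconvE; last exact: cst_continuous.
have h n : Iper (fun s => 1%:C * mode n s) = if n == 0 then P%:C else 0.
  rewrite -(Iper_mode P_gt0); congr Iper; apply/funext => s; exact: mul1r.
rewrite ssum_only0 => [|n n0]; last by rewrite h (negbTE n0) mulr0 mul0r.
rewrite h eqxx oppr0 mode0 mulr1 -rmorphM /=; congr (_%:C).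
by rewrite -mulrA [_ * P]mulrC mulVf// gt_eqF// mulr_gt0// kern_coef0_gt0.
Qed.

Lemma cos_le (x y : R) : 0 <= x <= y -> y <= pi -> cos y <= cos x.
Proof.
move=> /andP[x0]; rewrite le_eqVlt => /predU1P[->//|xy yp].
by rewrite ltW// ltr_cos// in_itv /=; lra.
Qed.

(** The half angle [Om |x| / 2] stays at distance at least [Om del / 2] from both 0 and pi, where
    |cos| is at most [cos (Om del / 2)]. *)
Lemma kern_far N (del x : R) : 0 < del <= P / 2 -> del <= `|x| <= P - del ->
  kern N x <= cos (Om * del / 2) ^+ N.*2.
Proof.
move=> /andP[d0 dP] /andP[dx xP]; set c := cos _.
have Om0 := frequency_gt0 P_gt0.
have OmP : Om * P = 2 * pi by rewrite /frequency mulfVK// gt_eqF.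
have pi0 := pi_gt0 R.
have -> : kern N x = `|cos (Om * `|x| / 2)| ^+ N.*2.
  rewrite /kern; have -> : cos (Om * `|x| / 2) = cos (Om * x / 2).
    by have [//|_] := ger0P x; rewrite mulrN mulNr cosN.
  by rewrite -muln2 mulnC !exprM real_normK// num_real.
have a1 : Om * del / 2 <= Om * `|x| / 2 by rewrite ler_pM2r// ler_pM2l.
have a2 : Om * `|x| / 2 <= pi - Om * del / 2.
  have : Om * `|x| <= Om * (P - del) by rewrite ler_pM2l.
  by rewrite mulrBr OmP; lra.
have a0 : 0 < Om * del / 2 by rewrite divr_gt0// mulr_gt0.
apply: lerXn2r; rewrite ?nnegrE//.
  apply: cos_ge0_pihalf; have : Om * del <= Om * (P / 2) by rewrite ler_pM2l.
  by rewrite mulrA OmP; lra.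
rewrite ler_norml; apply/andP; split.
  by rewrite /c -[cos (Om * del / 2)]cosN -cosDpi; apply: cos_le; lra.
by apply: cos_le; lra.
Qed.

(** Split c^(2N) into two factors c^N: N c^N stays below the geometric series 1 / (1 - c), and the
    other factor tends to 0. *)
Lemma mulrn_geometric_small (c e : R) : 0 <= c < 1 -> 0 < e ->
  exists N0, forall N, (N0 <= N)%N -> (N.*2.+1)%:R * c ^+ N.*2 <= e.
Proof.
move=> /andP[c0 c1] e0.
have nc N : N%:R * c ^+ N <= (1 - c)^-1.
  rewrite -[leRHS]mul1r ler_pdivlMr ?subr_gt0//.
  have h : N%:R * c ^+ N <= \sum_(i < N) c ^+ i.
    rewrite mulr_natl -[X in _ *+ X]card_ord -sumr_const; apply: ler_sum => i _.
    by apply: ler_wiXn2l => //; [exact: ltW|exact: ltnW (ltn_ord i)].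
  apply: (@le_trans _ _ ((\sum_(i < N) c ^+ i) * (1 - c))).
    by rewrite ler_wpM2r// subr_ge0 ltW.
  have := subrX1 c N; have := exprn_ge0 N c0; lra.
have : (fun N => c ^+ N) @ \oo --> (0 : R) by apply: cvg_expr; rewrite ger0_norm.
have e' : 0 < e / (2 * (1 - c)^-1 + 1).
  by rewrite divr_gt0// ltr_wpDl// mulr_ge0// invr_ge0 subr_ge0 ltW.
move=> /cvgrPdist_lt/(_ _ e')[N0 _ hN0]; exists N0 => N /hN0 /=.
rewrite sub0r normrN ger0_norm ?exprn_ge0// => hc.
have -> : (N.*2.+1)%:R * c ^+ N.*2 = c ^+ N * (2 * (N%:R * c ^+ N) + c ^+ N).
  by rewrite -addnn exprD -natr1 natrD; ring.
apply: (@le_trans _ _ (c ^+ N * (2 * (1 - c)^-1 + 1))).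
  apply: ler_wpM2l; first exact: exprn_ge0.
  by apply: lerD; [rewrite ler_wpM2l|rewrite exprn_ile1// ltW].
by rewrite -ler_pdivlMr ?ltW//; rewrite ltr_wpDl// mulr_ge0// invr_ge0 subr_ge0 ltW.
Qed.

End approximate_identity.

(** * Construction of the weight *)

Section weight.
Context (R : realType) (P : R).
Hypothesis P_gt0 : 0 < P.
Local Notation Om := (frequency P).
Local Notation mode := (mode P).
Local Notation Iper := (Iper P).
Local Notation kern := (kern P).
Local Notation kern_coef := (@kern_coef R).
Local Notation kconv := (kconv P).
Local Notation RI f := (Rintegral lebesgue_measure `[0%R, P] f).

Lemma itv0P_integrable (f : R -> R) : continuous f ->
  lebesgue_measure.-integrable `[0%R, P] (EFin \o f).
Proof. exact: continuous_integrable_itv. Qed.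

Lemma le_RI (f g : R -> R) : continuous f -> continuous g ->
  (forall t, 0 <= t <= P -> f t <= g t) -> RI f <= RI g.
Proof.
move=> cf cg fg; by apply: le_Rintegral => //; exact: itv0P_integrable.
Qed.

Lemma RID (f g : R -> R) : continuous f -> continuous g ->
  RI (fun t => f t + g t) = RI f + RI g.
Proof. by move=> cf cg; rewrite RintegralD//; exact: itv0P_integrable. Qed.

Lemma RIZ (c : R) (f : R -> R) : continuous f -> RI (fun t => c * f t) = c * RI f.
Proof. by move=> cf; rewrite RintegralZl//; exact: itv0P_integrable. Qed.

Lemma RI_cst (c : R) : RI (fun=> c) = P * c.
Proof.
by rewrite Rintegral_cst//= lebesgue_measure_itv /= lte_fin P_gt0 /= subr0 mulrC.
Qed.

Lemma kconv_approx (f : R -> R) (e : R) : continuous f -> f P = f 0 -> 0 < e ->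
  exists N0, forall N, (N0 <= N)%N ->
    forall t, 0 <= t <= P -> `|kconv f N t - f t| <= e.
Proof.
move=> cf fP e0.
have e4 : 0 < e / 4 by rewrite divr_gt0.
have [del0 del00 hdel] := @continuous_uniform_itv R f 0 P _ cf e4.
have [B B0 hB] := continuous_bounded_itv (ltW P_gt0) cf.
pose del := Num.min del0 (P / 2).
have del_gt0 : 0 < del by rewrite lt_min del00 divr_gt0.
have delP : 0 < del <= P / 2 by rewrite del_gt0 ge_min lexx orbT.
have deldel0 : del <= del0 by rewrite ge_min lexx.
pose c := cos (Om * del / 2).
have Om0 := frequency_gt0 P_gt0.
have pi0 := pi_gt0 R.
have OmP : Om * P = 2 * pi by rewrite /frequency mulfVK// gt_eqF.
have Odel : 0 < Om * del / 2 <= pi / 2.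
  apply/andP; split; first by rewrite divr_gt0// mulr_gt0.
  have : Om * del <= Om * (P / 2) by rewrite ler_pM2l//; case/andP: delP.
  by rewrite mulrA OmP; lra.
have c01 : 0 <= c < 1.
  have /andP[x0 x1] := Odel; apply/andP; split.
    by apply: cos_ge0_pihalf; apply/andP; split; lra.
  by rewrite -(cos0 R) /c ltr_cos ?in_itv /=; try (apply/andP; split); lra.
(* Nearness is meant modulo the period: if |t - s| > P - del, the two times lie at opposite ends and
   are compared through [f P = f 0]. *)
have near_or_far s t : 0 <= s <= P -> 0 <= t <= P ->
    (`|f s - f t| <= e / 2) \/ del <= `|t - s| <= P - del.
  move=> sP tP; have [h|h] := ltP `|t - s| del.
    left; have : `|f s - f t| <= e / 4; last by lra.
    by apply: hdel => //; rewrite distrC (lt_le_trans h).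
  have [h2|h2] := leP `|t - s| (P - del); first by right.
  left; have [ts|ts] := leP s t.
    rewrite ger0_norm ?subr_ge0// in h2.
    have h3 : `|f P - f t| <= e / 4.
      by apply: hdel => //; rewrite ger0_norm; lra.
    have h4 : `|f s - f 0| <= e / 4.
      by apply: hdel; [lra|rewrite subr0 ger0_norm; lra].
    rewrite (_ : f s - f t = (f s - f 0) + (f P - f t)); last by rewrite fP; ring.
    by rewrite (le_trans (ler_normD _ _))//; lra.
  rewrite ltr0_norm ?subr_lt0// in h2.
  have h3 : `|f s - f P| <= e / 4.
    by apply: hdel; [lra|rewrite ler0_norm; lra].
  have h4 : `|f 0 - f t| <= e / 4.
    by apply: hdel => //; rewrite sub0r normrN ger0_norm; lra.
  rewrite (_ : f s - f t = (f s - f P) + (f 0 - f t)); last by rewrite fP; ring.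
  by rewrite (le_trans (ler_normD _ _))//; lra.
(* Since [(kern_coef N 0)^-1 <= 2N + 1], this choice makes the far part [2 * B * c ^+ N.*2] at most
   [e / 2 * kern_coef N 0], as much as the near part contributes. *)
have eB : 0 < e / (4 * B) by rewrite divr_gt0// mulr_gt0.
have [N0 hN0] := mulrn_geometric_small c01 eB.
exists N0 => N /hN0 hN t tP.
have k0 := kern_coef0_gt0 R N.
have Pk0 : 0 < P * kern_coef N 0 by rewrite mulr_gt0.
have ck := @continuous_kernB R P N t.
have cfk : continuous (fun s => f s * kern N (t - s)).
  by move=> s; apply: cvgM; [exact: cf|exact: ck].
have k_ge0 x : 0 <= kern N x.
  by rewrite /kern -muln2 mulnC exprM exprn_ge0// sqr_ge0.
have RIk : RI (fun s => kern N (t - s)) = P * kern_coef N 0.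
  have := kconv1 P_gt0 N t; rewrite /kconv.
  under eq_Rintegral do rewrite mul1r.
  by move=> h; rewrite -[RHS]mulr1 -h mulVKf// gt_eqF.
have -> : kconv f N t - f t =
    (P * kern_coef N 0)^-1 * RI (fun s => (f s - f t) * kern N (t - s)).
  rewrite [X in _ * X](_ : _ = RI (fun s => f s * kern N (t - s)) - f t * (P * kern_coef N 0)).
    by rewrite mulrBr /kconv [f t * _]mulrC mulKf// gt_eqF.
  rewrite -RIk -mulNr -RIZ// -RID//; last first.
    by move=> s; apply: cvgM; [exact: cvg_cst|exact: ck].
  by apply: eq_Rintegral => s _; ring.
rewrite normrM gtr0_norm ?invr_gt0// mulrC ler_pdivrMr//.
have cF : continuous (fun s => (f s - f t) * kern N (t - s)).
  by move=> s; apply: cvgM; [apply: cvgB; [exact: cf|exact: cvg_cst]|exact: ck].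
apply: (le_trans (le_normr_Rintegral _ (itv0P_integrable cF))) => //.
apply: (@le_trans _ _ (RI (fun s => (e / 2) * kern N (t - s) + 2 * B * c ^+ N.*2))).
  apply: le_RI; [| |move=> s sP].
  - by move=> s; apply: cvg_norm; exact: cF.
  - by move=> s; apply: cvgD; [apply: cvgM; [exact: cvg_cst|exact: ck]|exact: cvg_cst].
  rewrite normrM [`|kern _ _|]ger0_norm//.
  have cN : 0 <= c ^+ N.*2 by apply: exprn_ge0; case/andP: c01.
  have [h|h] := near_or_far s t sP tP.
    by apply: ler_wpDr; [rewrite !mulr_ge0// ltW|rewrite ler_wpM2r].
  apply: ler_wpDl; first by rewrite mulr_ge0// divr_ge0// ltW.
  apply: ler_pM => //; last exact: kern_far.
  by rewrite (le_trans (ler_normB _ _))// mulr_natl mulr2n lerD// hB.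
rewrite RID; [|by move=> s; apply: cvgM; [exact: cvg_cst|exact: ck]|exact: cst_continuous].
rewrite RIZ// RIk RI_cst.
have h1 : c ^+ N.*2 <= e / (4 * B) * kern_coef N 0.
  rewrite -ler_pdivrMr//; apply: le_trans hN; rewrite mulrC ler_wpM2r//.
    by apply: exprn_ge0; case/andP: c01.
  exact: kern_coef0_inv.
have h2 : 2 * B * c ^+ N.*2 <= e / 2 * kern_coef N 0.
  have B2 : 0 < 2 * B by rewrite mulr_gt0.
  apply: (@le_trans _ _ (2 * B * (e / (4 * B) * kern_coef N 0))).
    by rewrite ler_pM2l.
  rewrite le_eqVlt; apply/orP; left; apply/eqP; field.
  by rewrite gt_eqF.
have h3 : P * (2 * B * c ^+ N.*2) <= P * (e / 2 * kern_coef N 0) by rewrite ler_pM2l.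
nra.
Qed.

(** An antiderivative differentiable on the whole line, end points of the period included, is
    obtained by integrating from -oo. To make this integral exist, [m] is multiplied by the
    continuous cutoff (|t + 1| - |t| + 1) / 2, which is 1 for t >= 0 and 0 for t <= -1. *)
Lemma global_antiderivative (m : R -> R) : continuous m ->
  exists g F : R -> R, [/\ continuous g, forall t : R, is_derive t 1 F (g t),
    forall t, 0 <= t -> g t = m t & F P - F 0 = RI m].
Proof.
move=> cm.
pose g t := m t * ((`|t + 1| - `|t| + 1) / 2).
have cg : continuous g.
  move=> t; apply: cvgM; first exact: cm.
  apply: cvgM; last exact: cvg_cst.
  apply: cvgD; last exact: cvg_cst.
  apply: cvgB; apply: cvg_norm; last exact: cvg_id.
  by apply: cvgD; [exact: cvg_id|exact: cvg_cst].
have gm t : 0 <= t -> g t = m t.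
  by move=> t0; rewrite /g !ger0_norm ?addr_ge0//; field.
have g0 t : t < -1 -> g t = 0.
  by move=> t1; rewrite /g (@ltr0_norm _ (t + 1)) ?(@ltr0_norm _ t); [field|lra..].
have ig (u : R) : lebesgue_measure.-integrable `]-oo, u] (EFin \o g).
  have -> : EFin \o g = (EFin \o g) \_ `[-1, +oo[%classic.
    apply/funext => t; rewrite patchE; case: ifPn => //.
    by rewrite notin_setE /= in_itv /= andbT => /negP; rewrite -ltNge => /g0 ->.
  apply/integrable_restrict => //.
  have -> : `]-oo, u]%classic `&` `[-1, +oo[%classic = `[-1, u]%classic :> set R.
    apply/seteqP; split => t /=; rewrite !in_itv /= andbT.
      by move=> [-> ->].
    by move=> /andP[-> ->].
  exact: continuous_integrable_itv.
pose F (y : R) := Rintegral lebesgue_measure `]-oo, y] g.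
have dF (t : R) : is_derive t 1 F (g t).
  have tt : t < t + 1 by rewrite ltrDl.
  have := continuous_FTC1 tt (ig _); rewrite ltNyr => /(_ isT (cg t))[d1 d2].
  by split; [exact: d1|rewrite -derive1E; exact: d2].
exists g, F; split => //.
rewrite -(FTC2_is_derive P_gt0 cg dF).
by apply: eq_Rintegral => t; rewrite inE /= in_itv /= => /andP[t0 _]; exact: gm.
Qed.

(** The exponential weight and its derivative are convolved with the same kernel: the second
    convolution is the termwise derivative of the first, so both are approximated uniformly by one
    polynomial and its derivative. *)
Lemma weight_exists (m : R -> R) (mbar : R) : continuous m -> m P = m 0 ->
  P * mbar = RI m -> 0 < mbar ->
  exists (L : nat) (c : int -> R[i]) (phi phi' : R -> R) (del : R),
  [/\ 0 < del,
      forall t, (phi t)%:C = ssum L (fun n => c n * mode (- n) t),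
      forall t, (phi' t)%:C =
        ssum L (fun n => - 'i * (n%:~R * Om)%:C * c n * mode (- n) t) &
      forall t, 0 <= t <= P ->
        del <= phi t /\ del <= 2 * mbar * phi t - phi' t / 2 - m t * phi t / 2].
Proof.
move=> cm mP Pmbar mbar0.
have [g [F [cg dF gm FP]]] := global_antiderivative cm.
pose phi0 t := expR (mbar * t - F t).
pose phi0' t := (mbar - g t) * phi0 t.
have dphi (t : R) : is_derive t 1 phi0 (phi0' t).
  have dl : is_derive t 1 (fun x : R => mbar * x - F x) (mbar - g t).
    have := dF t => dFt.
    have -> : (fun x : R => mbar * x - F x) = mbar *: (id : R -> R) - F by [].
    by apply: is_derive_eq; rewrite /GRing.scale /= mulr1.
  rewrite /phi0' mulrC.
  exact: (@is_derive1_comp _ expR (fun x => mbar * x - F x) t _ _ (is_derive_expR _) dl).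
have cphi0 : continuous phi0 by exact: is_derive_continuous dphi.
have cphi0' : continuous phi0'.
  by move=> t; apply: cvgM; [apply: cvgB; [exact: cvg_cst|exact: cg]|exact: cphi0].
(* The exponent has equal values at 0 and P exactly because [mbar] is the mean of [m]. *)
have phi0P : phi0 P = phi0 0.
  by rewrite /phi0; congr expR; move: FP; rewrite -Pmbar; lra.
have phi0'P : phi0' P = phi0' 0 by rewrite /phi0' phi0P !gm// ?mP// ltW.
have [tm _ htm] := EVT_min (ltW P_gt0) (@within_itv_continuous _ _ 0 P cphi0).
have [Bm Bm0 hBm] := continuous_bounded_itv (ltW P_gt0) cm.
pose a := phi0 tm; have a0 : 0 < a by exact: expR_gt0.
(* Errors [e] in the weight and its derivative change [2 mbar phi - phi'/2 - m phi/2] by at most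
   [q e]. On the period this quantity is [(3/2) mbar phi0 >= (3/2) mbar a], so [q e <= mbar a / 2]
   leaves [mbar a]. *)
pose q := 2 * mbar + 1 / 2 + Bm / 2.
have q0 : 0 < q by rewrite /q; lra.
pose e := Num.min (a / 2) (mbar * a / 2 / q).
have e0 : 0 < e by rewrite lt_min !divr_gt0// mulr_gt0.
have [N1 h1] := kconv_approx cphi0 phi0P e0.
have [N2 h2] := kconv_approx cphi0' phi0'P e0.
pose N := maxn N1 N2.
have cm0 n : ccontinuous (fun s => (phi0 s)%:C * mode n s).
  by apply: ccontinuousM; [exact: ccontinuous_real|exact: ccontinuous_mode].
exists N, (fun n => ((P * kern_coef N 0)^-1 * kern_coef N n)%:C *
                   Iper (fun s => (phi0 s)%:C * mode n s)),
  (kconv phi0 N), (kconv phi0' N), (Num.min (a / 2) (mbar * a)); split.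
- by rewrite lt_min divr_gt0// mulr_gt0.
- by move=> t; rewrite kconvE.
- move=> t; rewrite kconvE//; apply: eq_ssum => n; congr (_ * _).
  (* Coefficient [n] of [phi0'] is [- i n Om] times that of [phi0], and the kernel multiplies both
     by the same number. *)
  have := @Iper_by_parts _ P P_gt0 (fun t => (phi0 t)%:C) (fun t => (phi0' t)%:C) n.
  rewrite phi0P => -> //; first by rewrite mulrCA !mulNr.
    by move=> s; split; [exact: dphi|exact: is_derive_cst].
  exact: ccontinuous_real.
- move=> t tP; have := h1 N (leq_maxl _ _) t tP; have := h2 N (leq_maxr _ _) t tP.
  set x := kconv _ _ _; set y := kconv _ _ _.
  have at0 : a <= phi0 t by apply: htm; rewrite in_itv.
  have := hBm t tP; rewrite /phi0' gm; last by case/andP: tP.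
  have ea : e <= a / 2 by rewrite ge_min lexx.
  have eq0 : e * q <= mbar * a / 2 by rewrite -ler_pdivlMr// ge_min lexx orbT.
  move: (m t) (phi0 t) at0 => mt p at0 hm hy hx.
  split; first by rewrite ge_min; move: hx; rewrite ler_distl; lra.
  rewrite ge_min; apply/orP; right.
  move: hx; rewrite ler_distl => /andP[hx1 hx2].
  move: hy; rewrite ler_distl => /andP[hy1 hy2].
  move: hm; rewrite ler_norml => /andP[hm1 hm2].
  have : mt * (y - p) <= Bm * e.
    rewrite (le_trans (ler_norm _))// normrM ler_pM//.
      by rewrite ler_norml hm1.
    by rewrite ler_distl; apply/andP; split; lra.
  have : mbar * a <= mbar * p by rewrite ler_pM2l.
  have : mbar * (p - e) <= mbar * y by rewrite ler_pM2l//; lra.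
  by move: eq0; rewrite /q; lra.
Qed.

End weight.

(** * Hermitian forms along trigonometric polynomials *)

Section more_ssum.

Lemma absz_harmonic K (j : 'I_K.*2.+1) : (absz (harmonic j) <= K)%N.
Proof. by case: j => j jK; rewrite /harmonic /=; lia. Qed.

Lemma harmonic_surj K n : (absz n <= K)%N -> exists j : 'I_K.*2.+1, harmonic j = n.
Proof.
move=> nK; have nQ : (absz (n + K%:Z)%R < K.*2.+1)%N by lia.
by exists (Ordinal nQ); rewrite /harmonic /=; lia.
Qed.

Lemma eq_ssum_in (V : nmodType) Q (F G : int -> V) :
  (forall n, (absz n <= Q)%N -> F n = G n) -> ssum Q F = ssum Q G.
Proof. by move=> FG; apply: eq_bigr => j _; rewrite FG// absz_harmonic. Qed.

Lemma ssumD (V : nmodType) Q (F G : int -> V) :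
  ssum Q (fun n => F n + G n) = ssum Q F + ssum Q G.
Proof. by rewrite /ssum big_split. Qed.

Lemma ssum0 (V : nmodType) Q : ssum Q (fun=> 0 : V) = 0.
Proof. by rewrite /ssum big1. Qed.

Lemma exchange_ssum (V : nmodType) Q K (F : int -> int -> V) :
  ssum Q (fun n => ssum K (F n)) = ssum K (fun k => ssum Q (F^~ k)).
Proof. by rewrite /ssum exchange_big. Qed.

(** The window may start anywhere at or below [-K], which covers both widening ([a = -Q]) and
    shifting ([a = -Q - l]). *)
Lemma window_sum (V : nmodType) K (a : int) (N : nat) (F : int -> V) :
  (forall n, (K < absz n)%N -> F n = 0) -> a <= - K%:Z -> K%:Z < a + N%:Z ->
  \sum_(i < N) F (a + i%:Z) = ssum K F.
Proof.
move=> F0 aK KaN.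
rewrite -(big_mkord xpredT (fun i => F (a + i%:Z))).
pose p := absz (- K%:Z - a).
have pN : (p + K.*2.+1 <= N)%N by lia.
rewrite (big_cat_nat (n := p))//=; last by lia.
rewrite big1_seq ?add0r; last first.
  by move=> i; rewrite mem_index_iota => /andP[_ /andP[_ ip]]; apply: F0; lia.
rewrite (big_cat_nat (n := (p + K.*2.+1)%N))//=; last by lia.
rewrite [X in _ + X]big1_seq ?addr0; last first.
  by move=> i; rewrite mem_index_iota => /andP[_ /andP[ip _]]; apply: F0; lia.
rewrite -{1}[p]add0n big_addn addKn big_mkord; apply: eq_bigr => i _.
by congr F; rewrite /harmonic; lia.
Qed.

Lemma ssum_widen (V : nmodType) K Q (F : int -> V) :
  (forall n, (K < absz n)%N -> F n = 0) -> (K <= Q)%N -> ssum Q F = ssum K F.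
Proof.
move=> F0 KQ; rewrite -(@window_sum _ K (- Q%:Z) Q.*2.+1 F)//; [|lia|lia].
by apply: eq_bigr => i _; congr F; rewrite /harmonic; lia.
Qed.

Lemma ssum_shift (V : nmodType) K L Q (l : int) (F : int -> V) :
  (forall n, (K < absz n)%N -> F n = 0) -> (absz l <= L)%N -> (K + L <= Q)%N ->
  ssum Q (fun n => F (n - l)) = ssum Q F.
Proof.
move=> F0 lL KLQ; rewrite (@ssum_widen _ K Q F)//; last by lia.
rewrite -(@window_sum _ K (- Q%:Z - l) Q.*2.+1 F)//; [|lia|lia].
by apply: eq_bigr => i _; congr F; rewrite /harmonic; lia.
Qed.

End more_ssum.

Section hermitian_forms.
Context (R : realType) (V : lmodType R[i]).
Implicit Types (F : V -> V -> R[i]).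

Definition hermitian_form F :=
  (forall c x y z, F z (c *: x + y) = c * F z x + F z y) /\
  (forall x y, F x y = (F y x)^*).

Definition qform F x : R := Re (F x x).

Context (F : V -> V -> R[i]).
Hypothesis hF : hermitian_form F.

Lemma form0r x : F x 0 = 0.
Proof.
have [lin _] := hF; have := lin (-1) 0 0 x.
by rewrite scaler0 addr0 mulN1r addNr.
Qed.

Lemma formDr z x y : F z (x + y) = F z x + F z y.
Proof. by have [lin _] := hF; rewrite -{1}[x]scale1r lin mul1r. Qed.

Lemma formZr z c x : F z (c *: x) = c * F z x.
Proof. by have [lin _] := hF; rewrite -[c *: x]addr0 lin form0r addr0. Qed.

Lemma form_conj x y : F x y = (F y x)^*.
Proof. by have [_ ->] := hF. Qed.

Lemma form0l x : F 0 x = 0.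
Proof. by rewrite form_conj form0r conjc0. Qed.

Lemma formDl z x y : F (x + y) z = F x z + F y z.
Proof. by rewrite form_conj formDr rmorphD /= -!form_conj. Qed.

Lemma formZl z c x : F (c *: x) z = conjc c * F x z.
Proof. by rewrite form_conj formZr rmorphM /= -form_conj. Qed.

Lemma formNr z x : F z (- x) = - F z x.
Proof. by rewrite -scaleN1r formZr mulN1r. Qed.

Lemma formNl z x : F (- x) z = - F x z.
Proof. by rewrite form_conj formNr rmorphN /= -form_conj. Qed.

Lemma formBr z x y : F z (x - y) = F z x - F z y.
Proof. by rewrite formDr -scaleN1r formZr mulN1r. Qed.

Lemma form_ssumr z Q (x : int -> V) : F z (ssum Q x) = ssum Q (fun n => F z (x n)).
Proof.
by rewrite /ssum; elim/big_rec2 : _ => [|j y1 y2 _ <-]; rewrite ?form0r ?formDr.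
Qed.

Lemma form_ssuml z Q (x : int -> V) : F (ssum Q x) z = ssum Q (fun n => F (x n) z).
Proof.
by rewrite /ssum; elim/big_rec2 : _ => [|j y1 y2 _ <-]; rewrite ?form0l ?formDl.
Qed.

Lemma form_Im x : Im (F x x) = 0.
Proof.
have /(congr1 (@complex.Im R)) := form_conj x x; rewrite Im_conj => /eqP.
by rewrite -addr_eq0 -mulr2n mulrn_eq0 => /orP[//|/eqP].
Qed.

Lemma form_qform x : F x x = (qform F x)%:C.
Proof. by apply: complex_eq => //=; exact: form_Im. Qed.

Lemma qformZ c x : qform F (c *: x) = (Re c ^+ 2 + Im c ^+ 2) * qform F x.
Proof.
by rewrite /qform formZr formZl mulrA [c * _]mulrC mulConjE form_qform -rmorphM.
Qed.

Lemma Re_form_conj x y : Re (F x y) = Re (F y x).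
Proof. by rewrite form_conj Re_conj. Qed.

End hermitian_forms.

Section bounded_forms.
Context (R : realType) (V : lmodType R[i]) (F S : V -> V -> R[i]) (C : R).
Hypotheses (hF : hermitian_form F) (hS : hermitian_form S).
Hypothesis FS : forall x, `|qform F x| <= C * qform S x.

(* Polarization and the parallelogram law; [l] balances the two terms. *)
Lemma bounded_form_AMGM (l : R) x y : 0 < l ->
  `|Re (F x y)| <= C / 2 * (l * qform S x + qform S y / l).
Proof.
move=> l0.
have pol z : 4 * Re (F z y) = qform F (z + y) - qform F (z - y).
  rewrite /qform !(formDr hF) !(formDl hF) !(formNr hF) !(formNl hF) !ReD !ReN.
  by rewrite (Re_form_conj hF y z); ring.
have par z : qform S (z + y) + qform S (z - y) = 2 * (qform S z + qform S y).
  rewrite /qform !(formDr hS) !(formDl hS) !(formNr hS) !(formNl hS) !ReD !ReN.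
  by rewrite (Re_form_conj hS y z); ring.
have h z : `|Re (F z y)| <= C / 2 * (qform S z + qform S y).
  have h4 : `|4 * Re (F z y)| <= C * qform S (z + y) + C * qform S (z - y).
    by rewrite pol (le_trans (ler_normB _ _))// lerD.
  move: h4; rewrite -mulrDr par normrM ger0_norm//.
  by move: `|_| => v; lra.
have := h (l%:C *: x); rewrite (formZl hF) conj_real ReZ normrM gtr0_norm//.
rewrite (qformZ hS) /= expr0n addr0 mulrC -ler_pdivlMr// => /le_trans; apply.
rewrite le_eqVlt; apply/orP; left; apply/eqP; field.
by rewrite gt_eqF.
Qed.

(** With S(r) = 0 the preceding estimate reads |Re F(x, r)| <= C/2 l S(x) for every l > 0, and l can
    be taken arbitrarily small. Replacing [x] by ['i *: x] handles the imaginary part. *)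
Lemma bounded_form_ker r x : qform S r = 0 -> F x r = 0.
Proof.
move=> Sr.
have Re0 v : Re (F v r) = 0.
  apply/eqP; rewrite -normr_le0; apply/ler_addgt0Pl => e e0; rewrite addr0.
  have [Sv|Sv0] := eqVneq (C / 2 * qform S v) 0.
    have := bounded_form_AMGM v r ltr01.
    by rewrite Sr mul1r mul0r addr0 Sv => /le_trans; apply; exact: ltW.
  have l0 : 0 < e / `|C / 2 * qform S v| by rewrite divr_gt0// normr_gt0.
  have := bounded_form_AMGM v r l0.
  rewrite Sr mul0r addr0 mulrCA => /le_trans; apply.
  rewrite -[leRHS](@mulfVK _ `|C / 2 * qform S v| _ e) ?normr_eq0//.
  by apply: ler_wpM2l; [exact: ltW|exact: ler_norm].
apply: complex_eq; rewrite ?Re0//=.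
have := Re0 ('i *: x); rewrite (formZl hF) ReM Re_conj Im_conj /= mul0r sub0r mulN1r opprK.
by [].
Qed.

End bounded_forms.

(** * Calculus of vector-valued trigonometric polynomials *)

Section trigonometric_polynomials.
Context (R : realType) (P : R).
Hypothesis P_gt0 : 0 < P.
Context (V : lmodType R[i]) (Q : nat).
Local Notation Om := (frequency P).
Local Notation mode := (mode P).
Local Notation Iper := (Iper P).
Implicit Types (x y : int -> V).

Definition tpoly x (t : R) : V := ssum Q (fun n => mode (- n) t *: x n).

Definition dtime x (n : int) : V := (- 'i * (n%:~R * Om)%:C) *: x n.

Lemma tpolyD x y t : tpoly (fun n => x n + y n) t = tpoly x t + tpoly y t.
Proof. by rewrite /tpoly -ssumD; apply: eq_ssum => n; rewrite scalerDr. Qed.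

Lemma scaler_ssum (c : R[i]) K x : c *: ssum K x = ssum K (fun n => c *: x n).
Proof. exact: scaler_sumr. Qed.

Lemma tpolyZ c x t : tpoly (fun n => c *: x n) t = c *: tpoly x t.
Proof.
rewrite /tpoly scaler_ssum; apply: eq_ssum => n.
by rewrite !scalerA mulrC.
Qed.

Lemma form_tpoly (F : V -> V -> R[i]) x y t : hermitian_form F ->
  F (tpoly x t) (tpoly y t) =
  ssum Q (fun n => ssum Q (fun k => F (x n) (y k) * mode (n - k) t)).
Proof.
move=> hF; rewrite form_ssuml//; apply: eq_ssum => n.
rewrite formZl// conj_mode opprK form_ssumr// mulr_ssumr; apply: eq_ssum => k.
by rewrite formZr// modeD; ring.
Qed.

Section time_dependent_form.
Context (F : R -> V -> V -> R[i]).
Hypothesis hF : forall t, hermitian_form (F t).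
Hypothesis cF : forall v v' : V, ccontinuous (fun t => F t v v').

Lemma ccontinuous_form_mode (v v' : V) n : ccontinuous (fun t => F t v v' * mode n t).
Proof. by apply: ccontinuousM => //; exact: ccontinuous_mode. Qed.

Lemma ccontinuous_form_tpoly x y : ccontinuous (fun t => F t (tpoly x t) (tpoly y t)).
Proof.
under eq_fun do rewrite form_tpoly//.
by apply: ccontinuous_sum => i _; apply: ccontinuous_sum => j _; exact: ccontinuous_form_mode.
Qed.

Lemma Iper_form_tpoly x y : Iper (fun t => F t (tpoly x t) (tpoly y t)) =
  ssum Q (fun n => ssum Q (fun k => Iper (fun t => F t (x n) (y k) * mode (n - k) t))).
Proof.
under eq_fun do rewrite form_tpoly//.
rewrite Iper_ssum; last first.
  by move=> n; apply: ccontinuous_sum => j _; exact: ccontinuous_form_mode.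
apply: eq_ssum => n; rewrite Iper_ssum// => k; exact: ccontinuous_form_mode.
Qed.

End time_dependent_form.

(** Parseval's identity: for a form constant in time only the pairs n = k survive integration. *)
Lemma Iper_cst_form_tpoly (F : V -> V -> R[i]) x y : hermitian_form F ->
  Iper (fun t => F (tpoly x t) (tpoly y t)) = P%:C * ssum Q (fun n => F (x n) (y n)).
Proof.
move=> hF; rewrite (@Iper_form_tpoly (fun=> F))//; last by move=> ? ?; exact: ccontinuous_cst.
rewrite mulr_ssumr; apply: eq_ssum_in => n nQ.
have e k : Iper (fun t => F (x n) (y k) * mode (n - k) t) =
    F (x n) (y k) * (if n - k == 0 then P%:C else 0).
  by rewrite IperZ ?Iper_mode//; exact: ccontinuous_mode.
rewrite (eq_ssum _ e).
have nQ' : (absz (n + Q%:Z)%R < Q.*2.+1)%N by lia.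
rewrite /ssum (bigD1 (Ordinal nQ'))//= big1 ?addr0.
  have -> : harmonic (Ordinal nQ') = n by rewrite /harmonic /=; lia.
  by rewrite subrr eqxx mulrC.
move=> [j jQ] jn; rewrite subr_eq0; case: eqVneq => [nj|_]; last by rewrite mulr0.
exfalso; move: jn => /negP; apply; apply/eqP/val_inj => /=.
by rewrite nj /harmonic /=; lia.
Qed.

(** The three terms form the derivative of a periodic function. In coefficients, the factor [n - k]
    produced by differentiating the mode splits into the contributions of the two [dtime]. *)
Lemma Iper_form_by_parts (A A' : R -> V -> V -> R[i]) x y :
  (forall t, hermitian_form (A t)) -> (forall t, hermitian_form (A' t)) ->
  (forall v v' : V, cderivative (fun t => A t v v') (fun t => A' t v v')) ->
  (forall v v' : V, ccontinuous (fun t => A' t v v')) ->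
  (forall v v' : V, A P v v' = A 0 v v') ->
  Iper (fun t => A' t (tpoly x t) (tpoly y t)) +
  Iper (fun t => A t (tpoly (dtime x) t) (tpoly y t)) +
  Iper (fun t => A t (tpoly x t) (tpoly (dtime y) t)) = 0.
Proof.
move=> hA hA' dA cA' AP.
have cA (v v' : V) : ccontinuous (fun t => A t v v') := cderivative_continuous (dA v v').
rewrite !Iper_form_tpoly// -!ssumD -[RHS](@ssum0 _ Q); apply: eq_ssum => n.
rewrite -!ssumD -[RHS](@ssum0 _ Q); apply: eq_ssum => k.
rewrite (Iper_by_parts P_gt0 _ (dA _ _))//.
have -> : Iper (fun t => A t (dtime x n) (y k) * mode (n - k) t) =
    'i * (n%:~R * Om)%:C * Iper (fun t => A t (x n) (y k) * mode (n - k) t).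
  rewrite -IperZ; last exact: ccontinuous_form_mode.
  congr Iper; apply/funext => t; rewrite formZl// mulrA; congr (_ * _ * _).
  by apply: complex_eq; rewrite ?Re_conj ?Im_conj !(ReM, ImM) !(ReN, ImN) /=; ring.
have -> : Iper (fun t => A t (x n) (dtime y k) * mode (n - k) t) =
    - 'i * (k%:~R * Om)%:C * Iper (fun t => A t (x n) (y k) * mode (n - k) t).
  rewrite -IperZ; last exact: ccontinuous_form_mode.
  by congr Iper; apply/funext => t; rewrite formZr// mulrA.
by rewrite intrB mulrBl rmorphB /=; ring.
Qed.

(** Coefficients of the product of a scalar trigonometric polynomial of degree [L] with
    [tpoly x]. *)
Definition tconv L (c : int -> R[i]) x (n : int) : V :=
  ssum L (fun l => c l *: x (n - l)).

(** The condition [K + L <= Q] leaves room for every mode of the product, so nothing is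
    truncated. *)
Lemma tpoly_tconv K L c x t : (forall n, (K < absz n)%N -> x n = 0) ->
  (K + L <= Q)%N ->
  tpoly (tconv L c x) t = ssum L (fun l => c l * mode (- l) t) *: tpoly x t.
Proof.
move=> x0 KLQ; rewrite /tpoly /tconv.
under eq_ssum do rewrite scaler_ssum.
rewrite exchange_ssum.
rewrite [RHS](_ : _ = ssum L (fun l => (c l * mode (- l) t) *: tpoly x t)); last first.
  by rewrite [LHS]scaler_suml.
apply: eq_ssum_in => l lL.
rewrite /tpoly -(@ssum_shift _ K L Q l (fun n => mode (- n) t *: x n))//; last first.
  by move=> n /x0 ->; rewrite scaler0.
rewrite scaler_ssum; apply: eq_ssum => n; rewrite !scalerA; congr (_ *: _).
by rewrite -mulrA -modeD mulrC; congr (_ * mode _ _); ring.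
Qed.

(** Leibniz rule, from [n = l + (n - l)]. *)
Lemma dtime_tconv L c x n : dtime (tconv L c x) n =
  tconv L (fun n => - 'i * (n%:~R * Om)%:C * c n) x n + tconv L c (dtime x) n.
Proof.
rewrite /dtime /tconv scaler_ssum -ssumD; apply: eq_ssum => l.
rewrite !scalerA -scalerDl; congr (_ *: _).
by rewrite intrB mulrBl rmorphB /=; ring.
Qed.

End trigonometric_polynomials.

Section continuity_closure.
Context (R : realType).
Implicit Types (f g : R -> R).

Lemma contD f g : continuous f -> continuous g -> continuous (fun t => f t + g t).
Proof. by move=> cf cg t; apply: cvgD; [exact: cf|exact: cg]. Qed.

Lemma contM f g : continuous f -> continuous g -> continuous (fun t => f t * g t).
Proof. by move=> cf cg t; apply: cvgM; [exact: cf|exact: cg]. Qed.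

Lemma contN f : continuous f -> continuous (fun t => - f t).
Proof. by move=> cf t; apply: cvgN; exact: cf. Qed.

End continuity_closure.

Ltac cts := repeat first [assumption | exact: cst_continuous | apply: contD | apply: contM | apply: contN].

Section integral_comparison.
Context (R : realType) (P : R).
Local Notation RI f := (Rintegral lebesgue_measure `[0%R, P] f).

Lemma le_RI_comb (f f1 f2 f3 f4 : R -> R) (a1 a2 a3 a4 : R) : continuous f ->
  continuous f1 -> continuous f2 -> continuous f3 -> continuous f4 ->
  (forall t, 0 <= t <= P -> f t <= a1 * f1 t + a2 * f2 t + a3 * f3 t + a4 * f4 t) ->
  RI f <= a1 * RI f1 + a2 * RI f2 + a3 * RI f3 + a4 * RI f4.
Proof.
move=> cf c1 c2 c3 c4 h; rewrite -!RIZ//.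
have d1 : continuous (fun t => a1 * f1 t) by cts.
have d2 : continuous (fun t => a2 * f2 t) by cts.
have d3 : continuous (fun t => a3 * f3 t) by cts.
have d4 : continuous (fun t => a4 * f4 t) by cts.
have d12 := contD d1 d2; have d123 := contD d12 d3.
by rewrite -RID// -RID// -RID//; apply: le_RI => //; exact: contD.
Qed.

Lemma le_RI_energy (p p' g s be a a' : R -> R) (k b k0 : R) :
  continuous p -> continuous p' -> continuous g -> continuous s ->
  continuous be -> continuous a -> continuous a' ->
  (forall t, 0 <= t <= P -> k * (g t + s t) <=
     (b * p t - p' t / 2) * (g t + a t) - p t * a' t / 2 + k0 * (p t * be t)) ->
  k * (RI g + RI s) <=
  b * (RI (fun t => p t * g t) + RI (fun t => p t * a t))
  - (RI (fun t => p' t * g t) + RI (fun t => p' t * a t)) / 2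
  - RI (fun t => p t * a' t) / 2 + k0 * RI (fun t => p t * be t).
Proof.
move=> cp cp' cg cs cb ca ca' h.
have c1 := contM cp cg; have c2 := contM cp ca.
have c3 := contM cp' cg; have c4 := contM cp' ca.
rewrite -RID// -RIZ; last exact: contD.
rewrite -RID// -RID//.
have -> : forall I1 I2 I3 I4 : R, b * I1 - I2 / 2 - I3 / 2 + k0 * I4 =
    b * I1 + (- (1 / 2)) * I2 + (- (1 / 2)) * I3 + k0 * I4.
  by move=> *; field.
apply: le_RI_comb.
- by apply: contM; [exact: cst_continuous|exact: contD].
- exact: contD.
- exact: contD.
- exact: contM.
- exact: contM.
by move=> t /h; lra.
Qed.

End integral_comparison.

(** * Weighted energy estimate *)

Section harmonic_systems.
Context (R : realType) (P : R) (V : lmodType R[i]).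
Local Notation Om := (frequency P).
Implicit Types (G S B : V -> V -> R[i]) (A : R -> V -> V -> R[i]).

(** An abstract spatial discretisation: [G] stands for the mass form, [S] for the unweighted
    gradient form, [A t] and [A' t] for the gradient forms weighted by kappa and its time
    derivative. Keeping the space abstract lets the constants be fixed before [X h] is known. *)
Record coefficient_forms (m : R -> R) (c0 C0 C1 : R) G S A A' : Prop :=
  CoefficientForms {
    cf_G : hermitian_form G;
    cf_S : hermitian_form S;
    cf_A : forall t, hermitian_form (A t);
    cf_A' : forall t, hermitian_form (A' t);
    cf_G0 : forall x, 0 <= qform G x;
    cf_S0 : forall x, 0 <= qform S x;
    cf_der : forall x y, cderivative (fun t => A t x y) (fun t => A' t x y);
    cf_cont : forall x y, ccontinuous (fun t => A' t x y);
    cf_per : forall x y, A P x y = A 0 x y;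
    cf_lo : forall t x, 0 <= t <= P -> c0 * qform S x <= qform (A t) x;
    cf_hi : forall t x, 0 <= t <= P -> `|qform (A t) x| <= C0 * qform S x;
    cf_A'hi : forall t x, 0 <= t <= P -> `|qform (A' t) x| <= C1 * qform S x;
    cf_m : forall t x, 0 <= t <= P -> qform (A' t) x <= m t * qform (A t) x }.

Definition form_coef A (k : int) x y : R[i] :=
  (P^-1)%:C * Iper P (fun t => A t x y * mode P k t).

(** The equations are tested mode by mode, and nontriviality is measured by [G], because [G] may be
    degenerate: a nonzero coordinate vector can represent the zero field. *)
Record modal_eigenvector (K : nat) (k0 : R) G A B (omega : R[i]) (u z : int -> V) : Prop :=
  ModalEigenvector {
    me_u : forall n, (K < absz n)%N -> u n = 0;
    me_z : forall n, (K < absz n)%N -> z n = 0;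
    me_eq1 : forall n v, (absz n <= K)%N ->
      G v (dtime P u n - ('i * omega) *: u n - z n) = 0;
    me_eq2 : forall n v, (absz n <= K)%N ->
      G v (dtime P z n - ('i * omega) *: z n) +
      ssum K (fun k => form_coef A (n - k) v (u k)) + k0%:C * B v (z n) = 0;
    me_nz : exists n, qform G (u n) != 0 \/ qform G (z n) != 0 }.

End harmonic_systems.

Lemma RI_qform (R : realType) (P : R) (V : lmodType R[i]) (F : V -> V -> R[i])
  (Q : nat) (x : int -> V) : 0 < P -> hermitian_form F ->
  Rintegral lebesgue_measure `[0%R, P] (fun t => qform F (tpoly P Q x t)) =
  P * ssum Q (fun n => qform F (x n)).
Proof.
move=> P_gt0 hF; have := congr1 (@complex.Re R) (Iper_cst_form_tpoly P_gt0 Q x x hF).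
by rewrite ReZ Re_Iper /ssum Re_sum.
Qed.

Section energy.
Context (R : realType) (P : R).
Hypothesis P_gt0 : 0 < P.
Context (V : lmodType R[i]) (m : R -> R) (c0 C0 C1 : R).
Context (G S B : V -> V -> R[i]) (A A' : R -> V -> V -> R[i]).
Hypothesis cf : coefficient_forms P m c0 C0 C1 G S A A'.
Hypothesis hB : hermitian_form B.
Hypothesis B0 : forall x, 0 <= qform B x.
Context (lam : R).
Hypothesis S_le_G : forall x, qform S x <= lam * qform G x.
Context (K L : nat) (k0 : R) (omega : R[i]) (u z : int -> V).
Hypothesis me : modal_eigenvector P K k0 G A B omega u z.
Context (c : int -> R[i]) (phi phi' : R -> R).
Hypothesis phiE : forall t, (phi t)%:C = ssum L (fun n => c n * mode P (- n) t).
Hypothesis phi'E : forall t, (phi' t)%:C =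
  ssum L (fun n => - 'i * (n%:~R * frequency P)%:C * c n * mode P (- n) t).
Local Notation Om := (frequency P).
Local Notation Iper := (Iper P).
Local Notation RI f := (Rintegral lebesgue_measure `[0%R, P] f).
Local Notation Q := (K + L)%N.
Local Notation tpoly := (tpoly P Q).
Local Notation Z := (tpoly z).
Local Notation U := (tpoly u).
Local Notation DZ := (tpoly (dtime P z)).
Local Notation DU := (tpoly (dtime P u)).
Local Notation b := (Im omega).

Let y := tconv L c z.
Let w (n : int) : V := if (absz n <= K)%N then 0 else y n.

Definition energy_tail : R := Re (Iper (fun t => A t (tpoly w t) (U t))).

Let hG := cf_G cf.
Let hS := cf_S cf.
Let hA := cf_A cf.
Let hA' := cf_A' cf.

Let cA v v' : ccontinuous (fun t => A t v v').
Proof. exact: cderivative_continuous (cf_der cf v v'). Qed.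

Let ccA v v' := @ccontinuous_form_tpoly _ P V Q A hA cA v v'.
Let ccA' v v' := @ccontinuous_form_tpoly _ P V Q A' hA' (cf_cont cf) v v'.
Let cst_form (F : V -> V -> R[i]) (hF : hermitian_form F) v v' :=
  @ccontinuous_form_tpoly _ P V Q (fun=> F) (fun=> hF)
    (fun x x' => ccontinuous_cst (F x x')) v v'.

Lemma tpoly_y t : tpoly y t = (phi t)%:C *: Z t.
Proof. by rewrite /y (tpoly_tconv _ _ _ (me_z me)) ?phiE. Qed.

Lemma tpoly_dtime_conv (x : int -> V) t : (forall n, (K < absz n)%N -> x n = 0) ->
  tpoly (dtime P (tconv L c x)) t =
  (phi' t)%:C *: tpoly x t + (phi t)%:C *: tpoly (dtime P x) t.
Proof.
move=> x0; rewrite (_ : dtime P _ = fun n =>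
  tconv L (fun n => - 'i * (n%:~R * Om)%:C * c n) x n + tconv L c (dtime P x) n).
  rewrite tpolyD (tpoly_tconv _ _ _ x0)// phi'E phiE.
  rewrite (@tpoly_tconv _ P V Q K L c (dtime P x))//.
  by move=> n /x0; rewrite /dtime => ->; rewrite scaler0.
by apply/funext => n; exact: dtime_tconv.
Qed.

Lemma ccontinuous_phi : ccontinuous (fun t => (phi t)%:C).
Proof.
under eq_fun do rewrite phiE.
apply: ccontinuous_sum => j _; apply: ccontinuousM; first exact: ccontinuous_cst.
exact: ccontinuous_mode.
Qed.

Lemma ccontinuous_phi' : ccontinuous (fun t => (phi' t)%:C).
Proof.
under eq_fun do rewrite phi'E.
apply: ccontinuous_sum => j _; apply: ccontinuousM; first exact: ccontinuous_cst.
exact: ccontinuous_mode.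
Qed.

Lemma continuous_phi : continuous phi.
Proof. by case: ccontinuous_phi. Qed.

Lemma continuous_phi' : continuous phi'.
Proof. by case: ccontinuous_phi'. Qed.

Lemma Iper0 : Iper (fun=> 0) = 0.
Proof. by rewrite Iper_cst// mulr0. Qed.

Lemma P_form_coef k x x' :
  P%:C * form_coef P A k x x' = Iper (fun t => A t x x' * mode P k t).
Proof. by rewrite /form_coef mulrA -rmorphM /= mulfV ?mul1r// gt_eqF. Qed.

(* The second equation tested with the modes |n| <= K of phi z. *)
Lemma tested_equation :
  Iper (fun t => G (tpoly y t) (DZ t)) - 'i * omega * Iper (fun t => G (tpoly y t) (Z t)) +
  (Iper (fun t => A t (tpoly y t) (U t)) - Iper (fun t => A t (tpoly w t) (U t))) +
  k0%:C * Iper (fun t => B (tpoly y t) (Z t)) = 0.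
Proof.
pose y1 n : V := if (absz n <= K)%N then y n else 0.
pose r n := dtime P z n - ('i * omega) *: z n.
have dz0 n : (K < absz n)%N -> r n = 0.
  by move=> nK; rewrite /r /dtime (me_z me nK) !scaler0 subr0.
have KQ : (K <= Q)%N by rewrite leq_addr.
have tr t : tpoly r t = DZ t - ('i * omega) *: Z t.
  by rewrite -scaleNr -tpolyZ -tpolyD; apply: eq_ssum => n; rewrite scaleNr.
have y1w t : tpoly y1 t = tpoly y t - tpoly w t.
  rewrite -scaleN1r -tpolyZ -tpolyD; apply: eq_ssum => n; congr (_ *: _).
  by rewrite /y1 /w; case: ifP; rewrite ?scaler0 ?addr0// scaleN1r subrr.
have h : ssum K (fun n => G (y n) (r n) +
     ssum K (fun k => form_coef P A (n - k) (y n) (u k)) + k0%:C * B (y n) (z n)) = 0.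
  by rewrite -[RHS](@ssum0 _ K); apply: eq_ssum_in => n nK; exact: (me_eq2 me).
(* The forms [G] and [B] do not depend on time, so by orthogonality they only see the modes |n| <= K
   and the full [y] may replace its truncation. Only [A] couples different modes and leaves the term
   in [w]. *)
have T1 : P%:C * ssum K (fun n => G (y n) (r n)) =
    Iper (fun t => G (tpoly y t) (DZ t)) - 'i * omega * Iper (fun t => G (tpoly y t) (Z t)).
  rewrite -(@ssum_widen _ K Q (fun n => G (y n) (r n)))//; last first.
    by move=> n /dz0 ->; rewrite form0r.
  rewrite -Iper_cst_form_tpoly// -mulNr -IperZ; last exact: cst_form.
  rewrite -IperD; [|exact: cst_form|].
    by congr Iper; apply/funext => t; rewrite tr formBr// formZr// mulNr.
  by apply: ccontinuousM; [exact: ccontinuous_cst|exact: cst_form].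
have T3 : P%:C * ssum K (fun n => k0%:C * B (y n) (z n)) =
    k0%:C * Iper (fun t => B (tpoly y t) (Z t)).
  rewrite Iper_cst_form_tpoly// (@ssum_widen _ K Q (fun n => B (y n) (z n)))//.
    by rewrite -mulr_ssumr mulrCA.
  by move=> n /(me_z me) ->; rewrite form0r.
have T2 : P%:C * ssum K (fun n => ssum K (fun k => form_coef P A (n - k) (y n) (u k))) =
    Iper (fun t => A t (tpoly y t) (U t)) - Iper (fun t => A t (tpoly w t) (U t)).
  transitivity (Iper (fun t => A t (tpoly y1 t) (U t))).
    rewrite Iper_form_tpoly// mulr_ssumr.
    rewrite (@ssum_widen _ K Q (fun n => ssum Q _))//; last first.
      move=> n nK; rewrite -[RHS](@ssum0 _ Q); apply: eq_ssum => k.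
      rewrite -[RHS]Iper0; congr Iper; apply/funext => t.
      by rewrite /y1 leqNgt nK form0l// mul0r.
    apply: eq_ssum_in => n nK; rewrite mulr_ssumr.
    rewrite (@ssum_widen _ K Q (fun k => Iper _))//; last first.
      move=> k kK; rewrite -[RHS]Iper0; congr Iper; apply/funext => t.
      by rewrite (me_u me kK) form0r// mul0r.
    by apply: eq_ssum => k; rewrite P_form_coef /y1 nK.
  rewrite -mulN1r -IperZ// -IperD//.
    by congr Iper; apply/funext => t; rewrite y1w formDl// formNl// mulN1r.
  by apply: ccontinuousM => //; exact: ccontinuous_cst.
rewrite -T1 -T2 -T3 -!mulrDr.
by move: h; rewrite !ssumD => ->; rewrite mulr0.
Qed.

(** The first equation determines [z n] only modulo the kernel of [G]. By [S_le_G] this kernel lies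
    in that of [S], which every [A t] of the period annihilates. *)
Lemma form_residual t x n : 0 <= t <= P -> A t x (dtime P u n - ('i * omega) *: u n - z n) = 0.
Proof.
move=> tP; set r := _ - z n.
have [nK|nK] := leqP (absz n) K; last first.
  by rewrite /r /dtime (me_z me nK) (me_u me nK) !scaler0 !subr0 form0r.
have Sr : qform S r = 0.
  apply/eqP; rewrite eq_le (cf_S0 cf) andbT (le_trans (S_le_G _))//.
  by rewrite /qform (me_eq1 me)// mulr0.
exact: (bounded_form_ker (hA t) hS (fun v => cf_hi cf v tP)).
Qed.

Lemma form_Z t x : 0 <= t <= P ->
  A t x (DU t) = A t x (Z t) + 'i * omega * A t x (U t).
Proof.
move=> tP; rewrite -formZr// -formDr//.
apply/eqP; rewrite -subr_eq0 -formBr//; apply/eqP.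
rewrite -tpolyZ -tpolyD -[X in _ - X]scale1r -scaleNr -tpolyZ -tpolyD.
rewrite form_ssumr// -[RHS](@ssum0 _ Q); apply: eq_ssum => n.
rewrite formZr// [X in A t x X](_ : _ = dtime P u n - ('i * omega) *: u n - z n).
  by rewrite form_residual// mulr0.
by rewrite scaleN1r opprD addrCA addrC -addrA.
Qed.

Let cphi := continuous_phi.
Let cphi' := continuous_phi'.

Let cq (F : V -> V -> R[i]) (hF : hermitian_form F) x :
  continuous (fun t => qform F (tpoly x t)).
Proof. by have [] := cst_form hF x x. Qed.

Let cqA x : continuous (fun t => qform (A t) (tpoly x t)).
Proof. by have [] := ccA x x. Qed.

Let cqA' x : continuous (fun t => qform (A' t) (tpoly x t)).
Proof. by have [] := ccA' x x. Qed.

Let cRe (F : V -> V -> R[i]) (hF : hermitian_form F) x x' :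
  continuous (fun t => Re (F (tpoly x t) (tpoly x' t))).
Proof. by have [] := cst_form hF x x'. Qed.

Let cReA x x' : continuous (fun t => Re (A t (tpoly x t) (tpoly x' t))).
Proof. by have [] := ccA x x'. Qed.

Let cReA' x x' : continuous (fun t => Re (A' t (tpoly x t) (tpoly x' t))).
Proof. by have [] := ccA' x x'. Qed.

Lemma eq_RI (f g : R -> R) : (forall t, 0 <= t <= P -> f t = g t) -> RI f = RI g.
Proof. by move=> fg; apply: eq_Rintegral => t; rewrite inE /= in_itv /=; exact: fg. Qed.

Let gZ t := qform G (Z t).
Let aU t := qform (A t) (U t).
Let a'U t := qform (A' t) (U t).
Let bZ t := qform B (Z t).

(** Real part of the tested equation, after [form_Z] has replaced Z by U' - i omega U inside [A].
    The terms containing U' and Z' are then eliminated by integrating the derivatives of phi G(Z, Z)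
    and phi A(U, U) over the period ([IG] and [IA]). *)
Lemma energy_identity :
  b * (RI (fun t => phi t * gZ t) + RI (fun t => phi t * aU t))
  - (RI (fun t => phi' t * gZ t) + RI (fun t => phi' t * aU t)) / 2
  - RI (fun t => phi t * a'U t) / 2 + k0 * RI (fun t => phi t * bZ t) = energy_tail.
Proof.
have cgZ : continuous gZ := @cq G hG z.
have caU : continuous aU := @cqA u.
have ca'U : continuous a'U := @cqA' u.
have cbZ : continuous bZ := @cq B hB z.
have cG1 := @cRe G hG z (dtime P z).
have cA1 := @cReA (dtime P u) u.
have E1 := congr1 (@complex.Re R) tested_equation; rewrite !(ReD, ReN) in E1.
have R1 : Re (Iper (fun t => G (tpoly y t) (DZ t))) =
    RI (fun t => phi t * Re (G (Z t) (DZ t))).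
  rewrite Re_Iper; apply: eq_RI => t _ /=.
  by rewrite tpoly_y formZl// conj_real ReZ.
have R2 : Re ('i * omega * Iper (fun t => G (tpoly y t) (Z t))) =
    - b * RI (fun t => phi t * gZ t).
  rewrite [X in _ * X](_ : _ = (RI (fun t => phi t * gZ t))%:C).
    by rewrite ReM !(ReM, ImM) /=; ring.
  rewrite -Iper_real; congr Iper; apply/funext => t.
  by rewrite tpoly_y formZl// conj_real form_qform// -rmorphM.
have R3 : Re (Iper (fun t => A t (tpoly y t) (U t))) =
    RI (fun t => phi t * Re (A t (DU t) (U t))) + b * RI (fun t => phi t * aU t).
  rewrite -RIZ; last by cts.
  rewrite -RID; [|by cts|by cts].
  rewrite Re_Iper; apply: eq_RI => t tP /=.
  rewrite tpoly_y formZl// conj_real ReZ; have := form_Z (U t) tP.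
  move/(congr1 (@complex.Re R)); rewrite ReD Re_form_conj// [Re (A t (U t) (Z t))]Re_form_conj//.
  move=> ->; rewrite form_qform// !(ReM, ImM) /= -/(aU t); ring.
have R4 : Re (k0%:C * Iper (fun t => B (tpoly y t) (Z t))) = k0 * RI (fun t => phi t * bZ t).
  rewrite ReZ; congr (_ * _); rewrite Re_Iper; apply: eq_RI => t _ /=.
  by rewrite tpoly_y formZl// conj_real ReZ.
have IG : RI (fun t => phi' t * gZ t) + 2 * RI (fun t => phi t * Re (G (Z t) (DZ t))) = 0.
  have h0 : hermitian_form (fun _ _ : V => 0 : R[i]).
    by split => [*|*]; rewrite ?mulr0 ?addr0// conjc0.
  have := @Iper_form_by_parts _ P P_gt0 V Q (fun=> G) (fun _ _ _ => 0) y z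
    (fun=> hG) (fun=> h0) (fun x x' => cderivative_cst (G x x'))
    (fun x x' => ccontinuous_cst 0) (fun _ _ => erefl).
  rewrite Iper0 add0r => /(congr1 (@complex.Re R)); rewrite ReD R1 !Re_Iper => h.
  rewrite -[RHS]h mulr_natl mulr2n addrA; congr (_ + _).
  rewrite -RID; [|by cts|by cts]; apply: eq_RI => t _ /=.
  rewrite tpoly_dtime_conv; last exact: (me_z me).
  rewrite (formDl hG) !(formZl hG) !conj_real ReD !ReZ.
  by rewrite (Re_form_conj hG (DZ t)).
have IA : RI (fun t => phi t * a'U t) + RI (fun t => phi' t * aU t) +
    2 * RI (fun t => phi t * Re (A t (DU t) (U t))) = 0.
  have := @Iper_form_by_parts _ P P_gt0 V Q A A' (tconv L c u) u
    hA hA' (cf_der cf) (cf_cont cf) (cf_per cf).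
  have tu t : tpoly (tconv L c u) t = (phi t)%:C *: U t.
    by rewrite (tpoly_tconv _ _ _ (me_u me)) ?phiE.
  move=> /(congr1 (@complex.Re R)); rewrite !ReD !Re_Iper => h.
  rewrite -[RHS]h mulr_natl mulr2n addrA; congr (_ + _).
    rewrite -addrA; congr (_ + _).
      by apply: eq_RI => t _ /=; rewrite tu formZl// conj_real ReZ.
    rewrite -RID; [|by cts|by cts]; apply: eq_RI => t _ /=.
    rewrite tpoly_dtime_conv; last exact: (me_u me).
    by rewrite (formDl (hA t)) !(formZl (hA t)) !conj_real ReD !ReZ.
  apply: eq_RI => t _ /=; rewrite tu formZl// conj_real ReZ.
  by rewrite (Re_form_conj (hA t) (DU t)).
rewrite -/energy_tail R1 R2 R3 R4 in E1.
by move: E1 IG IA => /=; lra.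
Qed.

Let sU t := qform S (U t).

(** The excess [b - Cg] is kept as a factor because the upper bound for the tail grows with b as
    well. The constant [c1] passes from G + A to G + S. *)
Lemma energy_lower_bound (Cg del c1 : R) : 0 < c1 -> c1 <= 1 -> c1 <= c0 ->
  0 < del -> Cg < b -> 0 <= k0 -> (forall t, 0 <= t <= P -> 0 <= m t) ->
  (forall t, 0 <= t <= P ->
     del <= phi t /\ del <= Cg * phi t - phi' t / 2 - m t * phi t / 2) ->
  del * (1 + b - Cg) * c1 * (RI gZ + RI sU) <= energy_tail.
Proof.
move=> c1_gt0 c11 c10 del0 Cgb k00 m0 hphi; rewrite -energy_identity.
have cgZ : continuous gZ := @cq G hG z.
have csU : continuous sU := @cq S hS u.
have caU : continuous aU := @cqA u.
have ca'U : continuous a'U := @cqA' u.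
have cbZ : continuous bZ := @cq B hB z.
apply: (le_RI_energy cphi cphi' cgZ csU cbZ caU ca'U) => t tP.
have [p0 pd] := hphi t tP.
have g0 : 0 <= gZ t := cf_G0 cf _.
have s0 : 0 <= sU t := cf_S0 cf _.
have b0 : 0 <= bZ t := B0 _.
have a0 : c0 * sU t <= aU t := cf_lo cf _ tP.
have a'0 : a'U t <= m t * aU t := cf_m cf _ tP.
have := m0 t tP.
move: (phi t) (phi' t) (gZ t) (sU t) (bZ t) (aU t) (a'U t) (m t) p0 pd g0 s0 b0 a0 a'0
  => p p' g s be a a' mt p0 pd g0 s0 b0 a0 a'0 mt0.
have pp : 0 < p by exact: lt_le_trans p0.
have h1 : p * a' <= p * (mt * a) by rewrite ler_pM2l.
have h2 : 0 <= p * mt * g by rewrite !mulr_ge0// ltW.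
have h3 : 0 <= k0 * (p * be) by rewrite !mulr_ge0// ltW.
have h4 : (b - Cg) * del <= (b - Cg) * p by rewrite ler_pM2l// subr_gt0.
have h5 : del * (1 + b - Cg) <= b * p - p' / 2 - mt * p / 2 by lra.
have h6 : c1 * (g + s) <= g + a.
  have : c1 * g <= 1 * g by rewrite ler_wpM2r.
  have : c1 * s <= c0 * s by rewrite ler_wpM2r.
  lra.
have h7 : del * (1 + b - Cg) * (c1 * (g + s)) <= (b * p - p' / 2 - mt * p / 2) * (g + a).
  apply: ler_pM => //.
    by rewrite mulr_ge0// ?ltW//; lra.
  by apply: mulr_ge0; [exact: ltW|exact: addr_ge0].
by move: h7; rewrite mulrA; lra.
Qed.

Lemma energy_tail0 : L = 0%N -> energy_tail = 0.
Proof.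
move=> L0; rewrite /energy_tail -[RHS](congr1 (@complex.Re R) Iper0).
congr (Re (Iper _)); apply/funext => t.
rewrite [X in A t X _](_ : _ = 0) ?form0l//.
rewrite /tpoly -[RHS](@ssum0 _ Q); apply: eq_ssum_in => n.
by rewrite L0 addn0 /w => ->; rewrite scaler0.
Qed.

(** The case of mean zero. The test function is z itself, so there is no tail, and A'(U, U) <= m
    A(U, U) <= M m with M a bound for A(U, U) on the period; hence the integral of A'(U, U) is at
    most M times that of m, which is 0. *)
Lemma constant_weight_energy : L = 0%N -> (forall t, phi t = 1) ->
  (forall t, phi' t = 0) -> continuous m -> (forall t, 0 <= t <= P -> 0 <= m t) ->
  RI m = 0 -> 0 <= k0 -> 0 < c0 -> 0 < b -> RI gZ <= 0.
Proof.
move=> L0 phi1 phi'0 cm m0 RIm k00 c0_gt0 b_gt0.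
have ca'U : continuous a'U := @cqA' u.
have caU : continuous aU := @cqA u.
have := energy_identity; rewrite energy_tail0//.
have e1 f : RI (fun t => phi t * f t) = RI f.
  by apply: eq_RI => t _; rewrite phi1 mul1r.
have e0 f : RI (fun t => phi' t * f t) = 0.
  by rewrite (eq_RI (g := fun=> 0)) ?RI_cst ?mulr0// => t _; rewrite phi'0 mul0r.
rewrite !e1 !e0 addr0 mul0r subr0.
have [M M0 hM] := continuous_bounded_itv (ltW P_gt0) caU.
have a'le : RI a'U <= 0.
  apply: (@le_trans _ _ (RI (fun t => M * m t))); last by rewrite RIZ// RIm mulr0.
  apply: le_RI => //; first by apply: contM => //; exact: cst_continuous.
  move=> t tP; apply: le_trans (cf_m cf _ tP) _.
  by rewrite mulrC ler_wpM2r ?m0// (le_trans (ler_norm _)) ?hM.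
have a_ge0 : 0 <= RI aU.
  apply: Rintegral_ge0 => t; rewrite /= in_itv /= => tP.
  by apply: le_trans (cf_lo cf _ tP); rewrite mulr_ge0 ?(ltW c0_gt0)// (cf_S0 cf).
have b_ge0 : 0 <= k0 * RI bZ.
  by rewrite mulr_ge0// Rintegral_ge0// => t _; exact: B0.
have ba_ge0 : 0 <= b * RI aU by rewrite mulr_ge0// ltW.
rewrite mulrDr -(pmulr_rle0 _ b_gt0); move: b_ge0 ba_ge0 a'le.
move: (b * RI aU) (b * RI gZ) (RI a'U) (k0 * _) => *; lra.
Qed.

(** * Upper bound for the tail *)

Section tail_bound.
Context (l wn Phi r : R).
Hypotheses (l_gt0 : 0 < l) (wn_ge0 : 0 <= wn).
Hypothesis omega_wn : Re omega ^+ 2 + Im omega ^+ 2 <= wn ^+ 2.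
Hypothesis phi_Phi : forall t, 0 <= t <= P -> `|phi t| <= Phi.
Hypotheses (lam_ge0 : 0 <= lam) (lam_r : lam <= r * K%:R) (K_gt0 : (0 < K)%N).
Hypotheses (C0_ge0 : 0 <= C0) (C1_ge0 : 0 <= C1).

Let kap := (Phi / Om) ^+ 2.

(* The antiderivative of the tail, so that [w = dtime W]. *)
Let W (n : int) : V := if (absz n <= K)%N then 0 else
  ('i * ((n%:~R * Om)^-1)%:C) *: y n.

Let sW t := qform S (tpoly W t).

Lemma dtime_W : dtime P W = w.
Proof.
apply/funext => n; rewrite /dtime /W /w; case: ifP => nK; first by rewrite scaler0.
rewrite scalerA -[RHS]scale1r; congr (_ *: _).
have n0 : n%:~R * Om != 0.
  rewrite mulf_neq0 ?intr_eq0//; first by apply: contraFneq nK => ->.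
  by rewrite gt_eqF// frequency_gt0.
have -> : - 'i * (n%:~R * Om)%:C * ('i * (n%:~R * Om)^-1%:C) =
    - ('i * 'i) * ((n%:~R * Om)%:C * (n%:~R * Om)^-1%:C) :> R[i] by ring.
rewrite -rmorphM /= mulfV// mulr1.
by apply: complex_eq; rewrite ?(ReN, ImN, ReM, ImM) /=; ring.
Qed.

(** All modes of [W] have |n| > K, so Parseval gains (K Om)^-2 over S(phi z), which is at most
    [Phi ^+ 2 * lam] times the mass of z. This is the place where K is played off against the
    inverse estimate. *)
Lemma antiderivative_gain : K%:R ^+ 2 * RI sW <= kap * lam * RI gZ.
Proof.
have cgZ : continuous gZ := @cq G hG z.
have Om0 := frequency_gt0 P_gt0.
have K0 : 0 < K%:R :> R by rewrite ltr0n.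
rewrite RI_qform// mulrCA.
apply: (@le_trans _ _ (P * (Om ^- 2 * ssum Q (fun n => qform S (y n))))).
  rewrite ler_pM2l// /ssum !mulr_sumr; apply: ler_sum => j _.
  set n := harmonic j; rewrite /W; case: ifP => nK.
    rewrite /qform form0r//= mulr0 mulr_ge0 ?invr_ge0 ?exprn_ge0 ?(ltW Om0)//.
    exact: (cf_S0 cf).
  rewrite qformZ// mulrA; apply: ler_wpM2r; first exact: (cf_S0 cf).
  rewrite !(ReM, ImM) /= !(mul0r, mul1r, mulr0, subr0, sub0r, add0r, addr0) oppr0 expr0n /= add0r.
  rewrite exprVn exprMn invfM mulrA -[leRHS]mul1r; apply: ler_wpM2r.
    by rewrite invr_ge0 exprn_ge0// ltW.
  have nK' : K%:R <= `|n%:~R : R|.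
    by rewrite -intr_norm -natr_absz ler_nat; move/negbT: nK; rewrite -ltnNge => /ltnW.
  have n2 : 0 < (n%:~R : R) ^+ 2.
    by rewrite exprn_even_gt0//= -normr_eq0 gt_eqF// (lt_le_trans K0).
  rewrite ler_pdivrMr// mul1r -[leRHS]real_normK ?num_real//.
  by apply: lerXn2r; rewrite ?nnegrE// ltW.
rewrite mulrCA -RI_qform//.
have -> : RI (fun t => qform S (tpoly y t)) = RI (fun t => phi t * phi t * qform S (Z t)).
  by apply: eq_RI => t _; rewrite tpoly_y qformZ//= expr0n addr0 expr2.
have -> : kap * lam * RI gZ = Om ^- 2 * (Phi ^+ 2 * lam * RI gZ).
  by rewrite /kap expr_div_n; ring.
apply: ler_wpM2l; first by rewrite invr_ge0 exprn_ge0// ltW.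
rewrite -RIZ//.
have csZ := @cq S hS z.
apply: le_RI; [apply: contM => //; exact: contM|by apply: contM => //; exact: cst_continuous|move=> t tP].
rewrite -expr2 -mulrA; apply: ler_pM.
- exact: sqr_ge0.
- exact: (cf_S0 cf).
- rewrite -(real_normK (num_real (phi t))).
  have := phi_Phi tP => h; apply: lerXn2r; rewrite ?nnegrE//.
  exact: le_trans h.
- exact: S_le_G.
Qed.

(** Integration by parts moves the derivative from [W] to [A] and [U], and [form_Z] replaces U' by Z
    + i omega U. The large parameter [l] makes the part in [sU] small, then a small [r] the part in
    [gZ]. *)
Lemma energy_tail_upper_bound : energy_tail <=
  (1 + wn) * (((C0 + C1) / 2 * l * kap + C0 / 2 * (kap + 1)) * r * RI gZ
              + (C0 + C1) / (2 * l) * RI sU).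
Proof.
have cgZ : continuous gZ := @cq G hG z.
have csU : continuous sU := @cq S hS u.
have csW : continuous sW := @cq S hS W.
have K0 : 0 < K%:R :> R by rewrite ltr0n.
have K1 : 1 <= K%:R :> R by rewrite ler1n.
have wn1 : 0 < 1 + wn by rewrite ltr_wpDr.
have cA'W := @cReA' W u.
have cADW := @cReA W (dtime P u).
have -> : energy_tail =
    RI (fun t => - Re (A' t (tpoly W t) (U t)) + - Re (A t (tpoly W t) (DU t))).
  have := @Iper_form_by_parts _ P P_gt0 V Q A A' W u
    hA hA' (cf_der cf) (cf_cont cf) (cf_per cf).
  move=> /(congr1 (@complex.Re R)); rewrite !ReD dtime_W -/energy_tail !Re_Iper => h.
  rewrite RID; [|exact: contN|exact: contN].
  have RIN (f : R -> R) : continuous f -> RI (fun t => - f t) = - RI f.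
    move=> cf'; rewrite -[RHS]mulN1r -RIZ//; apply: eq_RI => t _; ring.
  rewrite !RIN//; move: h; rewrite /comp /=; lra.
(* Three products, balanced differently: [l] for A'(W, U); [K] for A(W, Z), so that after
   integration both K S(W) and S(Z) / K are controlled by [r] times the mass of z; [l * (1 + wn)]
   for A(W, i omega U), so that [wn ^+ 2] is reduced to a linear factor. *)
pose a1 := C1 / 2 * l + C0 / 2 * K%:R + C0 / 2 * (l * (1 + wn)).
pose a2 := C1 / 2 / l + C0 / 2 * (wn ^+ 2 / (l * (1 + wn))).
pose a3 := C0 / 2 * (lam / K%:R).
have a1_ge0 : 0 <= a1.
  by rewrite /a1 !addr_ge0// !mulr_ge0// ?invr_ge0// ?mulr_ge0// ltW.
apply: (@le_trans _ _ (a1 * RI sW + a2 * RI sU + a3 * RI gZ + 0 * RI gZ)).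
  apply: (le_RI_comb _ csW csU cgZ cgZ); first by apply: contD; exact: contN.
  move=> t tP.
  have e1 := bounded_form_AMGM (hA' t) hS (fun x => cf_A'hi cf x tP) (tpoly W t) (U t) l_gt0.
  have e2 := bounded_form_AMGM (hA t) hS (fun x => cf_hi cf x tP) (tpoly W t) (Z t) K0.
  have lw : 0 < l * (1 + wn) by rewrite mulr_gt0.
  have e3 := bounded_form_AMGM (hA t) hS (fun x => cf_hi cf x tP) (tpoly W t)
     (('i * omega) *: U t) lw.
  move: e1 e2 e3; rewrite !ler_norml => /andP[e1 _] /andP[e2 _] /andP[e3 _].
  have fz := congr1 (@complex.Re R) (form_Z (tpoly W t) tP).
  rewrite ReD -(formZr (hA t)) in fz; rewrite fz.
  have s0 : 0 <= sU t := cf_S0 cf _.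
  have sZ : qform S (Z t) <= lam * gZ t := S_le_G _.
  have h1 : qform S (('i * omega) *: U t) <= wn ^+ 2 * sU t.
    rewrite qformZ//; apply: ler_wpM2r => //; apply: le_trans omega_wn.
    by rewrite !(ReM, ImM) /=; lra.
  have h2 : C0 / 2 * (qform S (('i * omega) *: U t) / (l * (1 + wn))) <=
      C0 / 2 * (wn ^+ 2 * sU t / (l * (1 + wn))).
    by rewrite ler_wpM2l ?divr_ge0// ler_wpM2r// invr_ge0 ltW.
  have h3 : C0 / 2 * (qform S (Z t) / K%:R) <= C0 / 2 * (lam * gZ t / K%:R).
    by rewrite ler_wpM2l ?divr_ge0// ler_wpM2r// invr_ge0 ltW.
  move: e1 e2 e3 h2 h3; rewrite /a1 /a2 /a3 /sW /sU; lra.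
rewrite mul0r addr0.
have := antiderivative_gain.
have X0 : 0 <= RI gZ by rewrite Rintegral_ge0// => t _; exact: (cf_G0 cf).
have Y0 : 0 <= RI sU by rewrite Rintegral_ge0// => t _; exact: (cf_S0 cf).
have W0 : 0 <= RI sW by rewrite Rintegral_ge0// => t _; exact: (cf_S0 cf).
move: (RI sW) (RI sU) (RI gZ) W0 X0 Y0 => sig Y X W0 X0 Y0 gain.
have kap0 : 0 <= kap by exact: sqr_ge0.
have lamK : lam / K%:R <= r by rewrite ler_pdivrMr.
have r0 : 0 <= r by apply: le_trans lamK; rewrite divr_ge0// ltW.
have Ksig : K%:R * sig <= kap * r * X.
  rewrite -(ler_pM2l K0) mulrA -expr2 (le_trans gain)//.
  rewrite [leRHS](_ : _ = kap * (r * K%:R) * X); last by ring.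
  by rewrite ler_wpM2r// ler_wpM2l.
have sigX : sig <= kap * r * X.
  by apply: le_trans Ksig; rewrite ler_peMl.
have h1 : a3 * X <= C0 / 2 * r * X.
  by rewrite ler_wpM2r// /a3 ler_wpM2l// divr_ge0.
have wn2 : wn ^+ 2 / (l * (1 + wn)) <= (1 + wn) / l.
  rewrite ler_pdivrMr ?mulr_gt0//.
  have -> : (1 + wn) / l * (l * (1 + wn)) = (1 + wn) ^+ 2 by field; rewrite gt_eqF.
  by apply: lerXn2r; rewrite ?nnegrE//; move: wn_ge0; lra.
have h2 : a2 * Y <= (1 + wn) * ((C0 + C1) / (2 * l) * Y).
  rewrite mulrA; apply: ler_wpM2r => //.
  have : C0 / 2 * (wn ^+ 2 / (l * (1 + wn))) <= C0 / 2 * ((1 + wn) / l).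
    by rewrite ler_wpM2l// divr_ge0.
  have : 0 <= wn * (C1 / 2 / l) by rewrite !mulr_ge0// invr_ge0// ltW.
  have -> : (C0 + C1) / (2 * l) = C0 / 2 / l + C1 / 2 / l by field; rewrite gt_eqF.
  by rewrite /a2 !mulrDr !mulrDl !mul1r; lra.
have C02 : 0 <= C0 / 2 by rewrite divr_ge0.
have C12 : 0 <= C1 / 2 by rewrite divr_ge0.
have l_ge0 := ltW l_gt0.
have w1_ge0 := ltW wn1.
have h3 : (C1 / 2 * l) * sig <= (C1 / 2 * l) * (kap * r * X).
  by apply: ler_wpM2l => //; exact: mulr_ge0.
have h4 : (C0 / 2 * (l * (1 + wn))) * sig <= (C0 / 2 * (l * (1 + wn))) * (kap * r * X).
  by apply: ler_wpM2l => //; apply: mulr_ge0 => //; exact: mulr_ge0.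
have h5 : (C0 / 2) * (K%:R * sig) <= (C0 / 2) * (kap * r * X) by exact: ler_wpM2l.
have krX : 0 <= kap * r * X by apply: mulr_ge0 => //; exact: mulr_ge0.
have h6 : 0 <= wn * (C0 / 2 * r * X).
  by apply: mulr_ge0 => //; apply: mulr_ge0 => //; exact: mulr_ge0.
have h7 : 0 <= wn * ((C1 / 2 * l) * (kap * r * X)).
  by apply: mulr_ge0 => //; apply: mulr_ge0 => //; exact: mulr_ge0.
have h8 : 0 <= wn * ((C0 / 2) * (kap * r * X)).
  by apply: mulr_ge0 => //; exact: mulr_ge0.
move: h1 h2 h3 h4 h5 h6 h7 h8; rewrite /a1; lra.
Qed.

End tail_bound.

End energy.

(** * Growth bound with a uniform constant *)

Section modal_growth.
Context (R : realType) (P : R).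
Hypothesis P_gt0 : 0 < P.
Local Notation Om := (frequency P).
Local Notation RI f := (Rintegral lebesgue_measure `[0%R, P] f).

(** If all z_n were null for [G], the first equation q G(v, u_n) = G(v, z_n), with q = - i n Om - i
    omega of real part Im omega <> 0, taken at v = z_n and then at v = u_n would make all u_n null
    too. *)
Lemma kinetic_energy_gt0 (V : lmodType R[i]) (G B : V -> V -> R[i])
  (A : R -> V -> V -> R[i]) K Q k0 omega u z :
  hermitian_form G -> (forall x, 0 <= qform G x) -> (K <= Q)%N ->
  modal_eigenvector P K k0 G A B omega u z -> Im omega != 0 ->
  0 < RI (fun t => qform G (tpoly P Q z t)).
Proof.
move=> hG G0 KQ me b0; rewrite RI_qform// pmulr_rgt0// lt_def.
rewrite [X in _ && X]sumr_ge0 ?andbT; last by move=> j _; exact: G0.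
apply/negP => /eqP/esym/eqP; rewrite eq_sym psumr_eq0; last by move=> j _; exact: G0.
move=> /allP hz0.
have z0 n : qform G (z n) = 0.
  have [nK|nK] := leqP (absz n) K; last by rewrite (me_z me nK) /qform form0r.
  have nQ : (absz (n + Q%:Z)%R < Q.*2.+1)%N by lia.
  have := hz0 (Ordinal nQ) (mem_index_enum _) => /eqP.
  by have -> : harmonic (Ordinal nQ) = n by rewrite /harmonic /=; lia.
have [n []] := me_nz me; last by rewrite z0 eqxx.
have [nK|nK] := leqP (absz n) K; last by rewrite (me_u me nK) /qform form0r//= eqxx.
pose q : R[i] := - 'i * (n%:~R * Om)%:C - 'i * omega.
have q0 : q != 0.
  apply/eqP => /(congr1 (@complex.Re R)); rewrite /q !(ReD, ReN, ReM, ImM, ImN) /=.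
  by move=> h; move/eqP: b0; apply; move: h; lra.
have e v : q * G v (u n) = G v (z n).
  apply/eqP; rewrite -subr_eq0; apply/eqP; rewrite -(me_eq1 me v nK) /dtime.
  by rewrite !formBr// !formZr// /q mulrBl.
have Gzz : G (z n) (z n) = 0 by rewrite form_qform// z0.
have /eqP := e (z n); rewrite Gzz mulf_eq0 (negbTE q0) /= => /eqP Gzu.
have /eqP := e (u n); rewrite [G _ (z n)]form_conj// Gzu conjc0 mulf_eq0 (negbTE q0) /=.
by move=> /eqP; rewrite /qform => ->; rewrite eqxx.
Qed.

(** The order of quantifiers matters: [r] depends on [P], [m] and the constants of the forms alone,
    so it serves every space, [K], [lam] and [omega]. *)
Theorem modal_growth (m : R -> R) (mbar c0 C0 C1 : R) :
  continuous m -> m P = m 0 -> (forall t, 0 <= t <= P -> 0 <= m t) ->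
  P * mbar = RI m -> 0 < c0 -> 0 <= C0 -> 0 <= C1 ->
  exists r, 0 < r /\
  forall (V : lmodType R[i]) (G S B : V -> V -> R[i]) (A A' : R -> V -> V -> R[i])
    (lam : R) (K : nat) (k0 : R) (omega : R[i]) (u z : int -> V),
  coefficient_forms P m c0 C0 C1 G S A A' ->
  hermitian_form B -> (forall x, 0 <= qform B x) ->
  0 <= lam -> (forall x, qform S x <= lam * qform G x) ->
  lam <= r * K%:R -> (0 < K)%N -> 0 <= k0 ->
  modal_eigenvector P K k0 G A B omega u z ->
  - (Om / 2) <= Re omega <= Om / 2 -> Im omega <= 2 * mbar.
Proof.
move=> cm mP m0 Pmbar c0_gt0 C0_ge0 C1_ge0.
have RIm0 : 0 <= RI m by apply: Rintegral_ge0 => t; rewrite /= in_itv /=; exact: m0.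
have mbar_ge0 : 0 <= mbar by move: RIm0; rewrite -Pmbar pmulr_rge0.
have Om0 := frequency_gt0 P_gt0.
have [mbar0|mbar_gt0] := eqVneq mbar 0.
  (* There is no tail to absorb, so any positive [r] will do. *)
  exists 1; split => // V G S B A A' lam K k0 omega u z cf hB B0 lam0 SG lamK K0 k00 me reom.
  rewrite mbar0 mulr0 leNgt; apply/negP => b0.
  pose c (n : int) : R[i] := (n == 0)%:R.
  have phiE (t : R) : (1 : R)%:C = ssum 0 (fun n => c n * mode P (- n) t).
    rewrite ssum_only0 => [|n /negbTE n0]; last by rewrite /c n0 mul0r.
    by rewrite oppr0 mode0 /c eqxx mulr1.
  have phi'E (t : R) : (0 : R)%:C =
      ssum 0 (fun n => - 'i * (n%:~R * Om)%:C * c n * mode P (- n) t).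
    rewrite ssum_only0 => [|n /negbTE n0]; last by rewrite /c n0 mulr0 mul0r.
    by rewrite mul0r mulr0 !mul0r.
  have RIm : RI m = 0 by rewrite -Pmbar mbar0 mulr0.
  have := constant_weight_energy P_gt0 cf hB B0 SG me phiE phi'E erefl
    (fun=> erefl) (fun=> erefl) cm m0 RIm k00 c0_gt0 b0.
  by rewrite leNgt (kinetic_energy_gt0 (cf_G cf) (cf_G0 cf) _ me)// ?leq_addr// gt_eqF.
have mbar_pos : 0 < mbar by rewrite lt_def mbar_gt0.
have [L [c [phi [phi' [del [del0 phiE phi'E hphi]]]]]] :=
  weight_exists P_gt0 cm mP Pmbar mbar_pos.
have cphi : continuous phi by have [] := ccontinuous_phi phiE.
have [Phi Phi0 hPhi] := continuous_bounded_itv (ltW P_gt0) cphi.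
pose c1 := Num.min 1 c0.
have c1_gt0 : 0 < c1 by rewrite lt_min ltr01.
have c11 : c1 <= 1 by rewrite ge_min lexx.
have c10 : c1 <= c0 by rewrite ge_min lexx orbT.
(* Bounds the quotient of [1 + wn] by [1 + Im omega - 2 * mbar] uniformly in omega, see [wnM]. *)
pose Mo := 1 + Om / 2 + 2 * mbar.
have Mo1 : 1 <= Mo by rewrite /Mo; lra.
have dc : 0 < del * c1 by rewrite mulr_gt0.
(* Large enough for the part of the tail in U to be at most half of its share of the lower bound. *)
pose l := (C0 + C1 + 1) * Mo / (del * c1).
have l0 : 0 < l by apply: divr_gt0 => //; apply: mulr_gt0; lra.
pose kap := (Phi / Om) ^+ 2.
pose E := (C0 + C1) / 2 * l * kap + C0 / 2 * (kap + 1).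
have kap0 : 0 <= kap by exact: sqr_ge0.
have E0 : 0 <= E.
  apply: addr_ge0; first by rewrite mulr_ge0// mulr_ge0 ?(ltW l0)// divr_ge0// addr_ge0.
  by apply: mulr_ge0; [rewrite divr_ge0|rewrite addr_ge0].
(* Small enough for the part of the tail in Z to stay strictly below its share; strictness there
   suffices since the mass of z is positive. *)
pose r := del * c1 / (2 * Mo * (E + 1)).
have r0 : 0 < r by apply: divr_gt0 => //; do 2?apply: mulr_gt0 => //; lra.
have hE : Mo * (E * r) < del * c1.
  rewrite /r mulrA [Mo * _ * _]mulrA ltr_pdivrMr; last by do 2?apply: mulr_gt0 => //; lra.
  have : Mo * E * (del * c1) <= (Mo * (E + 1)) * (del * c1).
    by apply: ler_wpM2r; [exact: ltW|apply: ler_wpM2l; lra].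
  have : 0 < (Mo * (E + 1)) * (del * c1) by do 2?apply: mulr_gt0 => //; lra.
  by lra.
have hl : Mo * ((C0 + C1) / (2 * l)) <= del * c1.
  rewrite mulrA ler_pdivrMr; last exact: mulr_gt0.
  rewrite /l.
  have -> : del * c1 * (2 * ((C0 + C1 + 1) * Mo / (del * c1))) = 2 * ((C0 + C1 + 1) * Mo).
    by field; rewrite !gt_eqF.
  have : Mo * (C0 + C1) <= Mo * (2 * (C0 + C1 + 1)) by apply: ler_wpM2l; lra.
  by lra.
exists r; split => // V G S B A A' lam K k0 omega u z cf hB B0 lam0 SG lamK K0 k00 me.
move=> /andP[reom1 reom2]; rewrite leNgt; apply/negP => b0.
have b_gt0 : 0 < Im omega by apply: le_lt_trans b0; rewrite mulr_ge0.
(* A bound for |omega|, thanks to |Re omega| <= Om / 2. *)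
pose wn := Om / 2 + Im omega.
have wn0 : 0 <= wn by rewrite /wn; lra.
have wn2 : Re omega ^+ 2 + Im omega ^+ 2 <= wn ^+ 2.
  have : Re omega ^+ 2 <= (Om / 2) ^+ 2.
    rewrite -(real_normK (num_real (Re omega))); apply: lerXn2r; rewrite ?nnegrE//.
      by rewrite divr_ge0// ltW.
    by rewrite ler_norml reom1.
  have : 0 <= Om / 2 * Im omega.
    by apply: mulr_ge0; [apply: divr_ge0 => //; exact: ltW|exact: ltW].
  by rewrite /wn sqrrD mulr2n; lra.
have wnM : 1 + wn <= Mo * (1 + Im omega - 2 * mbar).
  have : 0 <= (Mo - 1) * (Im omega - 2 * mbar) by apply: mulr_ge0; lra.
  by rewrite /wn /Mo; lra.
have gap : 0 < 1 + Im omega - 2 * mbar by lra.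
have X0 := kinetic_energy_gt0 (cf_G cf) (cf_G0 cf) (leq_addr L K) me (lt0r_neq0 b_gt0).
have Y0 : 0 <= RI (fun t => qform S (tpoly P (K + L) u t)).
  by apply: Rintegral_ge0 => t _; exact: (cf_S0 cf).
have lower := energy_lower_bound P_gt0 cf hB B0 SG me phiE phi'E c1_gt0 c11 c10 del0 b0 k00 m0 hphi.
have upper := energy_tail_upper_bound P_gt0 cf SG me phiE l0 wn0 wn2 hPhi
  lam0 lamK K0 C0_ge0 C1_ge0.
have := le_trans lower upper; rewrite -/kap -/E.
move: X0 Y0; set X := RI _; set Y := RI _ => X0 Y0; apply/negP; rewrite -ltNge.
apply: (@le_lt_trans _ _ (Mo * (1 + Im omega - 2 * mbar) * (E * r * X + (C0 + C1) / (2 * l) * Y))).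
  apply: ler_wpM2r => //; apply: addr_ge0; apply: mulr_ge0 => //; try exact: ltW.
    by rewrite mulr_ge0// ltW.
  by rewrite divr_ge0 ?addr_ge0// mulr_ge0// ltW.
rewrite [ltLHS](_ : _ = (1 + Im omega - 2 * mbar) *
   (Mo * (E * r) * X + Mo * ((C0 + C1) / (2 * l)) * Y)); last by ring.
rewrite [ltRHS](_ : _ = (1 + Im omega - 2 * mbar) * (del * c1 * X + del * c1 * Y)); last by ring.
by rewrite ltr_pM2l// ltr_leD// ?ltr_pM2r// ler_wpM2r.
Qed.

End modal_growth.

(** * Conjugation symmetry without absorption *)

Section left_kernel.
Context (F : fieldType) (n : nat).

(** Rank count. If [H] killed the whole left kernel of [M], then rank H <= rank M; the inclusion of
    right kernels gives rank M <= rank H. Equal ranks force equal right kernels, against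
    [H *m x != 0]. The inclusion stands in for the invertibility of a mass matrix. *)
Lemma left_kernel_of_right_kernel (M H : 'M[F]_n) (x : 'cV[F]_n) :
  (forall v : 'cV[F]_n, H *m v = 0 -> M *m v = 0) ->
  M *m x = 0 -> H *m x != 0 -> exists y : 'rV[F]_n, y *m M = 0 /\ y *m H != 0.
Proof.
move=> HM Mx Hx.
case: (boolP (kermx M <= kermx H)%MS) => [|/row_subPn[i hi]]; last first.
  exists (row i (kermx M)); split.
    by apply/sub_kermxP; exact: row_sub.
  by apply: contra hi => /eqP/sub_kermxP.
move=> /mxrankS; rewrite !mxrank_ker => rk.
have sub : (kermx H^T <= kermx M^T)%MS.
  apply/rV_subP => v /sub_kermxP vH; apply/sub_kermxP.
  have := HM v^T; rewrite -[v *m M^T]trmxK trmx_mul trmxK => ->; rewrite ?trmx0//.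
  by rewrite -[H *m v^T]trmxK trmx_mul trmxK vH trmx0.
have := mxrank_leqif_sup sub; rewrite !mxrank_ker !mxrank_tr => -[_ h].
have e : \rank M = \rank H.
  move: rk (mxrankS sub); rewrite !mxrank_ker !mxrank_tr.
  by have := rank_leq_row M; have := rank_leq_row H; lia.
move: h; rewrite e eqxx => /esym/rV_subP/(_ x^T).
have -> : (x^T <= kermx M^T)%MS.
  by apply/sub_kermxP; rewrite -trmx_mul Mx trmx0.
move=> /(_ isT)/sub_kermxP; rewrite -trmx_mul => /(congr1 trmx).
by rewrite trmxK trmx0 => Hx0; rewrite Hx0 eqxx in Hx.
Qed.

End left_kernel.

Section duality.
Context (R : realType) (P : R).
Hypothesis P_gt0 : 0 < P.
Local Notation Om := (frequency P).
Local Notation C := R[i].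
Local Notation Iper := (Iper P).

Section sesquilinear_kernel.
Context (N : nat).
Local Notation W := 'rV[C]_N.
Implicit Types (b g : W -> W -> C).

Definition sesquilinear_form b :=
  (forall c x y z, b z (c *: x + y) = c * b z x + b z y) /\
  (forall c x y z, b (c *: x + y) z = conjc c * b x z + b y z).

Definition form_mx b : 'M[C]_N :=
  \matrix_(i, j) b (delta_mx 0 i) (delta_mx 0 j).

Lemma sesquilinear_formE b : sesquilinear_form b -> forall x y,
  b x y = (map_mx conjc x *m form_mx b *m y^T) 0 0.
Proof.
move=> [br bl] x y.
have b0r z : b z 0 = 0.
  by have := br (-1) 0 0 z; rewrite scaler0 addr0 mulN1r addNr.
have b0l z : b 0 z = 0.
  have := bl (-1) 0 0 z; rewrite scaler0 addr0 rmorphN1 mulN1r addNr.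
  by [].
have bsr z : b z y = \sum_j y 0 j * b z (delta_mx 0 j).
  rewrite {1}(row_sum_delta y).
  by elim/big_rec2 : _ => [//|j y1 y2 _ <-]; rewrite br.
rewrite bsr -mulmxA mxE [in LHS](row_sum_delta x).
have bsl z : b (\sum_(j < N) x 0 j *: delta_mx 0 j) z = \sum_j conjc (x 0 j) * b (delta_mx 0 j) z.
  by elim/big_rec2 : _ => [//|j y1 y2 _ <-]; rewrite bl.
under eq_bigr do rewrite bsl mulr_sumr.
rewrite exchange_big /=; apply: eq_bigr => i _; rewrite !mxE mulr_sumr.
by apply: eq_bigr => j _; rewrite !mxE; ring.
Qed.

Lemma sesquilinear_left_kernel b g x : sesquilinear_form b -> sesquilinear_form g ->
  (forall v, (forall w, g w v = 0) -> forall w, b w v = 0) ->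
  (forall w, b w x = 0) -> (exists w, g w x != 0) ->
  exists y, (forall w, b y w = 0) /\ exists w, g y w != 0.
Proof.
move=> hb hg gb bx [w0 gx].
have colP f (hf : sesquilinear_form f) (v : 'cV[C]_N) :
    (forall w, f w v^T = 0) <-> form_mx f *m v = 0.
  split => [h|h w].
    apply/matrixP => i j; rewrite ord1 [RHS]mxE -(h (delta_mx 0 i)).
    rewrite (sesquilinear_formE hf) trmxK -mulmxA map_delta_mx -rowE.
    by rewrite [RHS]mxE.
  by rewrite (sesquilinear_formE hf) trmxK -mulmxA h mulmx0 mxE.
have [|||y [yb yg]] := @left_kernel_of_right_kernel _ _ (form_mx b) (form_mx g) x^T.
- by move=> v /(colP _ hg) h; apply/(colP _ hb) => w; apply: gb.
- by apply/(colP _ hb); rewrite trmxK.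
- by apply/eqP => /(colP _ hg); rewrite trmxK => /(_ w0) h; rewrite h eqxx in gx.
(* The forms are conjugate-linear in the first argument, so a left kernel vector enters
   conjugated. *)
exists (map_mx conjc y).
have cc : map_mx conjc (map_mx conjc y) = y.
  by apply/matrixP => i j; rewrite !mxE conjcK.
split.
  by move=> w; rewrite (sesquilinear_formE hb) cc yb mul0mx mxE.
apply: contrapT => h; move/eqP: yg; apply; apply/matrixP => i j.
have : g (map_mx conjc y) (delta_mx 0 j) = 0.
  by apply/eqP; apply: contra_notT h => ?; exists (delta_mx 0 j).
rewrite (sesquilinear_formE hg) cc trmx_delta -colE [in X in X -> _]mxE ord1 => ->.
by rewrite mxE.
Qed.

End sesquilinear_kernel.

Section conjugate_eigenvalue.
Context (N K : nat) (m : R -> R) (c0 C0 C1 lam : R).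
Local Notation V := 'rV[C]_N.
Context (G S B : V -> V -> C) (A A' : R -> V -> V -> C).
Hypothesis cf : coefficient_forms P m c0 C0 C1 G S A A'.
Hypothesis S_le_G : forall x, qform S x <= lam * qform G x.

Let hG := cf_G cf.
Let hA := cf_A cf.

Let cA v v' : ccontinuous (fun t => A t v v').
Proof. exact: cderivative_continuous (cf_der cf v v'). Qed.

Let cAm v v' k : ccontinuous (fun t => A t v v' * mode P k t).
Proof. by apply: ccontinuousM => //; exact: ccontinuous_mode. Qed.

Lemma form_coef_linear k c z x y :
  form_coef P A k z (c *: x + y) = c * form_coef P A k z x + form_coef P A k z y.
Proof.
rewrite /form_coef mulrCA -mulrDr; congr (_ * _).
rewrite -[c * Iper _]IperZ// -IperD//; last first.
  by apply: ccontinuousM => //; exact: ccontinuous_cst.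
congr Iper; apply/funext => t.
by rewrite (formDr (hA t)) (formZr (hA t)); ring.
Qed.

Lemma form_coef0r k z : form_coef P A k z 0 = 0.
Proof.
by have := form_coef_linear k (-1) z 0 0; rewrite scaler0 addr0 mulN1r addNr.
Qed.

Lemma form_coef_conj k x y : form_coef P A k x y = conjc (form_coef P A (- k) y x).
Proof.
rewrite /form_coef conjcM conj_real -Iper_conj//; congr (_ * Iper _).
apply/funext => t; rewrite conjcM conj_mode opprK.
by rewrite {1}(form_conj (hA t)).
Qed.

Lemma form_coef_ker k r x : qform G r = 0 -> form_coef P A k x r = 0.
Proof.
move=> Gr; have Sr : qform S r = 0.
  by apply/eqP; rewrite eq_le (cf_S0 cf) andbT (le_trans (S_le_G _))// Gr mulr0.
rewrite /form_coef /Iper (@eq_cintegral _ _ _ _ _ _ (fun=> 0)) ?cintegral0 ?mulr0// => t.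
rewrite /= in_itv /= => tP.
by rewrite (bounded_form_ker (hA t) (cf_S cf) (fun v => cf_hi cf v tP))// mul0r.
Qed.

Lemma kinetic_form_ker r x : qform G r = 0 -> G x r = 0.
Proof.
apply: (@bounded_form_ker _ _ G G 1 hG hG) => v.
by rewrite mul1r ger0_norm// (cf_G0 cf).
Qed.

Let W := 'rV[C]_(K.*2.+1 * N).
Let slot (j : 'I_K.*2.+1) (x : W) : V := row j (vec_mx x).
Let shift (omega : C) (n : int) : C := - 'i * (n%:~R * Om)%:C - 'i * omega.

Let slotP j c x y : slot j (c *: x + y) = c *: slot j x + slot j y.
Proof. by rewrite /slot !linearP. Qed.

(** Eliminating z = (d/dt - i omega) u turns the system without absorption into the quadratic pencil
    (d/dt - i omega)^2 u + A u; [shift] is the symbol of d/dt - i omega. *)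
Definition pencil (omega : C) (y x : W) : C :=
  \sum_j (shift omega (harmonic j) ^+ 2 * G (slot j y) (slot j x) +
    \sum_k form_coef P A (harmonic j - harmonic k) (slot j y) (slot k x)).

Definition total_mass (y x : W) : C := \sum_j G (slot j y) (slot j x).

Lemma pencil_linear omega c z x y :
  pencil omega z (c *: x + y) = c * pencil omega z x + pencil omega z y.
Proof.
rewrite /pencil mulr_sumr -big_split; apply: eq_bigr => j _ /=.
rewrite slotP (formDr hG) (formZr hG).
have -> : \sum_k form_coef P A (harmonic j - harmonic k) (slot j z) (slot k (c *: x + y)) =
    c * (\sum_k form_coef P A (harmonic j - harmonic k) (slot j z) (slot k x)) +
    \sum_k form_coef P A (harmonic j - harmonic k) (slot j z) (slot k y).
  rewrite mulr_sumr -big_split; apply: eq_bigr => k _ /=.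
  by rewrite slotP form_coef_linear.
ring.
Qed.

(** Conjugating both omega and the value of [shift] only changes its sign, which the square does not
    see; a term linear in [shift], as absorption would produce, would not survive. *)
Lemma pencil_conj omega x y : pencil omega x y = conjc (pencil (conjc omega) y x).
Proof.
have hshift n : shift omega n ^+ 2 = conjc (shift (conjc omega) n) ^+ 2.
  rewrite -[RHS]sqrrN /shift; congr (_ ^+ 2); apply: complex_eq.
    by rewrite ReN Re_conj !(ReD, ReN, ReM, ImM, ImN, Re_conj, Im_conj) /=; ring.
  by rewrite ImN Im_conj !(ImD, ImN, ReM, ImM, ReN, Re_conj, Im_conj) /=; ring.
rewrite /pencil conjc_sum.
under [RHS]eq_bigr do rewrite conjcD conjcM conjcX conjc_sum -hshift -(form_conj hG).
rewrite !big_split; congr (_ + _).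
rewrite exchange_big; apply: eq_bigr => j _; apply: eq_bigr => k _.
by rewrite form_coef_conj opprB.
Qed.

Lemma total_mass_linear c z x y :
  total_mass z (c *: x + y) = c * total_mass z x + total_mass z y.
Proof.
rewrite /total_mass mulr_sumr -big_split; apply: eq_bigr => j _ /=.
by rewrite slotP (formDr hG) (formZr hG).
Qed.

Lemma total_mass_conj x y : total_mass x y = conjc (total_mass y x).
Proof.
by rewrite /total_mass conjc_sum; apply: eq_bigr => j _; exact: form_conj hG _ _.
Qed.

Lemma pencil_sesquilinear omega : sesquilinear_form (pencil omega).
Proof.
split => c x y z; first exact: pencil_linear.
by rewrite pencil_conj pencil_linear conjcD conjcM -!pencil_conj.
Qed.

Lemma total_mass_sesquilinear : sesquilinear_form total_mass.
Proof.
split => c x y z; first exact: total_mass_linear.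
by rewrite total_mass_conj total_mass_linear conjcD conjcM -!total_mass_conj.
Qed.

Let inj_slot (j : 'I_K.*2.+1) (v : V) : W := mxvec (\matrix_(k, i) (v 0 i *+ (k == j))).

Let slot_inj j k v : slot k (inj_slot j v) = if k == j then v else 0.
Proof.
rewrite /slot /inj_slot mxvecK; apply/rowP => i; rewrite !mxE.
by case: ifP => _; rewrite ?mxE ?mulr1n ?mulr0n.
Qed.

Lemma pencil_slot omega j v x : pencil omega (inj_slot j v) x =
  shift omega (harmonic j) ^+ 2 * G v (slot j x) +
  \sum_k form_coef P A (harmonic j - harmonic k) v (slot k x).
Proof.
rewrite /pencil (bigD1 j)//= slot_inj eqxx [X in _ + X]big1 ?addr0// => k /negbTE kj.
rewrite slot_inj kj (form0l hG) mulr0 add0r big1// => i _.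
by rewrite form_coef_conj form_coef0r conjc0.
Qed.

Lemma total_mass_slot j v x : total_mass (inj_slot j v) x = G v (slot j x).
Proof.
rewrite /total_mass (bigD1 j)//= slot_inj eqxx big1 ?addr0// => k /negbTE kj.
by rewrite slot_inj kj (form0l hG).
Qed.

Lemma shift_form omega (x : int -> V) n v :
  G v (dtime P x n - ('i * omega) *: x n) = shift omega n * G v (x n).
Proof. by rewrite (formBr hG) !(formZr hG) /shift mulrBl. Qed.

(* Without absorption the pencil is self-adjoint up to conjugation of omega. *)
Lemma modal_eigenvector_conj omega u z :
  modal_eigenvector P K 0 G A B omega u z ->
  exists u' z', modal_eigenvector P K 0 G A B (conjc omega) u' z'.
Proof.
move=> me.
pose x : W := mxvec (\matrix_(j < K.*2.+1) u (harmonic j)).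
have slotx j : slot j x = u (harmonic j) by rewrite /slot mxvecK rowK.
have e1 v n : (absz n <= K)%N -> shift omega n * G v (u n) = G v (z n).
  move=> nK; rewrite -shift_form; apply/eqP; rewrite -subr_eq0 -(formBr hG).
  by rewrite (me_eq1 me).
have px w : pencil omega w x = 0.
  rewrite /pencil big1// => j _; rewrite slotx.
  have nK := absz_harmonic j.
  rewrite -[RHS](me_eq2 me (slot j w) nK) mul0r addr0 shift_form -e1// mulrA -expr2.
  by congr (_ + _); rewrite /ssum; apply: eq_bigr => k _; rewrite slotx.
have mx : exists w, total_mass w x != 0.
  apply: contrapT => h.
  have Gu v n : G v (u n) = 0.
    have [nK|nK] := leqP (absz n) K; last by rewrite (me_u me nK) (form0r hG).
    have [j <-] := harmonic_surj nK; rewrite -slotx -total_mass_slot.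
    by apply/eqP; apply: contra_notT h => ?; exists (inj_slot j v).
  have [n []] := me_nz me; first by rewrite /qform Gu /= eqxx.
  have [nK|nK] := leqP (absz n) K; last by rewrite (me_z me nK) /qform (form0r hG)/= eqxx.
  by rewrite /qform -e1// Gu mulr0 /= eqxx.
have ker v : (forall w, total_mass w v = 0) -> forall w, pencil omega w v = 0.
  move=> hv w.
  have Gv j : qform G (slot j v) = 0.
    by rewrite /qform -total_mass_slot hv.
  rewrite /pencil big1// => j _; rewrite kinetic_form_ker// mulr0 add0r big1// => k _.
  exact: form_coef_ker.
(* By [pencil_conj], a left kernel vector of the pencil at omega is a right kernel vector at the
   conjugate of omega. *)
have [y [py [w0 my]]] := sesquilinear_left_kernel (pencil_sesquilinear omega)
  total_mass_sesquilinear ker px mx.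
pose u' n : V := if (absz n <= K)%N then slot (inord (absz (n + K%:Z)%R)) y else 0.
pose z' n : V := dtime P u' n - ('i * conjc omega) *: u' n.
have u'E j : u' (harmonic j) = slot j y.
  rewrite /u' absz_harmonic; congr slot; apply/val_inj; rewrite /= inordK.
    by rewrite /harmonic /=; lia.
  by have := ltn_ord j; rewrite /harmonic /=; lia.
have u'0 n : (K < absz n)%N -> u' n = 0 by rewrite /u' ltnNge => /negbTE ->.
exists u', z'; split => //.
- by move=> n nK; rewrite /z' /dtime u'0// !scaler0 subr0.
- by move=> n v nK; rewrite /z' subrr (form0r hG).
- move=> n v nK; rewrite mul0r addr0 shift_form /z' shift_form mulrA -expr2.
  have [j <-] := harmonic_surj nK.
  have := pencil_conj (conjc omega) (inj_slot j v) y; rewrite conjcK py conjc0.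
  rewrite pencil_slot u'E => <-; congr (_ + _); rewrite /ssum.
  by apply: eq_bigr => k _; rewrite u'E.
- apply: contrapT => h; move/eqP: my; apply; rewrite /total_mass big1// => j _.
  rewrite (form_conj hG) kinetic_form_ker ?conjc0//; apply/eqP.
  by apply: contra_notT h => ?; exists (harmonic j); left; rewrite u'E.
Qed.

End conjugate_eigenvalue.

End duality.

(** * Regularity of the coefficient *)

Section ae_bounded_multipliers.
Context d (T : measurableType d) (R : realType) (mu : {measure set T -> \bar R}).
Implicit Types (f g k : T -> R).

Lemma integrable_ae_bounded_mul k g (M : R) : measurable_fun setT k ->
  (\forall x \ae mu, `|k x| <= M) -> mu.-integrable setT (EFin \o g) ->
  mu.-integrable setT (EFin \o (fun x => k x * g x)).
Proof.
move=> mk kM /[dup] ig /integrableP[/measurable_EFinP mg gfin].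
have mkg : measurable_fun setT (fun x => k x * g x) by exact: measurable_funM.
apply/integrableP; split; first exact/measurable_EFinP.
have iMg : (\int[mu]_x (`|M|%:E * `|(g x)%:E|) < +oo)%E.
  rewrite ge0_integralZl//; first by rewrite lte_mul_pinfty.
  by apply: measurableT_comp => //; exact/measurable_EFinP.
apply: le_lt_trans iMg; apply: ae_ge0_le_integral => //.
- by apply: measurableT_comp => //; exact/measurable_EFinP.
- apply: emeasurable_funM => //; apply: measurableT_comp => //; exact/measurable_EFinP.
apply: filterS kM => x kx _; rewrite /= -EFinM lee_fin normrM ler_wpM2r//.
by rewrite (le_trans kx)// ler_norm.
Qed.

Lemma Rintegral_ae_bounded_mul k g (M : R) : measurable_fun setT k ->
  (\forall x \ae mu, `|k x| <= M) -> 0 <= M -> mu.-integrable setT (EFin \o g) ->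
  `|Rintegral mu setT (fun x => k x * g x)| <= M * Rintegral mu setT (fun x => `|g x|).
Proof.
move=> mk kM M0 ig; have ikg := integrable_ae_bounded_mul mk kM ig.
apply: (le_trans (le_normr_Rintegral _ ikg)) => //.
have ing := integrable_norm ig.
have inkg := integrable_norm ikg.
rewrite -RintegralZl// /Rintegral fine_le//.
- by apply: integrable_fin_num.
- apply: integrable_fin_num => //.
  by under eq_fun do rewrite EFinM; exact: integrableZl.
apply: ae_ge0_le_integral => //.
- by case/integrableP : inkg.
- by move=> x _; rewrite lee_fin mulr_ge0.
- apply/measurable_EFinP; apply: measurable_funM => //.
  by case/integrableP : ing => /measurable_EFinP.
apply: filterS kM => x kx _; rewrite lee_fin normrM ler_wpM2r//.
Qed.

Lemma ae_eq_Rintegral f g : measurable_fun setT f -> measurable_fun setT g ->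
  (\forall x \ae mu, f x = g x) -> Rintegral mu setT f = Rintegral mu setT g.
Proof.
move=> mf mg fg; rewrite /Rintegral; congr fine; apply: ae_eq_integral => //.
- exact/measurable_EFinP.
- exact/measurable_EFinP.
by apply: filterS fg => x -> _.
Qed.

End ae_bounded_multipliers.

Section inner_product.
Context d (T : measurableType d) (R : realType) (mu : {measure set T -> \bar R}).
Implicit Types (f g h : T -> R[i]) (k : T -> R).
Local Notation cint f := (cintegral mu setT f).

Lemma L2_comb (c : R[i]) f g : L2 mu f -> L2 mu g -> L2 mu (fun x => c * f x + g x).
Proof.
have p1 : (1 <= 2%:E :> \bar R)%E by rewrite lee_fin ler1n.
have cl (a : R) (u v : T -> R) : u \in Lfun mu 2%:E -> v \in Lfun mu 2%:E ->
    (fun x => a * u x + v x) \in Lfun mu 2%:E.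
  by move=> hu hv; have [_] := @Lfun_submod_closed _ _ _ mu _ p1; move=> /(_ a u v hu hv).
move=> [f1 f2] [g1 g2]; split.
  under eq_fun do rewrite ReD ReM -addrA [- _ + _]addrC.
  rewrite [X in X \in _](_ : _ = fun x => Re c * Re (f x) + (- Im c * Im (f x) + Re (g x))).
    by apply: (cl (Re c) (fun x => Re (f x))) => //; exact: (cl _ (fun x => Im (f x))).
  by apply/funext => x; ring.
rewrite [X in X \in _](_ : _ = fun x => Re c * Im (f x) + (Im c * Re (f x) + Im (g x))).
  by apply: (cl (Re c) (fun x => Im (f x))) => //; exact: (cl _ (fun x => Re (f x))).
by apply/funext => x; rewrite ImD ImM; ring.
Qed.

Lemma L2_cintegrable f g : L2 mu f -> L2 mu g ->
  cintegrable mu setT (fun x => conjc (f x) * g x).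
Proof.
have pr (u v : T -> R) : u \in Lfun mu 2%:E -> v \in Lfun mu 2%:E ->
    mu.-integrable setT (fun x => (u x * v x)%:E).
  by move=> hu hv; have /Lfun1_integrable := Lfun2_mul_Lfun1 hu hv.
move=> [f1 f2] [g1 g2]; split.
  under eq_fun do rewrite ReM Re_conj Im_conj mulNr opprK.
  by apply: integrableDr => //; exact: pr.
under eq_fun do rewrite ImM Re_conj Im_conj mulNr.
by apply: integrableBr => //; exact: pr.
Qed.

Lemma L2_measurable f : L2 mu f ->
  measurable_fun setT (fun x => Re (f x)) /\ measurable_fun setT (fun x => Im (f x)).
Proof.
by move=> [/sub_Lfun_mfun + /sub_Lfun_mfun]; rewrite !inE.
Qed.

Lemma L2norm_eq0 f : L2 mu f -> L2norm mu f = 0 -> \forall x \ae mu, f x = 0.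
Proof.
move=> L2f /eqP; rewrite sqrtr_eq0 => h.
have [mR mI] := L2_measurable L2f.
have hE x : Re (conjc (f x) * f x) = Re (f x) ^+ 2 + Im (f x) ^+ 2.
  by rewrite ReM Re_conj Im_conj; ring.
have [i1 _] := L2_cintegrable L2f L2f.
have e0 : (\int[mu]_x `|(Re (conjc (f x) * f x))%:E| = 0)%E.
  under eq_integral do rewrite /= hE ger0_norm ?addr_ge0 ?sqr_ge0// -hE.
  apply/eqP; rewrite eq_le; apply/andP; split; last first.
    by apply: integral_ge0 => x _; rewrite lee_fin hE addr_ge0 ?sqr_ge0.
  by rewrite -(fineK (integrable_fin_num measurableT i1)) lee_fin.
have m1 : measurable_fun setT (fun x => (Re (conjc (f x) * f x))%:E).
  by case/integrableP : i1.
have [+ _] := ae_eq_integral_abs mu measurableT m1.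
move=> /(_ e0); apply: filterS => x /(_ I) [] /eqP.
rewrite hE paddr_eq0 ?sqr_ge0// !sqrf_eq0 => /andP[/eqP a0 /eqP b0].
exact: complex_eq.
Qed.

End inner_product.

(** * Essential bounds as almost-everywhere statements *)

Section Linf_bounds.
Context d (T : measurableType d) (R : realType) (mu : {measure set T -> \bar R}).
Implicit Types (f : T -> R) (k : R -> T -> R).

Lemma Linf_norm_leP f (M : R) : 0 <= M ->
  (Linf_norm mu f <= M%:E)%E <-> \forall x \ae mu, `|f x| <= M.
Proof.
move=> M0; rewrite /Linf_norm unlock /Lnorm; case: ifPn => mu0.
  split=> [/ess_supP|h]; first by apply: filterS => x /=; rewrite lee_fin.
  by apply/ess_supP; apply: filterS h => x /=; rewrite lee_fin.
(* On a space of measure 0 the norm is 0 by convention, and every property holds almost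
   everywhere. *)
split=> _; last by rewrite lee_fin.
exists setT; split => //; apply/eqP; rewrite eq_le measure_ge0 andbT leNgt //.
Qed.

Lemma Linf_norm_ge0 f : (0 <= Linf_norm mu f)%E.
Proof. exact: Lnorm_ge0. Qed.

Lemma Linf_norm_fineE f (M : R) : (\forall x \ae mu, `|f x| <= M) ->
  (fine (Linf_norm mu f))%:E = Linf_norm mu f.
Proof.
move=> h; have h' : \forall x \ae mu, `|f x| <= `|M|.
  by apply: filterS h => x /le_trans; apply; exact: ler_norm.
apply: fineK; rewrite ge0_fin_numE ?Linf_norm_ge0//.
by apply: le_lt_trans (ltry `|M|); apply/Linf_norm_leP.
Qed.

Lemma ae_le_Linf_norm f (M : R) : (\forall x \ae mu, `|f x| <= M) ->
  \forall x \ae mu, `|f x| <= fine (Linf_norm mu f).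
Proof.
move=> h; apply/Linf_norm_leP; first by rewrite fine_ge0// Linf_norm_ge0.
by rewrite (Linf_norm_fineE h).
Qed.

Lemma fine_Linf_norm_le f (M : R) : 0 <= M -> (\forall x \ae mu, `|f x| <= M) ->
  fine (Linf_norm mu f) <= M.
Proof. by move=> M0 h; rewrite -lee_fin (Linf_norm_fineE h); apply/Linf_norm_leP. Qed.

(** The null set may depend on [s] and [t]: this is continuity with values in L^oo, not continuity
    in time at almost every point. *)
Definition ae_continuous k := forall t e : R, 0 < e ->
  \forall s \near t, \forall x \ae mu, `|k s x - k t x| <= e.

Definition ae_bounded k := forall t : R, exists M : R, \forall x \ae mu, `|k t x| <= M.

Definition ae_derivative k k' := forall t e : R, 0 < e ->
  \forall h \near 0^', \forall x \ae mu, `|h^-1 * (k (t + h) x - k t x) - k' t x| <= e.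

Lemma near_Linf_norm (F : set_system R) (g : R -> T -> R) : Filter F ->
  Linf_norm mu (g s) @[s --> F] --> 0%E -> forall e : R, 0 < e ->
  \forall s \near F, \forall x \ae mu, `|g s x| <= e.
Proof.
move=> FF h e e0.
have : nbhs (0%E : \bar R) [set y | (y < e%:E)%E] by apply: open_ereal_lt'; rewrite lte_fin.
move=> /h hF; have hF' : \forall s \near F, (Linf_norm mu (g s) < e%:E)%E := hF.
apply: filterS hF' => s hs; apply/Linf_norm_leP; first exact: ltW.
exact: ltW.
Qed.

Lemma Linf_continuous_ae k : Linf_continuous mu k -> ae_continuous k.
Proof. by move=> h t e e0; apply: (near_Linf_norm _ (h t)). Qed.

Lemma Linf_derivative_ae k k' : Linf_derivative mu k k' -> ae_derivative k k'.
Proof. by move=> h t e e0; apply: (near_Linf_norm _ (h t)). Qed.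

Lemma Lfun_oo_ae f : f \in Lfun mu +oo%E ->
  measurable_fun setT f /\ exists M : R, \forall x \ae mu, `|f x| <= M.
Proof.
move=> /[dup] /sub_Lfun_mfun; rewrite inE => mf /sub_Lfun_finLfun; rewrite inE => h.
split => //; exists (fine (Linf_norm mu f)).
apply/Linf_norm_leP; first by rewrite fine_ge0// Linf_norm_ge0.
by rewrite fineK// ge0_fin_numE ?Linf_norm_ge0.
Qed.

(** Yields both the continuity of the rate m and bounds uniform over a period. *)
Lemma continuous_Linf_norm k : ae_bounded k -> ae_continuous k ->
  continuous (fun t => fine (Linf_norm mu (k t))).
Proof.
move=> bk ck t; apply/cvgrPdist_le => e e0.
have := ck t e e0; apply: filterS => s hs.
have [Mt ht] := bk t; have [Ms hs'] := bk s.
have le1 s' t' : (exists M : R, \forall x \ae mu, `|k t' x| <= M) ->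
    (\forall x \ae mu, `|k s' x - k t' x| <= e) ->
    fine (Linf_norm mu (k s')) <= fine (Linf_norm mu (k t')) + e.
  move=> [M hM] h; apply: fine_Linf_norm_le.
    by rewrite addr_ge0 ?(ltW e0)// fine_ge0// Linf_norm_ge0.
  apply: filterS2 (ae_le_Linf_norm hM) h => x h1 h2.
  rewrite (_ : k s' x = k t' x + (k s' x - k t' x)); last by ring.
  by rewrite (le_trans (ler_normD _ _))// lerD.
rewrite ler_distl; apply/andP; split.
  by rewrite lerBlDr; apply: le1; [exists Mt|].
apply: le1; first by exists Ms.
by apply: filterS hs => x; rewrite distrC.
Qed.

(** The derivative in the growth constant and the one supplied by [Cper] may be different
    representatives; this identifies them at each time. *)
Lemma ae_derivative_unique k k1 k2 : ae_derivative k k1 -> ae_derivative k k2 ->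
  forall t, \forall x \ae mu, k1 t x = k2 t x.
Proof.
move=> d1 d2 t.
have h (e : R) : 0 < e -> \forall x \ae mu, `|k1 t x - k2 t x| <= e + e.
  move=> e0; have [s [h1 h2]] := filter_ex (filterI (d1 t e e0) (d2 t e e0)).
  apply: filterS2 h1 h2 => x h1 h2.
  set q := s^-1 * _ in h1 h2.
  rewrite (_ : k1 t x - k2 t x = - (q - k1 t x) + (q - k2 t x)); last by ring.
  by rewrite (le_trans (ler_normD _ _))// normrN lerD.
have : \forall x \ae mu, `|k1 t x - k2 t x| <= 0.
  apply/Linf_norm_leP => //; apply/lee_addgt0Pr => e e0; rewrite add0e.
  have e2 : 0 < e / 2 by rewrite divr_gt0.
  have -> : e = e / 2 + e / 2 by field.
  by apply/Linf_norm_leP; [rewrite addr_ge0// ltW|exact: h].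
by apply: filterS => x; rewrite normr_le0 subr_eq0 => /eqP.
Qed.

End Linf_bounds.

(** * Differentiation under the integral sign *)

Section parameter_integrals.
Context d (T : measurableType d) (R : realType) (mu : {measure set T -> \bar R}).
Context (k k' : R -> T -> R).
Hypotheses (mk : forall t, measurable_fun setT (k t)) (bk : ae_bounded mu k).
Hypothesis (ck : ae_continuous mu k).
Local Notation RI f := (Rintegral mu setT f).

(** Convergence of the multiplier in L^oo bounds the error by its norm times the L^1 norm [I] of
    [g], without dominated convergence. Dividing by [I + 1] also covers [I = 0]. *)
Lemma continuous_parameter_integral (g : T -> R) :
  mu.-integrable setT (EFin \o g) -> continuous (fun t => RI (fun x => k t x * g x)).
Proof.
move=> ig t; apply/cvgrPdist_le => e e0.
pose I := RI (fun x => `|g x|).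
have I0 : 0 <= I by apply: Rintegral_ge0.
have e1 : 0 < e / (I + 1) by rewrite divr_gt0// ltr_wpDl.
have := ck t e1; apply: filterS => s hs.
have [Mt ht] := bk t; have [Ms hs'] := bk s.
have ikt := integrable_ae_bounded_mul (mk t) ht ig.
have iks := integrable_ae_bounded_mul (mk s) hs' ig.
rewrite distrC -RintegralB//.
have -> : RI (fun x => k s x * g x - k t x * g x) = RI (fun x => (k s x - k t x) * g x).
  by apply: eq_Rintegral => x _; ring.
have mkd : measurable_fun setT (fun x => k s x - k t x) by exact: measurable_funB.
apply: (le_trans (Rintegral_ae_bounded_mul mkd hs (ltW e1) ig)).
by rewrite mulrAC ler_pdivrMr ?ltr_wpDl// ler_wpM2l ?(ltW e0)// lerDl.
Qed.

Hypotheses (mk' : forall t, measurable_fun setT (k' t)) (bk' : ae_bounded mu k').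
Hypothesis (dk : ae_derivative mu k k').

Lemma is_derive_parameter_integral (g : T -> R) (t : R) :
  mu.-integrable setT (EFin \o g) ->
  is_derive t 1 (fun t => RI (fun x => k t x * g x)) (RI (fun x => k' t x * g x)).
Proof.
move=> ig.
pose f (t : R) := RI (fun x => k t x * g x).
have lim : h^-1 *: (f (h *: 1 + t) - f t) @[h --> 0^'] --> RI (fun x => k' t x * g x).
  apply/cvgrPdist_le => e e0.
  pose I := RI (fun x => `|g x|).
  have I0 : 0 <= I by apply: Rintegral_ge0.
  have e1 : 0 < e / (I + 1) by rewrite divr_gt0// ltr_wpDl.
  have := dk t e1; apply: filterS => h hh.
  have [Mt ht] := bk t; have [Ms hs'] := bk (t + h); have [M' h'] := bk' t.
  have ikt := integrable_ae_bounded_mul (mk t) ht ig.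
  have iks := integrable_ae_bounded_mul (mk (t + h)) hs' ig.
  have ik' := integrable_ae_bounded_mul (mk' t) h' ig.
  rewrite distrC /f /GRing.scale /= mulr1 [h + t]addrC -RintegralB// -RintegralZl//; last first.
    exact: integrableBr.
  rewrite -RintegralB//; last first.
    by apply: integrableZr => //; exact: integrableBr.
  have -> : RI (fun x => h^-1 * (k (t + h) x * g x - k t x * g x) - k' t x * g x) =
      RI (fun x => (h^-1 * (k (t + h) x - k t x) - k' t x) * g x).
    by apply: eq_Rintegral => x _; ring.
  have mkd : measurable_fun setT (fun x => h^-1 * (k (t + h) x - k t x) - k' t x).
    by apply: measurable_funB => //; apply: measurable_funM => //; exact: measurable_funB.
  apply: (le_trans (Rintegral_ae_bounded_mul mkd hh (ltW e1) ig)).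
  by rewrite mulrAC ler_pdivrMr ?ltr_wpDl// ler_wpM2l ?(ltW e0)// lerDl.
apply: DeriveDef; first by apply/cvg_ex; exists (RI (fun x => k' t x * g x)).
exact: cvg_lim lim.
Qed.

End parameter_integrals.

Section sums_of_forms.
Context (R : realType).

Lemma cderivative_sum (I : Type) (s : seq I) (f f' : I -> R -> R[i]) :
  (forall i, cderivative (f i) (f' i)) ->
  cderivative (fun t => \sum_(i <- s) f i t) (fun t => \sum_(i <- s) f' i t).
Proof.
move=> df; elim: s => [|a s IH] t.
  under eq_fun do rewrite big_nil; rewrite big_nil; exact: cderivative_cst.
have [d1 d2] := df a t; have [e1 e2] := IH t.
rewrite big_cons; split.
  have -> : Re \o (fun t => \sum_(i <- a :: s) f i t) =
      (Re \o f a) + (Re \o (fun t => \sum_(i <- s) f i t)).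
    by apply/funext => x; rewrite /= big_cons ReD.
  by rewrite ReD; exact: is_deriveD.
have -> : Im \o (fun t => \sum_(i <- a :: s) f i t) =
    (Im \o f a) + (Im \o (fun t => \sum_(i <- s) f i t)).
  by apply/funext => x; rewrite /= big_cons ImD.
by rewrite ImD; exact: is_deriveD.
Qed.

Lemma hermitian_form_sum (V : lmodType R[i]) (I : Type) (s : seq I) (F : I -> V -> V -> R[i]) :
  (forall i, hermitian_form (F i)) ->
  hermitian_form (fun x y => \sum_(i <- s) F i x y).
Proof.
move=> hF; split=> [c x y z|x y].
  rewrite mulr_sumr -big_split; apply: eq_bigr => i _ /=.
  by have [-> _] := hF i.
by rewrite conjc_sum; apply: eq_bigr => i _; exact: form_conj (hF i) _ _.
Qed.

Lemma qform_sum (V : lmodType R[i]) (I : Type) (s : seq I) (F : I -> V -> V -> R[i]) x :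
  qform (fun x y => \sum_(i <- s) F i x y) x = \sum_(i <- s) qform (F i) x.
Proof. exact: Re_sum. Qed.

End sums_of_forms.

(** * Forms weighted by the coefficient *)

Section weighted_forms.
Context d (T : measurableType d) (R : realType) (mu : {measure set T -> \bar R}).
Context (V : lmodType R[i]) (phi : V -> T -> R[i]).
Hypothesis phi_linear : forall c x y p, phi (c *: x + y) p = c * phi x p + phi y p.
Hypothesis phi_L2 : forall x, L2 mu (phi x).
Implicit Types (k : T -> R).
Local Notation RI f := (Rintegral mu setT f).

Definition weighted_form k (x y : V) : R[i] :=
  cintegral mu setT (fun p => (k p)%:C * (conjc (phi x p) * phi y p)).

Lemma cintegrable_weight k (M : R) (h : T -> R[i]) : measurable_fun setT k ->
  (\forall p \ae mu, `|k p| <= M) -> cintegrable mu setT h ->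
  cintegrable mu setT (fun p => (k p)%:C * h p).
Proof.
move=> mk kM [h1 h2]; split.
  by under eq_fun do rewrite ReZ; exact: (integrable_ae_bounded_mul mk kM h1).
by under eq_fun do rewrite ImZ; exact: (integrable_ae_bounded_mul mk kM h2).
Qed.

Lemma phi_cintegrable x y : cintegrable mu setT (fun p => conjc (phi x p) * phi y p).
Proof. exact: L2_cintegrable. Qed.

Lemma hermitian_weighted_form k (M : R) : measurable_fun setT k ->
  (\forall p \ae mu, `|k p| <= M) -> hermitian_form (weighted_form k).
Proof.
move=> mk kM; have ik x y := cintegrable_weight mk kM (phi_cintegrable x y).
split=> [c x y z|x y].
  rewrite /weighted_form -cintegralZ// -cintegralD//; last exact: cintegrableZ.
  by apply: eq_cintegral => p _; rewrite phi_linear; ring.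
rewrite /weighted_form -cintegral_conj//; apply: eq_cintegral => p _.
by rewrite !conjcM conj_real conjcK; ring.
Qed.

Lemma Re_weighted_form k x y : Re (weighted_form k x y) =
  RI (fun p => k p * Re (conjc (phi x p) * phi y p)).
Proof. by rewrite /= ; apply: eq_Rintegral => p _; rewrite ReZ. Qed.

Lemma Im_weighted_form k x y : Im (weighted_form k x y) =
  RI (fun p => k p * Im (conjc (phi x p) * phi y p)).
Proof. by rewrite /= ; apply: eq_Rintegral => p _; rewrite ImZ. Qed.

Lemma ae_Rintegral_ge0 (f : T -> R) : mu.-integrable setT (EFin \o f) ->
  (\forall p \ae mu, 0 <= f p) -> 0 <= RI f.
Proof.
move=> /integrableP[/measurable_EFinP mf _] f0.
rewrite (@ae_eq_Rintegral _ _ _ _ f (fun p => `|f p|))//.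
- by apply: Rintegral_ge0.
- exact: measurableT_comp.
by apply: filterS f0 => p /ger0_norm.
Qed.

Lemma qform_weighted_le k1 k2 (M1 M2 a b : R) x : measurable_fun setT k1 ->
  measurable_fun setT k2 -> (\forall p \ae mu, `|k1 p| <= M1) ->
  (\forall p \ae mu, `|k2 p| <= M2) -> (\forall p \ae mu, a * k1 p <= b * k2 p) ->
  a * qform (weighted_form k1) x <= b * qform (weighted_form k2) x.
Proof.
move=> m1 m2 b1 b2 h; rewrite /qform !Re_weighted_form.
have [iN _] := phi_cintegrable x x.
have i1 := integrable_ae_bounded_mul m1 b1 iN.
have i2 := integrable_ae_bounded_mul m2 b2 iN.
rewrite -subr_ge0 -!RintegralZl// -RintegralB//; try exact: integrableZr.
apply: ae_Rintegral_ge0; first by apply: integrableBr => //; exact: integrableZr.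
apply: filterS h => p h; rewrite !mulrA -mulrBl mulr_ge0 ?subr_ge0//.
by rewrite mulConjE /= addr_ge0// sqr_ge0.
Qed.

Lemma qform_weighted_norm_le k1 k2 (M1 M2 b : R) x : measurable_fun setT k1 ->
  measurable_fun setT k2 -> (\forall p \ae mu, `|k1 p| <= M1) ->
  (\forall p \ae mu, `|k2 p| <= M2) -> (\forall p \ae mu, `|k1 p| <= b * k2 p) ->
  `|qform (weighted_form k1) x| <= b * qform (weighted_form k2) x.
Proof.
move=> m1 m2 b1 b2 h; rewrite ler_norml; apply/andP; split.
  rewrite lerNl -mulN1r; apply: (qform_weighted_le _ m1 m2 b1 b2).
  by apply: filterS h => p; rewrite ler_norml mulN1r lerNl => /andP[].
rewrite -[leLHS]mul1r; apply: (qform_weighted_le _ m1 m2 b1 b2).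
by apply: filterS h => p; rewrite ler_norml mul1r => /andP[].
Qed.

Section time_dependent_weight.
Context (k k' : R -> T -> R).
Hypotheses (mk : forall t, measurable_fun setT (k t)) (bk : ae_bounded mu k).
Hypothesis (ck : ae_continuous mu k).

Lemma ccontinuous_weighted_form x y : ccontinuous (fun t => weighted_form (k t) x y).
Proof.
have [i1 i2] := phi_cintegrable x y; split.
  have -> : Re \o (fun t => weighted_form (k t) x y) =
     (fun t => RI (fun p => k t p * Re (conjc (phi x p) * phi y p))).
    by apply/funext => t; exact: Re_weighted_form.
  exact: (continuous_parameter_integral mk bk ck).
have -> : Im \o (fun t => weighted_form (k t) x y) =
   (fun t => RI (fun p => k t p * Im (conjc (phi x p) * phi y p))).
  by apply/funext => t; exact: Im_weighted_form.
exact: (continuous_parameter_integral mk bk ck).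
Qed.

Hypotheses (mk' : forall t, measurable_fun setT (k' t)) (bk' : ae_bounded mu k').
Hypothesis (dk : ae_derivative mu k k').

Lemma cderivative_weighted_form x y :
  cderivative (fun t => weighted_form (k t) x y) (fun t => weighted_form (k' t) x y).
Proof.
have [i1 i2] := phi_cintegrable x y; move=> t; split.
  have -> : Re \o (fun t => weighted_form (k t) x y) =
     (fun t => RI (fun p => k t p * Re (conjc (phi x p) * phi y p))).
    by apply/funext => s; exact: Re_weighted_form.
  rewrite Re_weighted_form.
  exact: (is_derive_parameter_integral mk bk mk' bk' dk).
have -> : Im \o (fun t => weighted_form (k t) x y) =
   (fun t => RI (fun p => k t p * Im (conjc (phi x p) * phi y p))).
  by apply/funext => s; exact: Im_weighted_form.
rewrite Im_weighted_form.
exact: (is_derive_parameter_integral mk bk mk' bk' dk).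
Qed.

End time_dependent_weight.

End weighted_forms.

(** * Exchanging the Fourier integral with integration in space *)

Section time_space_fubini.
Context d (T : measurableType d) (R : realType) (mu : {finite_measure set T -> \bar R}).
Local Notation TR := (measurableTypeR R).
Context (P : R) (k : T * TR -> R) (c : R -> R) (M : R).
Hypothesis P_gt0 : 0 < P.
Hypothesis mk : measurable_fun setT k.
Hypothesis cc : continuous c.
Hypothesis kM : forall t : R, 0 <= t <= P -> \forall x \ae mu, `|k (x, t)| <= M.
Local Notation leb := (@lebesgue_measure R).

Definition fubini_integrand (g : T -> R) (z : T * TR) : R :=
  k z * g z.1 * (c z.2 * \1_(`[0, P]%classic : set TR) z.2).

Lemma measurable_slice (t : R) : measurable_fun setT (fun x => k (x, t)).
Proof. exact: (measurableT_comp mk (measurable_pair2 t)). Qed.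

Lemma measurable_time : measurable_fun setT (fun t : TR => c t * \1_(`[0, P]%classic : set TR) t).
Proof.
apply: measurable_funM; last exact: measurable_indic.
exact: continuous_measurable_fun.
Qed.

Lemma measurable_fubini_integrand g : measurable_fun setT g ->
  measurable_fun setT (fubini_integrand g).
Proof.
move=> mg; apply: measurable_funM; first apply: measurable_funM => //.
  by apply: (measurableT_comp mg); exact: measurable_fst.
by apply: (measurableT_comp measurable_time); exact: measurable_snd.
Qed.

(** The bound on [k] holds for almost every [x] at each fixed time, so the iterated integral that
    can be estimated is the one with [x] inside. *)
Lemma fubini_integrand_integrable g : mu.-integrable setT (EFin \o g) ->
  (mu \x leb)%E.-integrable setT (EFin \o fubini_integrand g).
Proof.
move=> /[dup] ig /integrableP[/measurable_EFinP mg gfin].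
have mf : measurable_fun setT (EFin \o fubini_integrand g).
  by apply/measurable_EFinP; exact: measurable_fubini_integrand.
have [_ int21] := @integrable21ltyP _ _ _ _ R mu leb _ mf; apply: int21.
have [B B0 hB] := continuous_bounded_itv (ltW P_gt0) cc.
pose G := Rintegral mu setT (fun x => `|g x|).
have bound : (\int[leb]_(t in `[0%R, P]) (`|M| * B * G)%:E < +oo)%E.
  by rewrite integral_cst//= lebesgue_measure_itv /= lte_fin P_gt0 -EFinD -EFinM ltry.
apply: le_lt_trans bound.
rewrite [leRHS]integral_mkcond; apply: ge0_le_integral => //.
- by move=> t _; exact: integral_ge0.
- apply: (@measurable_fun_fubini_tonelli_G _ _ _ _ R mu (abse \o (EFin \o fubini_integrand g))).
    exact: (measurableT_comp (@abse_measurable _ _) mf).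
  by move=> x /=.
- apply/(measurable_restrictT _ _).1 => //; exact: measurable_cst.
move=> t _; rewrite patchE; case: ifPn => [|tP].
  rewrite inE /= in_itv /= => tP.
  have ing := integrable_norm ig.
  have -> : (`|M| * B * G)%:E = (\int[mu]_x ((`|M| * B)%:E * `|(g x)%:E|))%E.
    rewrite ge0_integralZl ?lee_fin ?mulr_ge0// ?(ltW B0)//; last first.
      by apply: measurableT_comp => //; exact/measurable_EFinP.
    by rewrite EFinM /G /Rintegral fineK//; exact: (integrable_fin_num measurableT ing).
  apply: ae_ge0_le_integral => //.
  + apply/measurable_EFinP; apply: measurableT_comp => //.
    have h1 : measurable_fun setT (fun x => k (x, t) * g x).
      by apply: measurable_funM => //; exact: measurable_slice.
    exact: (measurable_funM h1 (measurable_cst (c t * \1_(`[0, P]%classic : set TR) t))).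
  + by move=> x _; rewrite mule_ge0// lee_fin mulr_ge0// ltW.
  + by apply: emeasurable_funM => //; apply: measurableT_comp => //; exact/measurable_EFinP.
  apply: filterS (kM tP) => x kx _; rewrite /fubini_integrand /= -EFinM lee_fin.
  rewrite indicE mem_set ?in_itv//= mulr1 !normrM mulrAC ler_wpM2r// ler_pM//.
    by rewrite (le_trans kx)// ler_norm.
  exact: hB.
rewrite integral0_eq// => x _; rewrite /fubini_integrand /= indicE (negbTE tP) !mulr0.
by rewrite normr0.
Qed.

Lemma integral_fubini_integrand1 x :
  (\int[leb]_t (fubini_integrand (cst 1%R) (x, t))%:E =
   \int[leb]_(t in `[0%R, P]) (k (x, t) * c t)%:E)%E.
Proof.
rewrite [RHS]integral_mkcond; apply: eq_integral => t _.
rewrite /fubini_integrand /= mulr1 patchE indicE; case: ifP => _.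
  by rewrite mulr1.
by rewrite !mulr0.
Qed.

(** Measurability of [F] comes from the case g = 1, of which it is the partial integral. Pulling
    [g x] out of the time integral is justified at those [x] whose slice is integrable, hence almost
    everywhere. *)
Lemma weighted_fubini (g : T -> R) : mu.-integrable setT (EFin \o g) ->
  let F x := Rintegral leb `[0, P] (fun t => k (x, t) * c t) in
  mu.-integrable setT (EFin \o (fun x => F x * g x)) /\
  Rintegral mu setT (fun x => F x * g x) =
  Rintegral leb `[0, P] (fun t => c t * Rintegral mu setT (fun x => k (x, t) * g x)).
Proof.
move=> ig F.
have i1 : mu.-integrable setT (EFin \o (cst 1%R : T -> R)).
  exact: finite_measure_integrable_cst.
have mg : measurable_fun setT g by case/integrableP : ig => /measurable_EFinP.
have if1 := fubini_integrand_integrable i1.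
have ifg := fubini_integrand_integrable ig.
pose F1 := fubini_F leb (EFin \o fubini_integrand (cst 1%R)).
pose Fg := fubini_F leb (EFin \o fubini_integrand g).
have iF1 : mu.-integrable setT F1 := integrable_fubini_F if1.
have iFg : mu.-integrable setT Fg := integrable_fubini_F ifg.
have FE x : F x = fine (F1 x) by rewrite /F /Rintegral -integral_fubini_integrand1.
have mF : measurable_fun setT F.
  rewrite (_ : F = fine \o F1); last by apply/funext => x; rewrite FE.
  by apply: measurableT_comp => //; case/integrableP : iF1.
have mFg : measurable_fun setT (fun x => F x * g x) by exact: measurable_funM.
have ae : ae_eq mu setT (EFin \o (fun x => F x * g x)) Fg.
  have := ae_integrable1 if1; apply: filterS => x ix _.
  rewrite /Fg /fubini_F /=.
  have -> : (\int[leb]_y (fubini_integrand g (x, y))%:E =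
      \int[leb]_y ((g x)%:E * (fubini_integrand (cst 1%R) (x, y))%:E))%E.
    by apply: eq_integral => y _; rewrite -EFinM /fubini_integrand /=; congr EFin; ring.
  rewrite integralZl// EFinM muleC; congr (_ * _)%E.
  by rewrite FE /F1 /fubini_F fineK//; exact: (integrable_fin_num measurableT ix).
have intE : (\int[mu]_x (F x * g x)%:E = \int[mu]_x Fg x)%E.
  by apply: ae_eq_integral => //; [exact/measurable_EFinP|case/integrableP : iFg].
split.
  apply/integrableP; split; first exact/measurable_EFinP.
  rewrite (@ae_eq_integral _ _ _ mu setT (abse \o Fg))//.
  - by case/integrableP : iFg.
  - by apply: measurableT_comp => //; exact/measurable_EFinP.
  - by apply: measurableT_comp => //; case/integrableP : iFg.
  by apply: filterS ae => x h _ /=; rewrite -h.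
rewrite [LHS]/Rintegral intE /Fg /fubini_F Fubini// /Rintegral.
congr fine; rewrite [RHS]integral_mkcond; apply: eq_integral => t _.
rewrite patchE; case: ifPn => [|tP].
  rewrite inE /= in_itv /= => tP.
  have ikg := integrable_ae_bounded_mul (measurable_slice t) (kM tP) ig.
  rewrite EFinM fineK; last exact: (integrable_fin_num measurableT ikg).
  rewrite -integralZl//; apply: eq_integral => x _.
  rewrite /fubini_integrand /= indicE mem_set ?in_itv//= -EFinM; congr EFin; ring.
rewrite integral0_eq// => x _; rewrite /fubini_integrand /= indicE (negbTE tP) !mulr0.
by [].
Qed.

End time_space_fubini.

Section more_Linf.
Context d (T : measurableType d) (R : realType) (mu : {measure set T -> \bar R}).
Implicit Types (f : T -> R) (k : R -> T -> R).

Lemma eq_Linf_norm f g : (\forall x \ae mu, f x = g x) -> Linf_norm mu f = Linf_norm mu g.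
Proof.
move=> fg; rewrite /Linf_norm unlock /Lnorm; case: ifP => // _.
by apply: eq_ess_sup; apply: filterS fg => x /= ->.
Qed.

(** The L^oo norm of the positive part of [c - f] is below every e, hence 0; the union of null sets
    is hidden in the fact that this norm is itself an almost-everywhere bound. *)
Lemma ae_le_epsilon f (c : R) : (forall e, 0 < e -> \forall x \ae mu, c - e <= f x) ->
  \forall x \ae mu, c <= f x.
Proof.
move=> h; have : \forall x \ae mu, `|Num.max (c - f x) 0| <= 0.
  apply/Linf_norm_leP => //; apply/lee_addgt0Pr => e e0; rewrite add0e.
  apply/Linf_norm_leP; first exact: ltW.
  apply: filterS (h e e0) => x hx; rewrite ger0_norm ?le_max ?lexx ?orbT//.
  by rewrite ge_max (ltW e0) andbT lerBlDr addrC -lerBlDr.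
apply: filterS => x; rewrite normr_le0 => /eqP h0.
by rewrite -subr_le0 -h0 le_max lexx.
Qed.

Lemma ae_periodic_lower_bound k (P c : R) : 0 < P ->
  (forall t, \forall x \ae mu, k (t + P) x = k t x) ->
  (forall t, 0 <= t <= P -> \forall x \ae mu, c <= k t x) ->
  forall t, \forall x \ae mu, c <= k t x.
Proof.
move=> P0 per h t.
have up (s : R) (n : nat) : (\forall x \ae mu, c <= k s x) ->
    \forall x \ae mu, c <= k (s + n%:R * P) x.
  move=> hs; elim: n => [|n IH]; first by rewrite mul0r addr0.
  rewrite -natr1 mulrDl mul1r addrA.
  by apply: filterS2 (per (s + n%:R * P)) IH => x ->.
have down (s : R) (n : nat) : (\forall x \ae mu, c <= k s x) ->
    \forall x \ae mu, c <= k (s - n%:R * P) x.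
  move=> hs; elim: n => [|n IH]; first by rewrite mul0r subr0.
  have := per (s - n.+1%:R * P); rewrite -addrA.
  have -> : - (n.+1%:R * P) + P = - (n%:R * P) by rewrite -natr1; ring.
  by move=> pe; apply: filterS2 pe IH => x ->.
have /andP[f1] := floor_itv (t / P); rewrite intrD => f2.
pose s := t - (Num.floor (t / P))%:~R * P.
have sP : 0 <= s <= P.
  rewrite /s subr_ge0 -ler_pdivlMr// f1 /= lerBlDl.
  have -> : (Num.floor (t / P))%:~R * P + P = ((Num.floor (t / P))%:~R + 1) * P by ring.
  by rewrite -ler_pdivrMr// ltW.
have hs := h s sP.
have -> : t = s + (Num.floor (t / P))%:~R * P by rewrite /s subrK.
case: (Num.floor (t / P)) => n; first exact: up.
by rewrite NegzE mulrNz mulNr; exact: down.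
Qed.

Section growth_rate.
Context (k k' : R -> T -> R) (c P : R).
Hypotheses (c_gt0 : 0 < c) (kc : forall t, \forall x \ae mu, c <= k t x).
Hypotheses (ck : ae_continuous mu k) (bk' : ae_bounded mu k') (ck' : ae_continuous mu k').

Definition growth_rate (t : R) (x : T) : R := Num.max (k' t x) 0 / k t x.

Lemma growth_rate_bounded : ae_bounded mu growth_rate.
Proof.
move=> t; have [M hM] := bk' t; exists (`|M| / c).
apply: filterS2 hM (kc t) => x hM hc; have k0 : 0 < k t x by exact: lt_le_trans hc.
rewrite normrM normfV (gtr0_norm k0) ler_pM ?invr_ge0 ?(ltW k0)//.
  rewrite ger0_norm ?le_max ?lexx ?orbT// ge_max normr_ge0 andbT.
  by rewrite (le_trans (ler_norm _))// (le_trans hM)// ler_norm.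
by rewrite lef_pV2 ?posrE.
Qed.

Lemma growth_rate_continuous : ae_continuous mu growth_rate.
Proof.
move=> t e e0; have [M hM] := bk' t.
pose M1 := `|M|; have M10 : 0 <= M1 := normr_ge0 M.
(* Lipschitz constant of the quotient a / v for numerators bounded by [M1] and denominators at least
   [c]. *)
pose q := c^-1 + M1 / c ^+ 2.
have q0 : 0 < q by rewrite ltr_pwDl ?invr_gt0// divr_ge0// exprn_ge0// ltW.
have e1 : 0 < e / q by rewrite divr_gt0.
apply: filterS2 (ck t e1) (ck' t e1) => s h1 h2.
have hM1 : \forall x \ae mu, `|k' t x| <= M1.
  by apply: filterS hM => x /le_trans; apply; exact: ler_norm.
apply: filterS3 (filterI h1 h2) (filterI (kc s) (kc t)) hM1 => x [a1 a2] [cs ct] aM.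
rewrite /growth_rate.
have u0 : 0 < k s x by exact: lt_le_trans cs.
have v0 : 0 < k t x by exact: lt_le_trans ct.
set a := Num.max (k' s x) 0; set b := Num.max (k' t x) 0.
have ab : `|a - b| <= e / q.
  apply: le_trans a2; rewrite /a /b; have [p|p] := leP (k' s x) 0; have [r|r] := leP (k' t x) 0.
  - by rewrite subrr normr0.
  - by rewrite sub0r normrN gtr0_norm// distrC (le_trans _ (ler_norm _))//; lra.
  - by rewrite subr0 gtr0_norm// (le_trans _ (ler_norm _))//; lra.
  - by [].
have bM : `|b| <= M1.
  rewrite /b; have [p|p] := leP (k' t x) 0; first by rewrite normr0.
  by [].
have -> : a / k s x - b / k t x =
    (a - b) / k s x + b * (k t x - k s x) / (k s x * k t x).
  by field; rewrite !gt_eqF.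
have i1 : (k s x)^-1 <= c^-1 by rewrite lef_pV2 ?posrE.
have i2 : (k s x * k t x)^-1 <= (c ^+ 2)^-1.
  by rewrite lef_pV2 ?posrE ?mulr_gt0// ?exprn_gt0// expr2 ler_pM// ltW.
have -> : e = e / q * c^-1 + M1 * (e / q) * (c ^+ 2)^-1.
  by rewrite {1}(_ : e = e / q * q); [rewrite {2}/q; ring|rewrite divfK// gt_eqF].
apply: (le_trans (ler_normD _ _)); apply: lerD.
  by rewrite normrM normfV (gtr0_norm u0) ler_pM// invr_ge0 ltW.
rewrite !normrM normfV normrM (gtr0_norm u0) (gtr0_norm v0).
by rewrite !ler_pM ?mulr_ge0// ?invr_ge0 ?mulr_ge0 ?(ltW u0) ?(ltW v0)// distrC.
Qed.

Lemma growth_rate_le t : \forall x \ae mu,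
  k' t x <= fine (Linf_norm mu (growth_rate t)) * k t x.
Proof.
have [M hM] := growth_rate_bounded t.
apply: filterS2 (ae_le_Linf_norm hM) (kc t) => x h hc.
have k0 : 0 < k t x by exact: lt_le_trans hc.
apply: (@le_trans _ _ (growth_rate t x * k t x)).
  by rewrite /growth_rate divfK ?gt_eqF// le_max lexx.
by rewrite ler_wpM2r ?(ltW k0)// (le_trans (ler_norm _)).
Qed.

End growth_rate.

End more_Linf.

Section ess_inf_slices.
Context d (T : measurableType d) (R : realType) (mu : {finite_measure set T -> \bar R}).
Local Notation leb := (@lebesgue_measure R).
Local Notation TR := (measurableTypeR R).

(** Fubini gives the bound on the slices of almost every time; such times are dense, and continuity
    in L^oo carries the bound to every time with an arbitrarily small loss. *)
Lemma ae_slice_lower_bound (k : R -> T -> R) (P c : R) : 0 < P ->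
  (\forall p \ae (mu \x leb)%E, (setT `*` `[0%R, P]) p -> c <= k p.2 p.1) ->
  ae_continuous mu k ->
  forall t, 0 <= t <= P -> \forall x \ae mu, c <= k t x.
Proof.
move=> P0 [N [mN muN hN]] ck t /andP[t0 tP].
have slices : \forall y \ae leb, mu (ysection N y) = 0%E.
  have mG := measurable_fun_ysection mu mN.
  have [+ _] := ae_eq_integral_abs leb measurableT mG.
  have -> : (\int[leb]_y `|(mu \o ysection N) y| = 0)%E.
    under eq_integral do rewrite gee0_abs ?measure_ge0//.
    have := indic_fubini_tonelli mu leb mN.
    rewrite indic_fubini_tonelli_GE// indic_fubini_tonelli_FE// => <-.
    exact: muN.
  by move=> /(_ erefl); apply: filterS => y /(_ I).
apply: ae_le_epsilon => e e0.
have [del /= del0 hdel] := ck t e e0.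
have [s [sP sdel Ns]] : exists s, [/\ 0 <= s <= P, `|s - t| < del & mu (ysection N s) = 0%E].
  apply: contrapT => hno.
  (* A one-sided interval at [t], to the right if t < P and to the left otherwise, stays inside the
     period and has positive length, so it cannot consist of exceptional times. *)
  have [a [b [ab hab]]] : exists a b, a < b /\
      forall s, a < s < b -> 0 <= s <= P /\ `|s - t| < del.
    have [tP'|tP'] := ltP t P.
      exists t, (Num.min P (t + del)); rewrite lt_min tP' ltrDl; split => // s.
      by rewrite lt_min => /andP[h1 /andP[h2 h3]]; rewrite gtr0_norm; lra.
    exists (Num.max 0 (t - del)), t; rewrite gt_max; split.
      by rewrite (lt_le_trans P0)//= ltrBlDr ltrDl.
    by move=> s; rewrite gt_max => /andP[/andP[h1 h2] h3]; rewrite ltr0_norm; lra.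
  have sub : `]a, b[%classic `<=` [set y | mu (ysection N y) <> 0%E].
    move=> s /=; rewrite in_itv /= => /hab[h1 h2] h3; apply: hno.
    by exists s; split.
  have [M [mM leM hM]] := slices.
  have : (leb `]a, b[%classic <= leb M)%E.
    by apply: le_measure; rewrite ?inE//; apply: (subset_trans sub).
  by rewrite leM lebesgue_measure_itv /= lte_fin ab lee_fin leNgt subr_gt0 ab.
have hs : \forall x \ae mu, c <= k s x.
  exists (ysection N s); split => //; first exact: measurable_ysection.
  move=> x /= h; rewrite /ysection /= inE; apply: hN => /=; apply: contra_not h => h.
  by apply: h; split => //=; rewrite in_itv.
have hst : \forall x \ae mu, `|k s x - k t x| <= e by apply: hdel; rewrite /= distrC.
apply: filterS2 hs hst => x h1; rewrite ler_distl => /andP[h2 h3].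
by lra.
Qed.

End ess_inf_slices.

Section volume_of_bounded_sets.
Context (R : realType) (n : nat) (D : set 'rV[R]_n).

Lemma volume_lty : bounded_set D -> (volume D setT < +oo)%E.
Proof.
move=> [M0 [_ /(_ (M0 + 1))]]; rewrite ltrDl ltr01 => /(_ isT).
set M := M0 + 1 => hM.
have Dbox : D `<=` box (const_mx (- `|M|)) (const_mx `|M|).
  move=> x Dx i; rewrite !mxE -ler_norml; apply: le_trans (ler_norm M).
  apply: le_trans (hM x Dx); rewrite [leRHS]mx_normrE.
  by apply: (le_bigmax_cond 0 (fun ij : 'I_1 * 'I_n => `|x ij.1 ij.2|) (j := (0, i))).
(* The gauge is defined on all sets, so D followed by empty sets is an admissible cover, and its
   gauge is at most the volume of a bounding cube. *)
pose F k : set (all_sets R n) := if k is 0%N then setT `&` D else set0.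
have gF : (box_gauge D < +oo)%E.
  rewrite /box_gauge; case: ifP => // _.
  apply: (@le_lt_trans _ _ (\prod_(i < n) ((const_mx `|M| : 'rV[R]_n) 0 i -
    (const_mx (- `|M|) : 'rV[R]_n) 0 i))%:E); last exact: ltry.
  apply: ereal_inf_lbound; exists (const_mx (- `|M|), const_mx `|M|); split => //= i.
  by rewrite !mxE ge0_cp.
apply: le_lt_trans gF.
apply: ereal_inf_lbound; exists F.
  split; first by move=> k.
  by move=> x Dx; exists 0%N.
rewrite nneseries_recl//; last by move=> k _; exact: box_gauge_ge0.
rewrite /F /= setTI eseries0 ?adde0// => -[//|k] _ _.
exact: box_gauge0.
Qed.

End volume_of_bounded_sets.

Section fourier_coefficient_fubini.
Context d (T : measurableType d) (R : realType) (mu : {finite_measure set T -> \bar R}).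
Local Notation TR := (measurableTypeR R).
Context (P : R) (k : R -> T -> R) (M : R) (n : int).
Hypothesis P_gt0 : 0 < P.
Hypothesis mk : measurable_fun setT (fun p : T * TR => k p.2 p.1).
Hypothesis bk : ae_bounded mu k.
Hypothesis ck : ae_continuous mu k.
Hypothesis kM : forall t : R, 0 <= t <= P -> \forall x \ae mu, `|k t x| <= M.
Local Notation Om := (frequency P).
Local Notation leb := (@lebesgue_measure R).
Local Notation RI f := (Rintegral leb (`[0, P] : set TR) f).

Let a (t : R) : R := n%:~R * Om * t.

Lemma measurable_time_slice t : measurable_fun setT (k t).
Proof. exact: (measurableT_comp mk (measurable_pair2 t)). Qed.

Lemma fourier_coefE p : fourier_coef P k n p =
  (P^-1)%:C * ((RI (fun t => k t p * cos (a t))) +i* (RI (fun t => k t p * sin (a t)))).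
Proof.
rewrite /fourier_coef /cintegral; congr (_ * (_ +i* _)); apply: eq_Rintegral => t _.
  by rewrite ReZ.
by rewrite ImZ.
Qed.

(** Links the Fourier coefficients of kappa, taken pointwise in space, to those of the
    time-dependent forms: four applications of [weighted_fubini], one for each pairing of cosine or
    sine with the real or imaginary part of [h]. *)
Lemma fourier_coef_fubini (h : T -> R[i]) : cintegrable mu setT h ->
  cintegrable mu setT (fun p => fourier_coef P k n p * h p) /\
  cintegral mu setT (fun p => fourier_coef P k n p * h p) =
  (P^-1)%:C * Iper P (fun t =>
    cintegral mu setT (fun p => (k t p)%:C * h p) * mode P n t).
Proof.
move=> [ih1 ih2].
have linc : continuous a by move=> t; apply: cvgMr; exact: cvg_id.
have cc : continuous (fun t => cos (a t)).
  by move=> t; apply: continuous_comp; [exact: linc|exact: continuous_cos].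
have cs : continuous (fun t => sin (a t)).
  by move=> t; apply: continuous_comp; [exact: linc|exact: continuous_sin].
pose Fc p := RI (fun t => k t p * cos (a t)).
pose Fs p := RI (fun t => k t p * sin (a t)).
have F c (Cc : continuous c) g ig := @weighted_fubini _ _ _ mu P
  (fun p => k p.2 p.1) c M P_gt0 mk Cc kM g ig.
pose FG (W : T -> R) (c : R -> R) (g : T -> R) :=
  mu.-integrable setT (EFin \o (fun x => W x * g x)) /\
  Rintegral mu setT (fun x => W x * g x) =
  RI (fun t => c t * Rintegral mu setT (fun x => k t x * g x)).
have [ic1 ec1] : FG Fc (cos \o a) (fun x => Re (h x)) := F _ cc _ ih1.
have [ic2 ec2] : FG Fc (cos \o a) (fun x => Im (h x)) := F _ cc _ ih2.
have [is1 es1] : FG Fs (sin \o a) (fun x => Re (h x)) := F _ cs _ ih1.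
have [is2 es2] : FG Fs (sin \o a) (fun x => Im (h x)) := F _ cs _ ih2.
have mt := measurable_time_slice.
have K1 := continuous_parameter_integral mt bk ck ih1.
have K2 := continuous_parameter_integral mt bk ck ih2.
have fE p : fourier_coef P k n p * h p = (P^-1)%:C *
   ((Fc p * Re (h p) - Fs p * Im (h p)) +i* (Fc p * Im (h p) + Fs p * Re (h p))).
  rewrite fourier_coefE -mulrA; congr (_ * _).
  by apply: complex_eq; rewrite ?ReM ?ImM.
have iF : cintegrable mu setT (fun p =>
   (Fc p * Re (h p) - Fs p * Im (h p)) +i* (Fc p * Im (h p) + Fs p * Re (h p))).
  by split; [exact: integrableBr|exact: integrableDr].
split.
  by under eq_fun do rewrite fE; exact: cintegrableZ.
under eq_fun do rewrite fE.
rewrite cintegralZ//; congr (_ * _).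
have ci (u v : R -> R) : continuous u -> continuous v ->
    leb.-integrable (`[0, P] : set TR) (EFin \o (fun t => v t * u t)).
  by move=> cu cv; apply: continuous_integrable_itv; exact: contM.
have i11' := ci _ _ K1 cc; have i12' := ci _ _ K2 cc.
have i21' := ci _ _ K1 cs; have i22' := ci _ _ K2 cs.
have fK t : cintegral mu setT (fun p => (k t p)%:C * h p) =
    (Rintegral mu setT (fun p => k t p * Re (h p))) +i*
    (Rintegral mu setT (fun p => k t p * Im (h p))).
  by apply: complex_eq => /=; apply: eq_Rintegral => p _; rewrite ?ReZ ?ImZ.
apply: complex_eq.
  rewrite [LHS](RintegralB measurableT ic1 is2) ec1 es2.
  rewrite -(RintegralB _ i11' i22')//.
  by apply: eq_Rintegral => t _; rewrite fK ReM /=; ring.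
rewrite [LHS](RintegralD measurableT ic2 is1) ec2 es1.
rewrite -(RintegralD _ i12' i21')//.
by apply: eq_Rintegral => t _; rewrite fK ImM /=; ring.
Qed.

End fourier_coefficient_fubini.

Lemma weighted_form_ae_eq d (T : measurableType d) (R : realType)
    (mu : {measure set T -> \bar R}) (V : lmodType R[i]) (phi : V -> T -> R[i]) (w1 w2 : T -> R) x y :
  (forall x, L2 mu (phi x)) -> measurable_fun setT w1 -> measurable_fun setT w2 ->
  (\forall p \ae mu, w1 p = w2 p) ->
  weighted_form mu phi w1 x y = weighted_form mu phi w2 x y.
Proof.
move=> phi_L2 m1 m2 w12.
have [/integrableP[/measurable_EFinP mR _] /integrableP[/measurable_EFinP mI _]] :=
  L2_cintegrable (phi_L2 x) (phi_L2 y).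
apply: complex_eq; rewrite ?Re_weighted_form ?Im_weighted_form.
  by apply: ae_eq_Rintegral; try exact: measurable_funM; apply: filterS w12 => p ->.
by apply: ae_eq_Rintegral; try exact: measurable_funM; apply: filterS w12 => p ->.
Qed.

Definition gradient_form d (T : measurableType d) (R : realType)
    (mu : {measure set T -> \bar R}) (V : lmodType R[i]) (L : nat)
    (psi : 'I_L -> V -> T -> R[i]) (w : T -> R) (x y : V) : R[i] :=
  \sum_l weighted_form mu (psi l) w x y.

Section weighted_coefficient_forms.
Context d (T : measurableType d) (R : realType) (mu : {finite_measure set T -> \bar R}).
Context (P c C0 C1 : R) (k k1 : R -> T -> R).
Hypotheses (P_gt0 : 0 < P) (c_gt0 : 0 < c).
Hypotheses (mk : forall t, measurable_fun setT (k t)) (bk : ae_bounded mu k)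
  (ck : ae_continuous mu k) (pk : forall t, \forall x \ae mu, k (t + P) x = k t x).
Hypotheses (mk1 : forall t, measurable_fun setT (k1 t)) (bk1 : ae_bounded mu k1)
  (ck1 : ae_continuous mu k1) (dk : ae_derivative mu k k1).
Hypothesis kc : forall t, \forall x \ae mu, c <= k t x.
Hypothesis kC0 : forall t, 0 <= t <= P -> \forall x \ae mu, `|k t x| <= C0.
Hypothesis kC1 : forall t, 0 <= t <= P -> \forall x \ae mu, `|k1 t x| <= C1.
Context (V : lmodType R[i]) (L : nat) (phi : V -> T -> R[i]) (psi : 'I_L -> V -> T -> R[i]).
Hypothesis phi_linear : forall a x y p, phi (a *: x + y) p = a * phi x p + phi y p.
Hypothesis phi_L2 : forall x, L2 mu (phi x).
Hypothesis psi_linear : forall l a x y p, psi l (a *: x + y) p = a * psi l x p + psi l y p.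
Hypothesis psi_L2 : forall l x, L2 mu (psi l x).

(** Each inequality between forms is an almost-everywhere inequality between weights, integrated
    against the squared moduli of the [psi l]. *)
Lemma weighted_coefficient_forms :
  coefficient_forms P (fun t => fine (Linf_norm mu (growth_rate k k1 t))) c C0 C1
    (weighted_form mu phi (cst 1)) (gradient_form mu psi (cst 1))
    (fun t => gradient_form mu psi (k t)) (fun t => gradient_form mu psi (k1 t)).
Proof.
have m1 : measurable_fun setT (cst 1%R : T -> R) by exact: measurable_cst.
have b1 : \forall p \ae mu, `|(cst 1%R : T -> R) p| <= 1.
  by apply: aeW => p; rewrite normr1.
have m0 : measurable_fun setT (cst 0%R : T -> R) by exact: measurable_cst.
have b0 : \forall p \ae mu, `|(cst 0%R : T -> R) p| <= 0.
  by apply: aeW => p; rewrite normr0.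
have pos (f : V -> T -> R[i]) (f2 : forall x, L2 mu (f x)) x : 0 <= qform (weighted_form mu f (cst 1)) x.
  have := @qform_weighted_le _ _ _ mu V f f2 (cst 1) (cst 1) 1 1 0 1 x m1 m1 b1 b1.
  rewrite mul0r mul1r; apply; apply: aeW => p; rewrite mul0r mul1r; exact: ler01.
split.
- exact: (hermitian_weighted_form phi_linear phi_L2 m1 b1).
- apply: hermitian_form_sum => l.
  exact: (hermitian_weighted_form (psi_linear l) (psi_L2 l) m1 b1).
- move=> t; apply: hermitian_form_sum => l; have [M hM] := bk t.
  exact: (hermitian_weighted_form (psi_linear l) (psi_L2 l) (mk t) hM).
- move=> t; apply: hermitian_form_sum => l; have [M hM] := bk1 t.
  exact: (hermitian_weighted_form (psi_linear l) (psi_L2 l) (mk1 t) hM).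
- by move=> x; exact: pos.
- by move=> x; rewrite qform_sum sumr_ge0// => l _; exact: pos.
- move=> x y; apply: cderivative_sum => l.
  exact: (cderivative_weighted_form (psi_L2 l) mk bk mk1 bk1 dk).
- move=> x y; apply: ccontinuous_sum => l _.
  exact: (ccontinuous_weighted_form (psi_L2 l) mk1 bk1 ck1).
- move=> x y; apply: eq_bigr => l _.
  apply: (weighted_form_ae_eq _ _ (psi_L2 l) (mk _) (mk _)).
  by have := pk 0; rewrite add0r.
- move=> t x tP; rewrite !qform_sum mulr_sumr ler_sum// => l _.
  rewrite -[leRHS]mul1r; have [M hM] := bk t.
  apply: (qform_weighted_le (psi_L2 l) x m1 (mk t) b1 hM).
  by apply: filterS (kc t) => p h; rewrite /= mulr1 mul1r.
- move=> t x tP; rewrite !qform_sum mulr_sumr (le_trans (ler_norm_sum _ _ _))//.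
  rewrite ler_sum// => l _.
  apply: (qform_weighted_norm_le (psi_L2 l) x (mk t) m1 (kC0 tP) b1).
  by apply: filterS (kC0 tP) => p h; rewrite /= mulr1.
- move=> t x tP; rewrite !qform_sum mulr_sumr (le_trans (ler_norm_sum _ _ _))//.
  rewrite ler_sum// => l _.
  apply: (qform_weighted_norm_le (psi_L2 l) x (mk1 t) m1 (kC1 tP) b1).
  by apply: filterS (kC1 tP) => p h; rewrite /= mulr1.
- move=> t x tP; rewrite !qform_sum mulr_sumr ler_sum// => l _.
  rewrite -[leLHS]mul1r.
  apply: (qform_weighted_le (psi_L2 l) x (mk1 t) (mk t) (kC1 tP) (kC0 tP)).
  apply: filterS (growth_rate_le c_gt0 kc bk1 t) => p; by rewrite mul1r.
Qed.

End weighted_coefficient_forms.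

Section coefficient_regularity.
Context d (T : measurableType d) (R : realType) (mu : {measure set T -> \bar R}).
Context (P : R) (k : R -> T -> R).

Lemma Cper_regular m : Cper mu m P k ->
  [/\ forall t, measurable_fun setT (k t), ae_bounded mu k, ae_continuous mu k &
      forall t, \forall x \ae mu, k (t + P) x = k t x].
Proof.
move=> h; have [h1 h2 h3] : [/\ forall t, k t \in Lfun mu +oo%E,
      forall t, \forall x \ae mu, k (t + P) x = k t x & Linf_continuous mu k].
  by case: m h => [|m] [].
split => //; last exact: Linf_continuous_ae.
  by move=> t; have [] := Lfun_oo_ae (h1 t).
by move=> t; have [] := Lfun_oo_ae (h1 t).
Qed.

Lemma ae_uniform_bound (a b : R) : a <= b -> ae_bounded mu k -> ae_continuous mu k ->
  exists2 C, 0 <= C & forall t, a <= t <= b -> \forall x \ae mu, `|k t x| <= C.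
Proof.
move=> ab bk ck.
have [C C0 hC] := continuous_bounded_itv ab (continuous_Linf_norm bk ck).
exists C => [|t tab]; first exact: ltW.
have [M hM] := bk t.
apply: filterS (ae_le_Linf_norm hM) => x /le_trans; apply.
exact: le_trans (ler_norm _) (hC t tab).
Qed.

End coefficient_regularity.

Lemma ess_inf_lower_bound d (T : measurableType d) (R : realType)
    (mu : {measure set T -> \bar R}) (A : set T) (f : T -> R) :
  (0 < ess_inf_on mu A (fun x => (f x)%:E))%E ->
  exists2 c, 0 < c & \forall x \ae mu, A x -> c <= f x.
Proof.
move=> /ereal_sup_gt[[y| |] /= hy y0] //.
  exists y; first by rewrite -lte_fin.
  by apply: filterS hy => x h /h; rewrite lee_fin.
(* A lower bound +oo of a real function means that A is negligible, so any positive constant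
   serves. *)
by exists 1 => //; apply: filterS hy => x h /h; rewrite leye_eq.
Qed.

(** * From fields to coordinate vectors *)

Section weighted_products.
Context d (T : measurableType d) (R : realType) (mu : {measure set T -> \bar R}).
Implicit Types (f g : T -> R[i]) (w : T -> R).

Definition weighted_ip w f g : R[i] :=
  cintegral mu setT (fun p => (w p)%:C * (conjc (f p) * g p)).

Lemma weighted_ip1 f g : weighted_ip (cst 1) f g = ip mu f g.
Proof. by apply: eq_cintegral => p _; rewrite mul1r. Qed.

Lemma weighted_ip_ae_eq w f1 f2 g1 g2 : measurable_fun setT w ->
  L2 mu f1 -> L2 mu f2 -> L2 mu g1 -> L2 mu g2 ->
  (\forall p \ae mu, f1 p = f2 p) -> (\forall p \ae mu, g1 p = g2 p) ->
  weighted_ip w f1 g1 = weighted_ip w f2 g2.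
Proof.
move=> mw f1L f2L g1L g2L f12 g12.
have [/integrableP[/measurable_EFinP mR1 _] /integrableP[/measurable_EFinP mI1 _]] :=
  L2_cintegrable f1L g1L.
have [/integrableP[/measurable_EFinP mR2 _] /integrableP[/measurable_EFinP mI2 _]] :=
  L2_cintegrable f2L g2L.
have Re_ip f g : Re (weighted_ip w f g) =
    Rintegral mu setT (fun p => w p * Re (conjc (f p) * g p)).
  by apply: eq_Rintegral => p _; rewrite ReZ.
have Im_ip f g : Im (weighted_ip w f g) =
    Rintegral mu setT (fun p => w p * Im (conjc (f p) * g p)).
  by apply: eq_Rintegral => p _; rewrite ImZ.
apply: complex_eq; rewrite ?Re_ip ?Im_ip; apply: ae_eq_Rintegral;
  try exact: measurable_funM; by apply: filterS2 f12 g12 => p -> ->.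
Qed.

Lemma ip_ae_eq f1 f2 g1 g2 :
  L2 mu f1 -> L2 mu f2 -> L2 mu g1 -> L2 mu g2 ->
  (\forall p \ae mu, f1 p = f2 p) -> (\forall p \ae mu, g1 p = g2 p) ->
  ip mu f1 g1 = ip mu f2 g2.
Proof. by rewrite -!weighted_ip1; apply: weighted_ip_ae_eq; exact: measurable_cst. Qed.

Lemma L2_cst0 f : L2 mu f -> L2 mu (fun=> 0).
Proof.
move=> fL; rewrite (_ : (fun=> 0) = fun p => -1 * f p + f p); first exact: L2_comb.
by apply/funext => p; rewrite mulN1r addNr.
Qed.

Lemma L2_scale a f : L2 mu f -> L2 mu (fun p => a * f p).
Proof.
move=> fL; have := L2_comb a fL (L2_cst0 fL).
by under eq_fun do rewrite addr0.
Qed.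

Lemma L2_sub f g : L2 mu f -> L2 mu g -> L2 mu (fun p => f p - g p).
Proof.
move=> fL gL; have := L2_comb (-1) gL fL.
by under eq_fun do rewrite mulN1r addrC.
Qed.

End weighted_products.

Section harmonic_extension.
Context (V : nmodType) (K : nat) (c : 'I_K.*2.+1 -> V).

Definition harmonic_extension (n : int) : V :=
  if (absz n <= K)%N then c (inord (absz (n + K%:Z)%R)) else 0.

Lemma harmonic_extensionE j : harmonic_extension (harmonic j) = c j.
Proof.
rewrite /harmonic_extension absz_harmonic; congr c; apply/val_inj.
by rewrite /= inordK; have := ltn_ord j; rewrite /harmonic /=; lia.
Qed.

Lemma harmonic_extension0 n : (K < absz n)%N -> harmonic_extension n = 0.
Proof. by rewrite /harmonic_extension ltnNge => /negbTE ->. Qed.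

End harmonic_extension.

(** * The Galerkin equations in coordinates *)

Section galerkin.
Context d (T : measurableType d) (R : realType) (mu : {finite_measure set T -> \bar R}).
Context d' (S : measurableType d') (nu : {measure set S -> \bar R}).
Context (P C0 : R) (k : R -> T -> R).
Local Notation TR := (measurableTypeR R).
Local Notation Om := (frequency P).
Hypothesis P_gt0 : 0 < P.
Hypothesis mk : measurable_fun setT (fun p : T * TR => k p.2 p.1).
Hypotheses (bk : ae_bounded mu k) (ck : ae_continuous mu k).
Hypothesis kC0 : forall t : R, 0 <= t <= P -> \forall x \ae mu, `|k t x| <= C0.
Context (V : lmodType R[i]) (L : nat) (phi : V -> T -> R[i]) (psi : 'I_L -> V -> T -> R[i])
  (theta : V -> S -> R[i]).
Hypothesis phi_linear : forall a x y p, phi (a *: x + y) p = a * phi x p + phi y p.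
Hypothesis phi_L2 : forall x, L2 mu (phi x).
Hypothesis psi_linear : forall l a x y p, psi l (a *: x + y) p = a * psi l x p + psi l y p.
Hypothesis psi_L2 : forall l x, L2 mu (psi l x).
Hypothesis theta_linear : forall a x y p, theta (a *: x + y) p = a * theta x p + theta y p.
Hypothesis theta_L2 : forall x, L2 nu (theta x).
Context (K : nat) (k0 : R) (omega : R[i]) (u z : 'I_K.*2.+1 -> T -> R[i])
  (gu : 'I_K.*2.+1 -> 'I_L -> T -> R[i]) (tz : 'I_K.*2.+1 -> S -> R[i])
  (cu cz : 'I_K.*2.+1 -> V).
Hypotheses (u_L2 : forall j, L2 mu (u j)) (z_L2 : forall j, L2 mu (z j))
  (gu_L2 : forall j l, L2 mu (gu j l)) (tz_L2 : forall j, L2 nu (tz j)).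
Hypotheses (u_phi : forall j, \forall p \ae mu, u j p = phi (cu j) p)
  (z_phi : forall j, \forall p \ae mu, z j p = phi (cz j) p)
  (gu_psi : forall j l, \forall p \ae mu, gu j l p = psi l (cu j) p)
  (tz_theta : forall j, \forall p \ae nu, tz j p = theta (cz j) p).
Local Notation dfreq j := (- 'i * ((harmonic j)%:~R * Om)%:C).
Hypothesis eq1 : forall j v,
  ip mu (phi v) (fun p => dfreq j * u j p - z j p) = 'i * omega * ip mu (phi v) (u j).
Hypothesis eq2 : forall j v,
  ip mu (phi v) (fun p => dfreq j * z j p) +
  \sum_l ip mu (psi l v)
    (fun p => \sum_m fourier_coef P k (harmonic j - harmonic m) p * gu m l p) +
  k0%:C * ip nu (theta v) (tz j) = 'i * omega * ip mu (phi v) (z j).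
Hypothesis nz : ~ (forall j, \forall p \ae mu, u j p = 0 /\ z j p = 0).

Local Notation G := (weighted_form mu phi (cst 1)).

Lemma galerkin_stiffness (j : 'I_K.*2.+1) v l :
  ip mu (psi l v) (fun p => \sum_m fourier_coef P k (harmonic j - harmonic m) p * gu m l p) =
  \sum_m form_coef P (fun t => weighted_form mu (psi l) (k t))
    (harmonic j - harmonic m) v (cu m).
Proof.
have F n m := fourier_coef_fubini n P_gt0 mk bk ck kC0
  (L2_cintegrable (psi_L2 l v) (gu_L2 m l)).
rewrite /ip (@eq_cintegral _ _ _ _ _ _ (fun p => \sum_m
   fourier_coef P k (harmonic j - harmonic m) p * (conjc (psi l v p) * gu m l p))); last first.
  by move=> p _; rewrite mulr_sumr; apply: eq_bigr => m _; rewrite mulrCA.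
rewrite cintegral_sum//; last by move=> m _; case: (F (harmonic j - harmonic m) m).
apply: eq_bigr => m _; have [_ ->] := F (harmonic j - harmonic m) m.
rewrite /form_coef; apply: (congr1 (fun x => (P^-1)%:C * x)).
apply: eq_cintegral => t _; apply: (congr1 (fun x => x * mode P _ t)).
apply: (weighted_ip_ae_eq (measurable_time_slice mk t)) => //.
by apply: aeW.
Qed.

(** Fields agree with their coordinate expressions only almost everywhere, which inner products do
    not see; conversely a vanishing quadratic form gives a field that is zero almost everywhere. *)
Lemma galerkin_modal_eigenvector :
  modal_eigenvector P K k0 G (fun t => gradient_form mu psi (k t))
    (weighted_form nu theta (cst 1)) omega
    (harmonic_extension cu) (harmonic_extension cz).
Proof.
have m1 : measurable_fun setT (cst 1%R : T -> R) by exact: measurable_cst.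
have b1 : \forall p \ae mu, `|(cst 1%R : T -> R) p| <= 1 by apply: aeW => p; rewrite normr1.
have hG : hermitian_form G := hermitian_weighted_form phi_linear phi_L2 m1 b1.
have Gu j v : ip mu (phi v) (u j) = G v (cu j).
  by rewrite -weighted_ip1; apply: (weighted_ip_ae_eq m1) => //; exact: aeW.
have Gz j v : ip mu (phi v) (z j) = G v (cz j).
  by rewrite -weighted_ip1; apply: (weighted_ip_ae_eq m1) => //; exact: aeW.
have phi0 p : phi 0 p = 0.
  by have := phi_linear (-1) 0 0 p; rewrite scaler0 addr0 mulN1r addNr.
have phiN x p : phi (- x) p = - phi x p.
  by have := phi_linear (-1) x 0 p; rewrite scaleN1r addr0 phi0 addr0 mulN1r.
split.
- exact: harmonic_extension0.
- exact: harmonic_extension0.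
- move=> n v /harmonic_surj[j <-].
  rewrite /dtime !harmonic_extensionE.
  have -> : dfreq j *: cu j - ('i * omega) *: cu j - cz j =
     (dfreq j *: cu j - cz j) - ('i * omega) *: cu j by rewrite addrAC.
  rewrite (formBr hG) (formZr hG) -Gu -eq1 -weighted_ip1.
  apply/eqP; rewrite subr_eq0; apply/eqP; apply: (weighted_ip_ae_eq m1) => //.
  + by apply: L2_sub => //; exact: L2_scale.
  + exact: aeW.
  + by apply: filterS2 (u_phi j) (z_phi j) => p -> ->; rewrite phi_linear phiN.
- move=> n v /harmonic_surj[j <-].
  rewrite /dtime !harmonic_extensionE (formBr hG) !(formZr hG) -Gz -eq2.
  have -> : ip mu (phi v) (fun p => dfreq j * z j p) = dfreq j * ip mu (phi v) (z j).
    rewrite /ip -cintegralZ//; last exact: L2_cintegrable.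
    by apply: eq_cintegral => p _; rewrite mulrCA.
  have -> : ip nu (theta v) (tz j) = weighted_form nu theta (cst 1) v (cz j).
    by rewrite -weighted_ip1; apply: weighted_ip_ae_eq => //; exact: aeW.
  have -> : ssum K (fun m => form_coef P (fun t => gradient_form mu psi (k t))
      (harmonic j - m) v (harmonic_extension cu m)) =
    \sum_l ip mu (psi l v)
      (fun p => \sum_m fourier_coef P k (harmonic j - harmonic m) p * gu m l p).
    under [RHS]eq_bigr do rewrite galerkin_stiffness.
    rewrite exchange_big; apply: eq_bigr => m _; rewrite harmonic_extensionE.
    rewrite /form_coef -mulr_sumr; congr (_ * _).
    rewrite -Iper_sum; last first.
      move=> l _; apply: ccontinuousM; last exact: ccontinuous_mode.
      exact: (ccontinuous_weighted_form (psi_L2 l) (measurable_time_slice mk) bk ck).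
    by apply: eq_cintegral => t _; rewrite /gradient_form mulr_suml.
  by rewrite opprD !opprD; ring.
apply: contrapT => hno; apply: nz => j.
have zero x : qform G x = 0 -> \forall p \ae mu, phi x p = 0.
  move=> h; apply: L2norm_eq0 => //.
  by rewrite /L2norm -weighted_ip1 -[RHS](@sqrtr0 R); congr Num.sqrt.
have Gu0 : qform G (cu j) = 0.
  apply: contrapT => /eqP h; apply: hno; exists (harmonic j); left.
  by rewrite harmonic_extensionE.
have Gz0 : qform G (cz j) = 0.
  apply: contrapT => /eqP h; apply: hno; exists (harmonic j); right.
  by rewrite harmonic_extensionE.
apply: filterS2 (filterI (u_phi j) (zero _ Gu0)) (filterI (z_phi j) (zero _ Gz0)).
by move=> p [-> ->] [-> ->].
Qed.

End galerkin.

Section finite_volume.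
Context (R : realType) (n : nat) (D : set 'rV[R]_n).
Hypothesis bD : bounded_set D.

Lemma volume_fin_num_fun : fin_num_fun (volume D).
Proof.
apply: lty_fin_num_fun; exact: volume_lty.
Qed.

(** The measure [volume D] with its finiteness attached, as the Fubini arguments require. *)
Definition finite_volume :
    {finite_measure set (caratheodory_type (volume_outer D)) -> \bar R} :=
  HB.pack (Measure.sort (volume D)) (Measure_isFinite.Build _ _ _ (volume D) volume_fin_num_fun).

End finite_volume.

Section almost_everywhere.
Context d (T : measurableType d) (R : realType) (mu : {measure set T -> \bar R}).
Implicit Types A B C : T -> Prop.

Lemma ae_imply A B : (forall p, A p -> B p) ->
  (\forall p \ae mu, A p) -> \forall p \ae mu, B p.
Proof. by move=> AB; exact: filterS. Qed.

Lemma ae_imply2 A B C : (forall p, A p -> B p -> C p) ->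
  (\forall p \ae mu, A p) -> (\forall p \ae mu, B p) -> \forall p \ae mu, C p.
Proof. by move=> ABC; exact: filterS2. Qed.

Lemma ae_and A B : (\forall p \ae mu, A p) -> (\forall p \ae mu, B p) ->
  \forall p \ae mu, A p /\ B p.
Proof. by move=> hA hB; apply: filterS2 hA hB => p. Qed.

End almost_everywhere.

Section null_functions.
Context d (T : measurableType d) (R : realType) (mu : {measure set T -> \bar R}).

Lemma L2_sum (I : Type) (s : seq I) (a : I -> R[i]) (f : I -> T -> R[i]) (g : T -> R[i]) :
  L2 mu g -> (forall i, L2 mu (f i)) -> L2 mu (fun p => \sum_(i <- s) a i * f i p).
Proof.
move=> gL fL; elim: s => [|i s IH].
  by under eq_fun do rewrite big_nil; exact: L2_cst0 gL.
by under eq_fun do rewrite big_cons; exact: L2_comb.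
Qed.

Lemma ae0_L2norm f : L2 mu f -> (\forall p \ae mu, f p = 0) -> L2norm mu f = 0.
Proof.
move=> fL f0; have zL := L2_cst0 fL.
rewrite /L2norm (ip_ae_eq fL zL fL zL f0 f0) /ip.
have -> : cintegral mu setT (fun x => (0 : R[i])^* * 0) = 0.
  rewrite (_ : (fun _ : T => _) = fun=> 0) ?cintegral0//.
  by apply/funext => p; rewrite mulr0.
by rewrite sqrtr0.
Qed.

Lemma L2norm_sqr f : L2 mu f -> L2norm mu f ^+ 2 = Re (ip mu f f).
Proof.
move=> fL; rewrite /L2norm sqr_sqrtr//.
have [i1 _] := L2_cintegrable fL fL.
apply: (ae_Rintegral_ge0 i1); apply: aeW => p.
by rewrite mulConjE /= addr_ge0 ?sqr_ge0.
Qed.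

End null_functions.

(** * Coordinates on the discrete space *)

Section discrete_space.
Context (R : realType) (n : nat) (D : set 'rV[R]_n.+1).
Local Notation field := (field R n).
Local Notation vol := (volume D).
Local Notation srf := (surface (boundary D)).
Context (tr : ('rV[R]_n.+1 -> R[i]) -> ('rV[R]_n.+1 -> R[i])).
Hypothesis htr : trace_operator D tr.
Context (X : set field) (N : nat) (e : 'I_N -> field).
Hypothesis X_H1 : X `<=` H1 D.
Hypothesis X_neq0 : X !=set0.
Hypothesis X_comb : forall c v w, X v -> X w -> X (comb c v w).
Hypothesis X_e : forall j, X (e j).
Hypothesis X_span : forall w, X w -> exists c : 'I_N -> R[i],
  \forall x \ae vol, w.1 x = \sum_j c j * (e j).1 x.
Context (C : R).
Hypothesis inverse_estimate : forall w, X w -> grad_norm D w <= C * L2norm vol w.1.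

Definition lin_field (x : 'rV[R[i]]_N) : field :=
  (fun p => \sum_j x 0 j * (e j).1 p, fun l p => \sum_j x 0 j * (e j).2 l p).

(** The trace operator is linear only almost everywhere; combining the traces of the family gives a
    map linear at every point. *)
Definition lin_trace (x : 'rV[R[i]]_N) (p : 'rV[R]_n.+1) : R[i] :=
  \sum_j x 0 j * tr (e j).1 p.

Let field0 : field := (fun=> 0, fun _ _ => 0).

Lemma comb_cancel w : comb (-1) w w = field0.
Proof.
by rewrite /comb /field0; congr pair; do ?[apply/funext => ?]; rewrite mulN1r addNr.
Qed.

Lemma X_field0 : X field0.
Proof. by have [w Xw] := X_neq0; rewrite -(comb_cancel w); exact: X_comb. Qed.

Lemma trace_field0 : \forall p \ae srf, tr field0.1 p = 0.
Proof.
have [w Xw] := X_neq0; have [_ lin _ _] := htr.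
have := lin (-1) w w (X_H1 Xw) (X_H1 Xw); rewrite comb_cancel.
by apply: ae_imply => p ->; rewrite mulN1r addNr.
Qed.

Lemma lin_field_sum (x : 'rV[R[i]]_N) (s : seq 'I_N) :
  let w : field := (fun p => \sum_(j <- s) x 0 j * (e j).1 p,
                    fun l p => \sum_(j <- s) x 0 j * (e j).2 l p) in
  X w /\ \forall p \ae srf, tr w.1 p = \sum_(j <- s) x 0 j * tr (e j).1 p.
Proof.
have [_ lin _ _] := htr.
elim: s => [|j s [Xw trw]] w.
  have -> : w = field0.
    by rewrite /w /field0; congr pair; do ?[apply/funext => ?]; rewrite big_nil.
  split; first exact: X_field0.
  by apply: ae_imply trace_field0 => p ->; rewrite big_nil.
set w0 := (_, _) in Xw; have wE : w = comb (x 0 j) (e j) w0.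
  by rewrite /w /comb /w0; congr pair; do ?[apply/funext => ?]; rewrite big_cons.
rewrite wE; split; first exact: X_comb.
apply: ae_imply2 (lin (x 0 j) _ _ (X_H1 (X_e j)) (X_H1 Xw)) trw => p -> ->.
by rewrite big_cons.
Qed.

Lemma X_lin_field x : X (lin_field x).
Proof. by have [] := lin_field_sum x (index_enum 'I_N). Qed.

Lemma trace_lin_field x : \forall p \ae srf, tr (lin_field x).1 p = lin_trace x p.
Proof. by have [] := lin_field_sum x (index_enum 'I_N). Qed.

Lemma X_L2 w : X w -> [/\ L2 vol w.1, forall l, L2 vol (w.2 l) & L2 srf (tr w.1)].
Proof.
move=> Xw; have [h1 h2 _] := X_H1 Xw; have [h3 _ _ _] := htr.
by split => //; exact: h3 (X_H1 Xw).
Qed.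

Lemma lin_trace_L2 x : L2 srf (lin_trace x).
Proof.
by have [_ _ t0] := X_L2 X_field0; apply: (L2_sum _ _ t0) => j; have [] := X_L2 (X_e j).
Qed.

Lemma lin_field_linear a x y p :
  (lin_field (a *: x + y)).1 p = a * (lin_field x).1 p + (lin_field y).1 p.
Proof.
by rewrite mulr_sumr -big_split; apply: eq_bigr => j _; rewrite !mxE mulrDl mulrA.
Qed.

Lemma lin_grad_linear l a x y p :
  (lin_field (a *: x + y)).2 l p = a * (lin_field x).2 l p + (lin_field y).2 l p.
Proof.
by rewrite mulr_sumr -big_split; apply: eq_bigr => j _; rewrite !mxE mulrDl mulrA.
Qed.

Lemma lin_trace_linear a x y p : lin_trace (a *: x + y) p = a * lin_trace x p + lin_trace y p.
Proof.
by rewrite mulr_sumr -big_split; apply: eq_bigr => j _; rewrite !mxE mulrDl mulrA.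
Qed.

(* Gradients and traces are determined by values thanks to the inverse estimate. *)
Lemma null_field w : X w -> (\forall p \ae vol, w.1 p = 0) ->
  (forall l, \forall p \ae vol, w.2 l p = 0) /\ \forall p \ae srf, tr w.1 p = 0.
Proof.
move=> Xw w0; have [h1 h2 h3] := X_L2 Xw.
have n0 := ae0_L2norm h1 w0.
have g0 : grad_norm D w = 0.
  apply/eqP; rewrite eq_le sqrtr_ge0 andbT.
  by have := inverse_estimate Xw; rewrite n0 mulr0.
have ss l : L2norm vol (w.2 l) = 0.
  move: g0 => /eqP; rewrite sqrtr_eq0 => h.
  have /eqP : \sum_l L2norm vol (w.2 l) ^+ 2 = 0.
    by apply/eqP; rewrite eq_le h sumr_ge0// => i _; exact: sqr_ge0.
  rewrite psumr_eq0 => [|i _]; last exact: sqr_ge0.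
  by move=> /allP/(_ l (mem_index_enum _)); rewrite /= sqrf_eq0 => /eqP.
split=> [l|]; first exact: L2norm_eq0.
have [_ _ [B hB] _] := htr.
apply: L2norm_eq0 => //; apply/eqP; rewrite eq_le sqrtr_ge0 andbT.
have := hB w (X_H1 Xw).
by rewrite /H1_norm n0 g0 expr0n addr0 sqrtr0 mulr0.
Qed.

(** Spanning concerns values only. The difference of [w] and its combination is an element of [X]
    with null values, to which [null_field] applies. *)
Lemma coordinates w : X w -> exists x : 'rV[R[i]]_N,
  [/\ \forall p \ae vol, w.1 p = (lin_field x).1 p,
      forall l, \forall p \ae vol, w.2 l p = (lin_field x).2 l p &
      \forall p \ae srf, tr w.1 p = lin_trace x p].
Proof.
move=> Xw; have [c hc] := X_span Xw; pose x : 'rV[R[i]]_N := \row_j c j.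
have wx : \forall p \ae vol, w.1 p = (lin_field x).1 p.
  apply: ae_imply hc => p ->; apply: eq_bigr => j _; by rewrite mxE.
have Xl := X_lin_field x; have Xd := X_comb (-1) Xl Xw.
have [|dg dt] := null_field Xd.
  by apply: ae_imply wx => p h; rewrite /= h mulN1r addNr.
exists x; split => //.
  move=> l; apply: ae_imply (dg l) => p /eqP; rewrite /= mulN1r addrC subr_eq0.
  by move/eqP.
have [_ lin _ _] := htr.
have := ae_and dt (trace_lin_field x); apply: ae_imply2 (lin (-1) _ _ (X_H1 Xl) (X_H1 Xw)).
move=> p -> [/eqP + <-]; rewrite mulN1r addrC subr_eq0; by move/eqP.
Qed.

Lemma gradient_le_mass x :
  qform (gradient_form vol (fun l y => (lin_field y).2 l) (cst 1)) x <=
  C ^+ 2 * qform (weighted_form vol (fun y => (lin_field y).1) (cst 1)) x.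
Proof.
have [h1 h2 _] := X_L2 (X_lin_field x).
have G1 f : L2 vol f -> Re (weighted_ip vol (cst 1) f f) = L2norm vol f ^+ 2.
  by move=> fL; rewrite weighted_ip1 L2norm_sqr.
rewrite qform_sum.
have -> : \sum_l qform (weighted_form vol (fun y => (lin_field y).2 l) (cst 1)) x =
    grad_norm D (lin_field x) ^+ 2.
  rewrite sqr_sqrtr; last by rewrite sumr_ge0// => l _; exact: sqr_ge0.
  by apply: eq_bigr => l _; exact: G1.
have -> : qform (weighted_form vol (fun y => (lin_field y).1) (cst 1)) x =
   L2norm vol (lin_field x).1 ^+ 2 by exact: G1.
rewrite -exprMn ler_pXn2r ?nnegrE ?sqrtr_ge0//.
  exact: inverse_estimate (X_lin_field x).
exact: le_trans (sqrtr_ge0 _) (inverse_estimate (X_lin_field x)).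
Qed.

End discrete_space.

Section coupled_harmonics_modes.
Context (R : realType) (n : nat) (D : set 'rV[R]_n.+1).
Hypothesis bD : bounded_set D.
Local Notation field := (field R n).
Local Notation vol := (volume D).
Local Notation srf := (surface (boundary D)).
Local Notation T := (caratheodory_type (volume_outer D)).
Local Notation TR := (measurableTypeR R).
Context (tr : ('rV[R]_n.+1 -> R[i]) -> ('rV[R]_n.+1 -> R[i])).
Hypothesis htr : trace_operator D tr.
Context (X : set field) (N : nat) (e : 'I_N -> field).
Hypothesis X_H1 : X `<=` H1 D.
Hypothesis X_neq0 : X !=set0.
Hypothesis X_comb : forall c v w, X v -> X w -> X (comb c v w).
Hypothesis X_e : forall j, X (e j).
Hypothesis X_span : forall w, X w -> exists c : 'I_N -> R[i],
  \forall x \ae vol, w.1 x = \sum_j c j * (e j).1 x.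
Context (C : R).
Hypothesis inverse_estimate : forall w, X w -> grad_norm D w <= C * L2norm vol w.1.
Context (P C0 : R) (kappa : R -> 'rV[R]_n.+1 -> R).
Hypothesis P_gt0 : 0 < P.
Hypothesis mk : measurable_fun setT (fun p : T * TR => kappa p.2 p.1).
Hypotheses (bk : ae_bounded vol kappa) (ck : ae_continuous vol kappa).
Hypothesis kC0 : forall t : R, 0 <= t <= P -> \forall x \ae vol, `|kappa t x| <= C0.
Local Notation val x := (lin_field e x).1.
Local Notation grad := (fun l x => (lin_field e x).2 l).
Local Notation G := (weighted_form vol (fun x => (lin_field e x).1) (cst 1)).

Lemma ip_0l d (U : measurableType d) (mu : {measure set U -> \bar R}) (g : U -> R[i]) :
  ip mu (fun=> 0) g = 0.
Proof.
rewrite /ip (_ : (fun _ : U => _) = fun=> 0) ?cintegral0//.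
by apply/funext => p; rewrite conjC0 mul0r.
Qed.

Lemma coupled_harmonics_modes K (k0 : R) (omega : R[i]) :
  coupled_harmonics_eigenvalue D P kappa k0 tr K X omega ->
  exists u z, modal_eigenvector P K k0 G
    (fun t => gradient_form vol grad (kappa t))
    (weighted_form srf (lin_trace tr e) (cst 1)) omega u z.
Proof.
move=> [u [z [Xu Xz nz eq]]].
have [cu hcu] := choice (fun j => coordinates htr X_H1 X_neq0 X_comb X_e X_span inverse_estimate (Xu j)).
have [cz hcz] := choice (fun j => coordinates htr X_H1 X_neq0 X_comb X_e X_span inverse_estimate (Xz j)).
have XL w := X_L2 htr X_H1 (w := w).
have Xlin := X_lin_field htr X_H1 X_neq0 X_comb X_e.
(* A test vector concentrated in harmonic [j] extracts the equation of that mode. *)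
pose test (j : 'I_K.*2.+1) v j' := lin_field e (if j' == j then v else 0).
have lin0 : lin_field e 0 = (fun=> 0, fun _ _ => 0).
  rewrite /lin_field; congr pair; do ?[apply/funext => ?];
    by rewrite big1// => i _; rewrite mxE mul0r.
have ipD j v F : ipK vol (value (test j v)) F = ip vol (val v) (F j).
  rewrite /ipK (bigD1 j)//= [X in _ + X]big1 ?addr0 => [|i /negbTE ij].
    by rewrite /value /test eqxx.
  by rewrite /value /test ij lin0 ip_0l.
have ipDg j v F l : ipK vol (fun j' => (test j v j').2 l) F = ip vol (grad l v) (F j).
  rewrite /ipK (bigD1 j)//= [X in _ + X]big1 ?addr0 => [|i /negbTE ij].
    by rewrite /test eqxx.
  by rewrite /test ij -[X in ip _ X _]/((lin_field e 0).2 l) lin0 ip_0l.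
have trL x := lin_trace_L2 htr X_H1 X_neq0 X_comb X_e x.
have trE v (j' : 'I_K.*2.+1) : ip srf (tr (lin_field e v).1) (tr (z j').1) =
    ip srf (lin_trace tr e v) (tr (z j').1).
  have [_ _ t1] := XL _ (Xlin v); have [_ _ t2] := XL _ (Xz j').
  apply: ip_ae_eq => //; last exact: aeW.
  exact: (trace_lin_field htr X_H1 X_neq0 X_comb X_e).
have ipS j v : ipK srf (fun j' => tr (value (test j v) j')) (fun j' => tr (value z j')) =
    ip srf (lin_trace tr e v) (tr (z j).1).
  rewrite /ipK (bigD1 j)//= [X in _ + X]big1 ?addr0 => [|i /negbTE ij].
    by rewrite /value /test eqxx trE.
  rewrite /value /test ij trE// (_ : lin_trace tr e 0 = fun=> 0) ?ip_0l//.
  by apply/funext => p; rewrite /lin_trace big1// => l _; rewrite mxE mul0r.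
exists (harmonic_extension cu), (harmonic_extension cz).
apply: (@galerkin_modal_eigenvector _ _ _ (finite_volume bD) _ _ srf P C0 kappa
  P_gt0 mk bk ck kC0 'rV[R[i]]_N n.+1 (fun x => val x) grad (lin_trace tr e)
  (lin_field_linear e) _ _ _ K k0 omega (fun j => (u j).1) (fun j => (z j).1)
  (fun j l => (u j).2 l) (fun j => tr (z j).1) cu cz).
- by move=> x; have [] := XL _ (Xlin x).
- by move=> l x; have [] := XL _ (Xlin x).
- exact: trL.
- by move=> j; have [] := XL _ (Xu j).
- by move=> j; have [] := XL _ (Xz j).
- by move=> j l; have [] := XL _ (Xu j).
- by move=> j; have [] := XL _ (Xz j).
- by move=> j; have [] := hcu j.
- by move=> j; have [] := hcz j.
- by move=> j l; have [] := hcu j.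
- by move=> j; have [] := hcz j.
- move=> j v; have [h _] := eq (test j v) (test j v) (fun j' => Xlin _) (fun j' => Xlin _).
  by rewrite !ipD in h.
- move=> j v; have [_ h] := eq (test j v) (test j v) (fun j' => Xlin _) (fun j' => Xlin _).
  rewrite !ipD ipS in h; rewrite -[RHS]h; congr (_ + _ + _).
  by apply: eq_bigr => l _; rewrite ipDg.
exact: nz.
Qed.

End coupled_harmonics_modes.

Theorem theorem4p2 (R : realType) (d : nat) (D : set 'rV[R]_d.+1)
    (hD : bounded_lipschitz_domain D)
    (tr : ('rV[R]_d.+1 -> R[i]) -> ('rV[R]_d.+1 -> R[i]))
    (htr : trace_operator D tr)
    (P : R) (hP : 0 < P) (kappa0 : R) (hkappa0 : 0 < kappa0)
    (kappa kappa' : R -> 'rV[R]_d.+1 -> R)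
    (hmeas : measurable_fun setT
       (fun p : (caratheodory_type (volume_outer D) * measurableTypeR R)%type => kappa p.2 p.1))
    (hC3 : Cper (volume D) 3 P kappa)
    (hkappa' : Linf_derivative (volume D) kappa kappa')
    (hinf : (0 < ess_inf_on (volume D \x lebesgue_measure)
                   (setT `*` `[0%R, P]) (fun p => (kappa p.2 p.1)%:E))%E)
    (hsup : (ess_sup_on (volume D \x lebesgue_measure)
                   (setT `*` `[0%R, P]) (fun p => (kappa p.2 p.1)%:E) < +oo)%E)
    (X : R -> set (field R d)) (Cinv : R -> R)
    (hX : forall h, 0 < h -> finite_dim_subspace D (X h))
    (hinv : forall h, 0 < h -> forall w, X h w ->
       grad_norm D w <= Cinv h * L2norm (volume D) w.1)
    (hCinv : Cinv h @[h --> 0^'+] --> +oo) :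
  exists C0 : R, 0 < C0 /\
    forall (h : R) (K : nat), 0 < h -> (0 < K)%N ->
      C0 * Cinv h ^+ 2 < K%:R ->
      (forall omega : R[i],
         coupled_harmonics_eigenvalue D P kappa kappa0 tr K (X h) omega ->
         in_first_Brillouin_zone P omega ->
         complex.Im omega <= growth_constant (volume D) P kappa kappa') /\
      (forall omega : R[i],
         coupled_harmonics_eigenvalue D P kappa 0 tr K (X h) omega ->
         in_first_Brillouin_zone P omega ->
         `|complex.Im omega| <= growth_constant (volume D) P kappa kappa').
Proof.
have [_ _ _ bD _] := hD.
pose T := caratheodory_type (volume_outer D).
pose mu := finite_volume bD.
have [mk bk ck pk] := Cper_regular hC3.
have [k1 [dk C2]] : exists k1, Linf_derivative (volume D) kappa k1 /\
    Cper (volume D) 2 P k1 by case: hC3 => _ _ _ [k1 h1 h2]; exists k1.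
have [mk1 bk1 ck1 pk1] := Cper_regular C2.
have dk_ae := Linf_derivative_ae dk.
have [c c_gt0 hc] := ess_inf_lower_bound hinf.
(* The essential infimum is taken in space-time over one period: continuity in L^oo gives the bound
   at every time of the period, periodicity at all times. *)
have kc : forall t, \forall x \ae volume D, c <= kappa t x.
  apply: (ae_periodic_lower_bound hP pk).
  exact: (@ae_slice_lower_bound _ _ _ mu _ _ _ hP hc ck).
have [C0 C0_ge0 kC0] := ae_uniform_bound (ltW hP) bk ck.
have [C1 C1_ge0 kC1] := ae_uniform_bound (ltW hP) bk1 ck1.
pose m t := fine (Linf_norm (volume D) (growth_rate (kappa : R -> T -> R) k1 t)).
have cm : continuous m.
  apply: continuous_Linf_norm; first exact: (growth_rate_bounded c_gt0 kc bk1).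
  exact: (growth_rate_continuous c_gt0 kc ck bk1 ck1).
have mP : m P = m 0.
  rewrite /m; congr fine; apply: eq_Linf_norm.
  have := pk 0; have := pk1 0; rewrite !add0r => p1 p0.
  by apply: ae_imply2 p1 p0 => x h1 h0; rewrite /growth_rate h1 h0.
have m_ge0 t : 0 <= t <= P -> 0 <= m t by move=> _; rewrite fine_ge0// Linf_norm_ge0.
pose RIm := Rintegral lebesgue_measure `[0%R, P] m.
(* The growth constant is twice the mean of [m], although [m] is built from the derivative [k1]
   rather than [kappa']. *)
have growthE : growth_constant (volume D) P kappa kappa' = 2 * (P^-1 * RIm).
  rewrite /growth_constant mulrA; congr (_ * _); apply: eq_Rintegral => t _.
  rewrite /m; congr fine; apply: eq_Linf_norm.
  have := ae_derivative_unique (Linf_derivative_ae hkappa') dk_ae t.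
  by apply: ae_imply => x h; rewrite /growth_rate h.
have Pm : P * (P^-1 * RIm) = RIm by rewrite mulVKf// gt_eqF.
have [r [r_gt0 growth]] := modal_growth hP cm mP m_ge0 Pm c_gt0 C0_ge0 C1_ge0.
(* With [lam = Cinv h ^+ 2], the requirement [lam <= r * K] of [growth] follows from K > r^-1
   Cinv(h)^2. *)
exists r^-1; split; first by rewrite invr_gt0.
move=> h K h_gt0 K_gt0 hK.
have [X_H1 X_neq0 X_comb [N [e [X_e X_span]]]] := hX h h_gt0.
have inv := hinv h h_gt0.
have lamK : Cinv h ^+ 2 <= r * K%:R.
  by rewrite ltW// -ltr_pdivrMl.
have Xlin := X_lin_field htr X_H1 X_neq0 X_comb X_e.
have XL x := X_L2 htr X_H1 (Xlin x).
have tL := lin_trace_L2 htr X_H1 X_neq0 X_comb X_e.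
have valL x : L2 (volume D) (lin_field e x).1 by have [] := XL x.
have gradL l x : L2 (volume D) ((lin_field e x).2 l) by have [] := XL x.
have cf := @weighted_coefficient_forms _ _ _ mu P c C0 C1 kappa k1 c_gt0 mk bk pk
  mk1 bk1 ck1 dk_ae kc kC0 kC1 'rV[R[i]]_N d.+1 (fun x => (lin_field e x).1)
  (fun l x => (lin_field e x).2 l) (lin_field_linear e) valL (lin_grad_linear e) gradL.
pose S := surface (boundary D).
have mS : measurable_fun setT (cst 1%R : caratheodory_type (area_outer (boundary D)) -> R).
  exact: measurable_cst.
have bS : \forall p \ae S, `|cst (1 : R) p| <= 1.
  by apply: aeW => p; rewrite normr1.
pose B := weighted_form S (lin_trace tr e) (cst 1).
have hB : hermitian_form B :=
  @hermitian_weighted_form _ _ _ S _ (lin_trace tr e) (lin_trace_linear tr e) tL _ _ mS bS.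
have B_ge0 x : 0 <= qform B x.
  rewrite /qform /B.
  rewrite -[weighted_form _ _ _ _ _]/(weighted_ip S (cst 1) (lin_trace tr e x) (lin_trace tr e x)).
  by rewrite weighted_ip1 -L2norm_sqr// sqr_ge0.
have SG := gradient_le_mass htr X_H1 X_neq0 X_comb X_e inv.
have modes k0 omega := coupled_harmonics_modes bD htr X_H1 X_neq0 X_comb X_e X_span inv
  hP hmeas bk ck kC0 (K := K) (k0 := k0) (omega := omega).
rewrite growthE; split=> omega ev /andP[Re1 Re2].
  have [u [z me]] := modes _ _ ev.
  apply: (growth _ _ _ _ _ _ _ _ _ _ _ _ cf hB B_ge0 (sqr_ge0 _) SG lamK K_gt0 (ltW hkappa0) me).
  by rewrite (ltW Re1).
have [u [z me]] := modes _ _ ev.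
have ReO : - (frequency P / 2) <= Re omega <= frequency P / 2 by rewrite (ltW Re1).
(* The growth bound is one-sided; applied to the conjugate eigenvalue, which has the same real part,
   it yields the lower bound on Im omega. *)
have [u' [z' me']] := modal_eigenvector_conj hP cf SG me.
rewrite ler_norml; apply/andP; split; last first.
  exact: (growth _ _ _ _ _ _ _ _ _ _ _ _ cf hB B_ge0 (sqr_ge0 _) SG lamK K_gt0 (lexx 0) me).
rewrite lerNl.
have := growth _ _ _ _ _ _ _ _ _ _ _ _ cf hB B_ge0 (sqr_ge0 _) SG lamK K_gt0 (lexx 0) me'.
by rewrite Re_conj Im_conj; apply.
Qed.
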